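(* Let $m\in\mathbb{N}$ and let $\phi\in\mathcal{H}^{\infty}(\mathbb{D})$ be an $m$-folder complex analytic function. Let $M_{\phi}$ be the operator of multiplication by $\phi$ on $\mathcal{H}^{2}(\mathbb{D})$. If for every $z_0\in\mathbb{D}$ the rooter function of $\phi$ at $z_0$ is an outer function, then $\phi$ is a Cowen-Douglas function; more precisely, the adjoint multiplier satisfies $M_{\phi}^{*}\in\mathcal{B}_m(\bar{\phi}(\mathbb{D}))$.
   Context: $\mathbb{D}=\{z\in\mathbb{C}:|z|<1\}$; $\mathbb{N}$ denotes the positive integers. $\mathcal{H}^2(\mathbb{D})$ is the Hardy space of analytic functions $g$ on $\mathbb{D}$ with $\|g\|_{\mathcal{H}^2}^2=\sup_{r<1}\int_{-\pi}^{\pi}|g(re^{i\theta})|^2\frac{d\theta}{2\pi}<\infty$, a Hilbert space. $\mathcal{H}^\infty(\mathbb{D})$ is the Banach algebra of bounded analytic functions on $\mathbb{D}$ with the sup norm. For $\phi\in\mathcal{H}^\infty(\mathbb{D})$, $M_\phi g=\phi g$ is a bounded operator on $\mathcal{H}^2(\mathbb{D})$ with adjoint $M_\phi^*$. Write $\bar\phi(\mathbb{D})=\{\overline{\phi(z)}:z\in\mathbb{D}\}$. Outer function: $h\in\mathcal{H}^2(\mathbb{D})$ is outer if $\{p h: p \text{ a polynomial}\}$ is dense in $\mathcal{H}^2(\mathbb{D})$. $m$-folder function and rooter function: a non-constant analytic function $\phi$ on $\mathbb{D}$ is an $m$-folder complex analytic function on $\mathbb{D}$ if for every $z_0\in\mathbb{D}$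 there are a monic polynomial $p_{z_0}$ of degree $m$ (the same $m$ for all $z_0$), all of whose roots lie in $\mathbb{D}$, and an analytic function $h_{z_0}$ on $\mathbb{D}$ with no zeros in $\mathbb{D}$, such that $\phi(z)-\phi(z_0)=p_{z_0}(z)h_{z_0}(z)$ for all $z\in\mathbb{D}$. The function $h_{z_0}$ is called the rooter function of $\phi$ at $z_0$. Cowen-Douglas class: for a connected open set $\Omega\subset\mathbb{C}$, $n\in\mathbb{N}$ and a Hilbert space $\mathbb{H}$, $\mathcal{B}_n(\Omega)$ is the set of bounded linear operators $T$ on $\mathbb{H}$ such that (1) $\Omega\subset\sigma(T)=\{\omega\in\mathbb{C}:T-\omega\text{ is not invertible}\}$; (2) $\mathrm{ran}(T-\omega)=\mathbb{H}$ for every $\omega\in\Omega$; (3) the closed linear span of $\bigcup_{\omega\in\Omega}\ker(T-\omega)$ is $\mathbb{H}$; (4) $\dim\ker(T-\omega)=n$ for every $\omega\in\Omega$. Cowen-Douglas function: $\phi\in\mathcal{H}^\infty(\mathbb{D})$ is a Cowen-Douglas function if $M_\phi^*\in\mathcal{B}_n(\bar\phi(\mathbb{D}))$ (with $\mathbb{H}=\mathcal{H}^2(\mathbb{D})$) for some $n\in\mathbb{N}$. *)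

(* Defs.v *)
From HB Require Import structures.
From mathcomp Require Import all_boot all_order all_algebra.
From mathcomp Require Import complex.
From mathcomp Require Import all_classical all_reals all_analysis measurable_realfun.
From mathcomp Require Import ring lra.

Set Implicit Arguments.
Unset Strict Implicit.
Unset Printing Implicit Defensive.

Import Order.TTheory GRing.Theory Num.Theory numFieldNormedType.Exports.
Import Normc.

Local Open Scope classical_set_scope.
Local Open Scope ring_scope.
Local Open Scope complex_scope.

Section Operators.
Variables (R : realType) (V : normedModType R[i]).
Implicit Types (S T A : V -> V) (w : R[i]) (K : set V).

Definition bounded_operator T :=
  linear T /\ exists k : R[i], forall v, `|T v| <= k * `|v|.

Definition shift_op T w : V -> V := fun v => T v - w *: v.

Definition invertible_operator T :=
  exists S, [/\ bounded_operator S, cancel T S & cancel S T].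

Definition spectrum T : set R[i] :=
  [set w | ~ invertible_operator (shift_op T w)].

Definition ker_op T : set V := [set v | T v = 0].

Definition linear_span K : set V :=
  [set v | exists n (c : 'I_n -> R[i]) (e : 'I_n -> V),
     (forall i, K (e i)) /\ v = \sum_i c i *: e i].

(* V need not be finite-dimensional, so vector.v's \dim does not apply: the
   subspace K has dimension n when it has a basis with n elements. *)
Definition has_dim K (n : nat) :=
  exists e : 'I_n -> V,
    (forall c : 'I_n -> R[i], \sum_i c i *: e i = 0 -> forall i, c i = 0) /\
    K = [set v | exists c : 'I_n -> R[i], v = \sum_i c i *: e i].

(* B_n(Omega); the class is only considered for open connected Omega, which is
   therefore part of membership.  The topology of the complex plane is found
   on R[i]^o. *)
Definition cowen_douglas_class (n : nat) (Omega : set R[i]) T :=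
  [/\ open (Omega : set R[i]^o), connected (Omega : set R[i]^o)
    & bounded_operator T] /\
  [/\ Omega `<=` spectrum T,
      forall w, Omega w -> range (shift_op T w) = setT,
      closure (linear_span (\bigcup_(w in Omega) ker_op (shift_op T w))) = setT
    & forall w, Omega w -> has_dim (ker_op (shift_op T w)) n].

(* When the norm of V is a Hilbert space norm, this is its inner product
   (linear in u), by the polarization identity. *)
Definition inner (u v : V) : R[i] :=
  4^-1 * \sum_(k < 4) 'i ^+ k * `|u + 'i ^+ k *: v| ^+ 2.

Definition adjoint_of T A := forall u v, inner (T u) v = inner u (A v).

End Operators.

Section Disc.
Variable R : realType.

Record disc := Disc { disc_val :> R[i]; disc_lt1 : `|disc_val| < 1 }.
HB.instance Definition _ := [isSub for disc_val].
HB.instance Definition _ := [Choice of disc by <:].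

Definition analytic (f : disc -> R[i]) :=
  forall z0 : disc, exists (a : nat -> R[i]) (r : R), 0 < r /\
    forall z : disc, `|disc_val z - disc_val z0| < r%:C ->
      (series (fun n => a n * (disc_val z - disc_val z0) ^+ n) : nat -> R[i]^o)
        @ \oo --> (f z : R[i]^o).

Lemma disc0_subproof : `|0 : R[i]| < 1. Proof. by rewrite normr0. Qed.
Definition disc0 := Disc disc0_subproof.

(* r e^(it); the default value disc0 is only taken when r is not in ]-1, 1[. *)
Definition polar (r t : R) : disc :=
  insubd disc0 ((r * cos t) +i* (r * sin t)).

Definition circ (f : disc -> R[i]) (r t : R) : \bar R :=
  (normc (f (polar r t)) ^+ 2 / (2 * pi))%:E.

Definition circle_mean (f : disc -> R[i]) (r : R) : \bar R :=
  (\int[lebesgue_measure]_(t in `[(- pi)%R, pi%R]) circ f r t)%E.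

Definition hardy_norm2 (f : disc -> R[i]) : \bar R :=
  ereal_sup [set circle_mean f r | r in `[0, 1[].

Definition hardy2 : {pred disc -> R[i]} :=
  [pred f | `[< analytic f /\ (hardy_norm2 f < +oo)%E >]].

Lemma cvgCP (u : nat -> R[i]) (l : R[i]) :
  ((u : nat -> R[i]^o) @ \oo --> (l : R[i]^o)) <->
  forall e : R, 0 < e -> exists N, forall n, (N <= n)%N -> normc (l - u n) < e.
Proof.
split => [ul e e0|H].
  have e0' : 0 < e%:C by rewrite ltcR.
  move/cvgrPdist_lt : ul => /(_ _ e0') [N _ HN].
  by exists N => n Nn; have := HN n Nn; rewrite -ltcR.
apply/cvgrPdist_lt => e e0.
have eR : e = (complex.Re e)%:C by apply/esym/RRe_real/gtr0_real.
rewrite eR ltcR in e0.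
have [N HN] := H _ e0; exists N => // n /= Nn.
by rewrite eR; have := HN n Nn; rewrite -ltcR.
Qed.

Lemma normcB_sym (x y : R[i]) : normc (x - y) = normc (y - x).
Proof. by rewrite -opprB (@normcN R). Qed.

Lemma normc_ge0 (x : R[i]) : 0 <= normc x.
Proof. by case: x => a b; exact: sqrtr_ge0. Qed.

Lemma normcX (x : R[i]) n : normc (x ^+ n) = normc x ^+ n.
Proof. by elim: n => [|n IH]; rewrite ?normc1// !exprS normcM IH. Qed.

Lemma normcD (x y : R[i]) : normc (x + y) <= normc x + normc y.
Proof. exact: (@le_normcD R). Qed.

Lemma normc_sum n (F : 'I_n -> R[i]) : normc (\sum_i F i) <= \sum_i normc (F i).
Proof.
elim/big_ind2: _ => [|x1 x2 y1 y2 h1 h2|//]; first by rewrite normc0.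
by rewrite (le_trans (normcD _ _))// lerD.
Qed.

End Disc.

Section Analytic.
Variable R : realType.
Implicit Types f g : disc R -> R[i].

Lemma half_geo_le2 (q : R) n : 0 <= q -> q <= 2^-1 -> \sum_(i < n) q ^+ i <= 2.
Proof.
move=> q0 q1; elim: n => [|n IH]; first by rewrite big_ord0.
rewrite big_ord_recl expr0 (eq_bigr (fun i : 'I_n => q * q ^+ i)) => [|i _]; last by rewrite -exprS.
rewrite -mulr_sumr.
have : q * \sum_(i < n) q ^+ i <= 2^-1 * 2.
  by apply: ler_pM => //; apply: sumr_ge0 => i _; rewrite exprn_ge0.
by rewrite mulVf ?pnatr_eq0//; lra.
Qed.

Lemma analytic_bound f (z0 : disc R) : analytic f ->
  exists (a : nat -> R[i]) (M rho : R), [/\ 0 < rho, 0 < M,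
    (forall n, normc (a n) * rho ^+ n <= M) &
    forall z : disc R, normc (disc_val z - disc_val z0) < rho ->
      forall e : R, 0 < e -> exists N, forall n, (N <= n)%N ->
        normc (f z - \sum_(k < n) a k * (disc_val z - disc_val z0) ^+ k) < e].
Proof.
move=> /(_ z0) [a [r [r0 H]]].
have z01 : 0 < 1 - normc (disc_val z0).
  by rewrite subr_gt0 -ltcR; exact: disc_lt1.
have H' (z : disc R) : normc (disc_val z - disc_val z0) < r ->
      forall e : R, 0 < e -> exists N, forall n, (N <= n)%N ->
        normc (f z - \sum_(k < n) a k * (disc_val z - disc_val z0) ^+ k) < e.
  move=> zr e e0; have /H/cvgCP/(_ _ e0)[N HN] : `|disc_val z - disc_val z0| < r%:C.
    by rewrite -ltcR in zr.
  by exists N => n /HN; rewrite /series /= big_mkord.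
pose rho := Num.min r (1 - normc (disc_val z0)) / 2.
have rho0 : 0 < rho by rewrite divr_gt0// lt_min r0.
have rhor : rho < r.
  rewrite ltr_pdivrMr//; apply: (@le_lt_trans _ _ r); first by rewrite ge_min lexx.
  by rewrite ltr_pMr// ltr1n.
have rho1 : rho < 1 - normc (disc_val z0).
  rewrite ltr_pdivrMr//; apply: (@le_lt_trans _ _ (1 - normc (disc_val z0))).
    by rewrite ge_min lexx orbT.
  by rewrite ltr_pMr// ltr1n.
have nrho : normc rho%:C = rho.
  by rewrite /= expr0n/= addr0 sqrtr_sqr gtr0_norm.
have w1 : `|disc_val z0 + rho%:C| < 1.
  rewrite -[X in X < _]/((normc (disc_val z0 + rho%:C))%:C) -[1]/(1%:C) ltcR.
  apply: le_lt_trans (normcD _ _) _; rewrite nrho; lra.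
have zw : disc_val (Disc w1) - disc_val z0 = rho%:C by rewrite /= addrC addKr.
have w1r : normc (disc_val (Disc w1) - disc_val z0) < r by rewrite zw nrho.
have [N] := H' _ w1r _ ltr01; rewrite zw => HN.
pose S n := \sum_(k < n) a k * rho%:C ^+ k.
have tE n : normc (a n) * rho ^+ n = normc (S n.+1 - S n).
  by rewrite /S big_ord_recr/= [_ + a n * _]addrC addrK normcM normcX nrho.
exists a, (2 + \sum_(k < N) normc (a k) * rho ^+ k), rho; split => //.
- rewrite ltr_wpDr//; apply: sumr_ge0 => k _.
  by rewrite mulr_ge0 ?normc_ge0// exprn_ge0// ltW.
- move=> n; have [Nn|nN] := leqP N n.
    rewrite tE; have -> : S n.+1 - S n = (f (Disc w1) - S n) - (f (Disc w1) - S n.+1) by ring.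
    rewrite (le_trans (normcD _ _))// normcN.
    have := HN n Nn; have := HN n.+1 (leqW Nn); rewrite -/(S _) -/(S _).
    have : 0 <= \sum_(k < N) normc (a k) * rho ^+ k.
      apply: sumr_ge0 => k _.
      by rewrite mulr_ge0 ?normc_ge0// exprn_ge0// ltW.
    by lra.
  rewrite (bigD1 (Ordinal nN))//= addrCA lerDl addr_ge0//; apply: sumr_ge0 => k _.
  by rewrite mulr_ge0 ?normc_ge0// exprn_ge0// ltW.
- by move=> z zr; apply: H'; rewrite (lt_trans zr).
Qed.

Lemma normc_lim_le (l c : R[i]) (u : nat -> R[i]) (M : R) :
  (forall e : R, 0 < e -> exists N, forall n, (N <= n)%N -> normc (l - u n) < e) ->
  (exists N, forall n, (N <= n)%N -> normc (u n - c) <= M) -> normc (l - c) <= M.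
Proof.
move=> ul [N1 uM]; rewrite leNgt; apply/negP => Ml.
have e0 : 0 < normc (l - c) - M by rewrite subr_gt0.
have [N /(_ (maxn N N1) (leq_maxl _ _)) HN] := ul _ e0.
have := uM (maxn N N1) (leq_maxr _ _).
have : normc (l - c) <= normc (l - u (maxn N N1)) + normc (u (maxn N N1) - c).
  by apply: le_trans (normcD _ _); rewrite addrA subrK.
by lra.
Qed.

Lemma term_bound (x M rho w : R) n : 0 < rho -> 0 <= w ->
  x * rho ^+ n <= M -> x * w ^+ n <= M * (w / rho) ^+ n.
Proof.
move=> rho0 w0 xM; rewrite expr_div_n mulrA [M * _]mulrC -mulrA mulrC.
by rewrite ler_wpM2l ?exprn_ge0// ler_pdivlMr ?exprn_gt0.
Qed.

Lemma analytic_continuous f (z0 : disc R) : analytic f ->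
  forall e : R, 0 < e -> exists2 d : R, 0 < d & forall z : disc R,
    normc (disc_val z - disc_val z0) < d -> normc (f z - f z0) < e.
Proof.
move=> af e e0; have [a [M [rho [rho0 M0 aM H]]]] := analytic_bound z0 af.
have fa0 : f z0 = a 0.
  apply/eqP; rewrite -subr_eq0; apply/eqP/eq0_normc/le_anti; rewrite normc_ge0 andbT.
  have z0r : normc (disc_val z0 - disc_val z0) < rho by rewrite subrr normc0.
  apply: (normc_lim_le (H z0 z0r)).
  exists 1%N => -[//|n] _; rewrite big_ord_recl/= expr0 mulr1 big1 ?addr0 ?subrr ?normc0//.
  by move=> i _; rewrite ?subrr expr0n mulr0.
pose d := Num.min (rho / 2) (e * rho / (2 * M + 1)).
have d0 : 0 < d by rewrite lt_min !divr_gt0 ?mulr_gt0//; lra.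
exists d => // z zd.
set w := disc_val z - disc_val z0 in zd.
have wr : normc w < rho / 2 by rewrite (lt_le_trans zd)// ge_min lexx.
have we : normc w < e * rho / (2 * M + 1).
  by rewrite (lt_le_trans zd)// ge_min lexx orbT.
rewrite fa0; apply: (@le_lt_trans _ _ (2 * M * (normc w / rho))); last first.
  rewrite mulrA ltr_pdivrMr//.
  rewrite ltr_pdivlMr in we; last lra.
  have := normc_ge0 w; nra.
have q0 : 0 <= normc w / rho by rewrite divr_ge0 ?normc_ge0 ?ltW.
have q1 : normc w / rho <= 2^-1 by rewrite ler_pdivrMr// mulrC ltW.
have zr : normc (disc_val z - disc_val z0) < rho.
  by rewrite (lt_trans wr)// ltr_pdivrMr// ltr_pMr// ltr1n.
apply: (normc_lim_le (H z zr)).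
exists 1%N => -[//|n] _; rewrite big_ord_recl/= expr0 mulr1 addrC addKr.
rewrite (le_trans (normc_sum _))//.
apply: (@le_trans _ _ (\sum_(i < n) M * (normc w / rho) * (normc w / rho) ^+ i)).
  apply: ler_sum => i _; rewrite -mulrA -exprS -/w normcM normcX.
  by apply: term_bound => //; exact: normc_ge0.
rewrite -mulr_sumr -[leRHS]mulrA [leRHS]mulrC ler_wpM2l ?half_geo_le2//.
by rewrite mulr_ge0// ltW.
Qed.

End Analytic.

Section AnalyticAlgebra.
Variable R : realType.
Implicit Types f g : disc R -> R[i].

Lemma analytic_intro f :
  (forall z0 : disc R, exists (a : nat -> R[i]) (r : R), 0 < r /\
    forall z : disc R, normc (disc_val z - disc_val z0) < r ->
      forall e : R, 0 < e -> exists N, forall n, (N <= n)%N ->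
        normc (f z - \sum_(k < n) a k * (disc_val z - disc_val z0) ^+ k) < e) ->
  analytic f.
Proof.
move=> H z0; have [a [r [r0 Hr]]] := H z0; exists a, r; split => // z.
rewrite -[X in X < _]/((normc _)%:C) ltcR => /Hr{}Hr.
by apply/cvgCP => e /Hr[N HN]; exists N => n /HN; rewrite /series /= big_mkord.
Qed.

Lemma analytic_cst (c : R[i]) : analytic (fun _ : disc R => c).
Proof.
apply: analytic_intro => z0; exists (fun n => if n is 0%N then c else 0), 1; split => // z _ e e0.
exists 1%N => -[//|n] _; rewrite big_ord_recl/= expr0 mulr1 big1 ?addr0 ?subrr ?normc0//.
by move=> i _; rewrite mul0r.
Qed.

Lemma analyticD f g : analytic f -> analytic g -> analytic (fun z => f z + g z).
Proof.
move=> af ag; apply: analytic_intro => z0.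
have [a [M [r [r0 _ _ Hf]]]] := analytic_bound z0 af.
have [b [M' [s [s0 _ _ Hg]]]] := analytic_bound z0 ag.
exists (fun n => a n + b n), (Num.min r s); split; first by rewrite lt_min r0.
move=> z; rewrite lt_min => /andP[zr zs] e e0.
have e2 : 0 < e / 2 by rewrite divr_gt0.
have [N HN] := Hf z zr _ e2; have [N' HN'] := Hg z zs _ e2.
exists (maxn N N') => n; rewrite geq_max => /andP[/HN h1 /HN' h2].
rewrite (eq_bigr (fun k : 'I_n => a k * (disc_val z - disc_val z0) ^+ k +
   b k * (disc_val z - disc_val z0) ^+ k)) => [|i _]; last by rewrite mulrDl.
rewrite big_split/= opprD addrACA (le_lt_trans (normcD _ _))//; lra.
Qed.

Lemma cauchy_prod_sum (x y : nat -> R[i]) n :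
  \sum_(k < n) \sum_(i < k.+1) x i * y (k - i)%N =
  \sum_(i < n) x i * \sum_(j < n - i) y j.
Proof.
elim: n => [|n IH]; first by rewrite !big_ord0.
rewrite big_ord_recr/= IH [in RHS]big_ord_recr/= [in LHS]big_ord_recr/= addrA.
rewrite subnn subSn// subnn big_ord1; congr (_ + _).
rewrite -big_split/=; apply: eq_bigr => i _.
by rewrite -mulrDr subSn ?big_ord_recr// ltnW.
Qed.

Lemma cauchy_prod_bound (x y : nat -> R[i]) (M M' : R) n : 0 <= M -> 0 <= M' ->
  (forall n, normc (x n) <= M * 4^-1 ^+ n) ->
  (forall n, normc (y n) <= M' * 4^-1 ^+ n) ->
  normc ((\sum_(k < n) x k) * (\sum_(k < n) y k) -
    \sum_(k < n) \sum_(i < k.+1) x i * y (k - i)%N) <= 2 * M * M' * 2^-1 ^+ n.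
Proof.
move=> M0 M'0 xM yM; rewrite cauchy_prod_sum mulr_suml -sumrB.
rewrite (le_trans (normc_sum _))//.
apply: (@le_trans _ _ (\sum_(i < n) 2 * M * M' * 4^-1 ^+ n)); last first.
  rewrite sumr_const card_ord -mulrnAr ler_wpM2l ?mulr_ge0//.
  have -> : (4^-1 : R) = 2^-1 * 2^-1 by rewrite -invfM -natrM.
  rewrite exprMn -mulrnAl -[leRHS]mul1r ler_wpM2r ?exprn_ge0//.
  rewrite -mulr_natl exprVn ler_pdivrMr ?exprn_gt0// mul1r -natrX ler_nat.
  by rewrite ltnW// ltn_expl.
apply: ler_sum => i _; rewrite -mulrBr normcM.
have -> : \sum_(k < n) y k - \sum_(j < n - i) y j = \sum_(j < i) y (n - i + j)%N.
  rewrite -(big_mkord xpredT y) (big_cat_nat (n := n - i)%N)//= ?leq_subr//.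
  rewrite big_mkord [X in X - _]addrC addrK -{1}[(n - i)%N]add0n big_addn subKn ?big_mkord; last exact: ltnW.
  by apply: eq_bigr => j _; rewrite addnC.
have : normc (\sum_(j < i) y (n - i + j)%N) <= M' * 4^-1 ^+ (n - i) * 2.
  apply: (le_trans (normc_sum _)).
  apply: (@le_trans _ _ (\sum_(j < i) M' * 4^-1 ^+ (n - i) * 4^-1 ^+ j)).
    by apply: ler_sum => j _; rewrite -mulrA -exprD.
  by rewrite -mulr_sumr ler_wpM2l ?mulr_ge0 ?exprn_ge0// half_geo_le2//; lra.
move=> /(ler_pM (normc_ge0 _) (normc_ge0 _) (xM i)) /le_trans; apply.
have -> : (4^-1 : R) ^+ n = 4^-1 ^+ (n - i) * 4^-1 ^+ i by rewrite -exprD subnK// ltnW.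
by rewrite le_eqVlt; apply/orP; left; apply/eqP; ring.
Qed.

Lemma analyticM f g : analytic f -> analytic g -> analytic (fun z => f z * g z).
Proof.
move=> af ag; apply: analytic_intro => z0.
have [a [M [r [r0 M0 aM Hf]]]] := analytic_bound z0 af.
have [b [M' [s [s0 M'0 bM Hg]]]] := analytic_bound z0 ag.
exists (fun n => \sum_(i < n.+1) a i * b (n - i)%N), (Num.min r s / 4); split.
  by rewrite divr_gt0// lt_min r0.
move=> z; rewrite ltr_pdivlMr// lt_min => /andP[zr zs] e e0.
set w := disc_val z - disc_val z0 in zr zs *.
have w0 := normc_ge0 w.
have zr' : normc w < r by apply: le_lt_trans zr; rewrite ler_peMr// ler1n.
have zs' : normc w < s by apply: le_lt_trans zs; rewrite ler_peMr// ler1n.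
pose x n := a n * w ^+ n; pose y n := b n * w ^+ n.
have xM n : normc (x n) <= M * 4^-1 ^+ n.
  rewrite normcM normcX (le_trans (term_bound r0 w0 (aM n)))// ler_wpM2l ?(ltW M0)//.
  rewrite lerXn2r ?nnegrE ?divr_ge0 ?(ltW r0)//.
  by rewrite ler_pdivrMr// mulrC ler_pdivlMr// ltW.
have yM n : normc (y n) <= M' * 4^-1 ^+ n.
  rewrite normcM normcX (le_trans (term_bound s0 w0 (bM n)))// ler_wpM2l ?(ltW M'0)//.
  rewrite lerXn2r ?nnegrE ?divr_ge0 ?(ltW s0)//.
  by rewrite ler_pdivrMr// mulrC ler_pdivlMr// ltW.
have /cvgCP/(_ _ (divr_gt0 e0 (ltr0Sn _ 1)))[N HN] :
  (fun n => (\sum_(k < n) x k) * (\sum_(k < n) y k) : R[i]^o) @ \oo --> (f z * g z : R[i]^o).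
  by apply: (@cvgM R[i]); apply/cvgCP => d d0; [exact: Hf|exact: Hg].
have [N' HN'] : exists N, forall n, (N <= n)%N -> 2 * M * M' * 2^-1 ^+ n < e / 2.
  have : (fun n => 2 * M * M' * 2^-1 ^+ n) @ \oo --> (0 : R).
    rewrite -(mulr0 (2 * M * M')); apply: cvgMr; apply: cvg_expr.
    by rewrite ger0_norm ?invr_ge0// invf_lt1// ltr1n.
  move=> /cvgrPdist_lt/(_ _ (divr_gt0 e0 (ltr0Sn _ 1)))[K _ HK].
  exists K => n /HK /=; rewrite sub0r normrN ger0_norm// ?mulr_ge0 ?exprn_ge0 ?ltW//.
exists (maxn N N') => n; rewrite geq_max => /andP[/HN h1 /HN' h2].
rewrite (eq_bigr (fun k : 'I_n => \sum_(i < k.+1) x i * y (k - i)%N)); last first.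
  move=> k _; rewrite mulr_suml; apply: eq_bigr => i _.
  by rewrite /x /y mulrACA -exprD subnKC// -ltnS.
have h3 := cauchy_prod_bound n (ltW M0) (ltW M'0) xM yM.
have -> : f z * g z - \sum_(k < n) \sum_(i < k.+1) x i * y (k - i)%N =
    (f z * g z - (\sum_(k < n) x k) * (\sum_(k < n) y k)) +
    ((\sum_(k < n) x k) * (\sum_(k < n) y k) -
     \sum_(k < n) \sum_(i < k.+1) x i * y (k - i)%N).
  by rewrite addrA subrK.
rewrite (le_lt_trans (normcD _ _))// (splitr e) ltrD//.
exact: le_lt_trans h3 h2.
Qed.

End AnalyticAlgebra.

Section HardyNorm.
Variable R : realType.
Implicit Types f g : disc R -> R[i].
Local Notation mu := (@lebesgue_measure R).

Lemma polar_val (r t : R) : 0 <= r < 1 ->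
  disc_val (polar r t) = (r * cos t) +i* (r * sin t).
Proof.
move=> /andP[r0 r1]; rewrite /polar insubdK//=.
rewrite -[_ \in _]/((normc _)%:C < 1%:C) ltcR /=.
by rewrite !exprMn -mulrDr cos2Dsin2 mulr1 sqrtr_sqr ger0_norm.
Qed.

Lemma continuous_polar f (r : R) : analytic f -> 0 <= r < 1 ->
  continuous (fun t : R => normc (f (polar r t))).
Proof.
move=> af r01 t0; have [r0 r1] := andP r01.
apply/cvgrPdist_lt => e e0.
have [d d0 Hd] := analytic_continuous (polar r t0) af e0.
have d2 : 0 < d / 2 by rewrite divr_gt0.
have /cvgrPdist_lt/(_ _ d2) hc := @continuous_cos R t0.
have /cvgrPdist_lt/(_ _ d2) hs := @continuous_sin R t0.
near=> t.
have dist : normc (f (polar r t) - f (polar r t0)) < e.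
  apply: Hd; rewrite !polar_val//.
  have -> : (r * cos t +i* (r * sin t)) - (r * cos t0 +i* (r * sin t0)) =
      (r * (cos t - cos t0))%:C + 'i%C * (r * (sin t - sin t0))%:C :> R[i].
    by simpc; congr (_ +i* _); ring.
  apply: (le_lt_trans (normcD _ _)); rewrite normcM.
  have nR (x : R) : normc x%:C = `|x| by rewrite /= expr0n/= addr0 sqrtr_sqr.
  rewrite !nR -[normc 'i%C]/(Num.sqrt (0 ^+ 2 + 1 ^+ 2)) expr0n/= expr1n add0r sqrtr1 mul1r.
  rewrite !normrM (ger0_norm r0) -mulrDr.
  apply: (@le_lt_trans _ _ (`|cos t - cos t0| + `|sin t - sin t0|)).
    by rewrite ler_piMl ?addr_ge0// ltW.
  rewrite (splitr d) ltrD// distrC.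
    by near: t.
  by near: t.
apply: le_lt_trans dist; rewrite distrC.
have h1 : normc (f (polar r t)) <= normc (f (polar r t) - f (polar r t0)) + normc (f (polar r t0)).
  by apply: le_trans (normcD _ _); rewrite subrK.
have h2 : normc (f (polar r t0)) <= normc (f (polar r t0) - f (polar r t)) + normc (f (polar r t)).
  by apply: le_trans (normcD _ _); rewrite subrK.
rewrite normcB_sym in h2.
by rewrite ler_norml; apply/andP; split; lra.
Unshelve. all: by end_near. Qed.

Lemma circ_ge0 f r t : (0 <= circ f r t)%E.
Proof. by rewrite lee_fin divr_ge0 ?sqr_ge0// mulr_ge0// pi_ge0. Qed.

Lemma continuous_circ f (r : R) : analytic f -> 0 <= r < 1 ->
  continuous (fun t : R => normc (f (polar r t)) ^+ 2 / (2 * pi)).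
Proof.
move=> af r01 t; apply: cvgM; last exact: cvg_cst.
by under eq_fun do rewrite expr2; apply: cvgM; exact: continuous_polar.
Qed.

Lemma measurable_circ f (r : R) : analytic f -> 0 <= r < 1 ->
  measurable_fun (`[(- pi)%R, pi]%classic : set R) (circ f r).
Proof.
move=> af r01; apply/measurable_EFinP; apply: measurable_funTS.
by apply: continuous_measurable_fun; exact: continuous_circ.
Qed.

Lemma circle_mean_ge0 f r : (0 <= circle_mean f r)%E.
Proof. by apply: integral_ge0 => t _; exact: circ_ge0. Qed.

Lemma circle_mean_le_hardy f r : 0 <= r < 1 -> (circle_mean f r <= hardy_norm2 f)%E.
Proof. by move=> r01; apply: ereal_sup_ubound; exists r => //; rewrite /= in_itv. Qed.

Lemma hardy_norm2_ge0 f : (0 <= hardy_norm2 f)%E.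
Proof.
apply: le_trans (circle_mean_ge0 f 0) (circle_mean_le_hardy f _).
by rewrite lexx ltr01.
Qed.

Lemma hardy_norm2D f g (s : R) : analytic f -> analytic g -> 0 < s ->
  (hardy_norm2 (fun z => (f z + g z)%R) <=
   (1 + s)%:E * hardy_norm2 f + (1 + s^-1)%:E * hardy_norm2 g)%E.
Proof.
move=> af ag s0; apply: ge_ereal_sup => _ [r /= + <-]; rewrite in_itv/= => r01.
have s1 : 0 < s^-1 by rewrite invr_gt0.
apply: (@le_trans _ _ ((1 + s)%:E * circle_mean f r + (1 + s^-1)%:E * circle_mean g r)%E); last first.
  by apply: leeD; rewrite lee_pmul2l ?circle_mean_le_hardy// lte_fin addr_gt0.
have mf := measurable_circ af r01; have mg := measurable_circ ag r01.
have s1' : 0 <= 1 + s by rewrite addr_ge0// ltW.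
have s2' : 0 <= 1 + s^-1 by rewrite addr_ge0// ltW.
have F0 (k : R) h t : 0 <= k -> (0 <= k%:E * circ h r t)%E.
  by move=> k0; rewrite mule_ge0 ?circ_ge0// lee_fin.
have mF (k : R) h : measurable_fun (`[(- pi)%R, pi]%classic : set R) (circ h r) ->
    measurable_fun (`[(- pi)%R, pi]%classic : set R) (fun t => (k%:E * circ h r t)%E).
  by move=> mh; exact: measurable_funeM.
have eqZ (k : R) h : 0 <= k -> analytic h ->
    (k%:E * circle_mean h r = \int[mu]_(t in `[(- pi)%R, pi]) (k%:E * circ h r t))%E.
  move=> k0 ah; rewrite ge0_integralZl_EFin//; last exact: measurable_circ.
  by move=> t _; exact: circ_ge0.
rewrite !eqZ// -ge0_integralD//; [|by move=> t _; exact: F0|exact: mF|by move=> t _; exact: F0|exact: mF].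
apply: ge0_le_integral => //.
- by move=> t _; exact: (circ_ge0 (fun z => f z + g z)).
- exact: (measurable_circ (analyticD af ag) r01).
- by apply: emeasurable_funD; exact: mF.
move=> t _; rewrite -!EFinM -EFinD lee_fin !mulrA -mulrDl.
rewrite ler_wpM2r ?invr_ge0 ?mulr_ge0 ?pi_ge0//.
have := normcD (f (polar r t)) (g (polar r t)).
have := normc_ge0 (f (polar r t) + g (polar r t)).
set a := normc (f _); set b := normc (g _); set c := normc _ => c0 cab.
apply: (@le_trans _ _ ((a + b) ^+ 2)); first by rewrite lerXn2r ?nnegrE// (le_trans c0).
suff : 0 <= s * (a - s^-1 * b) ^+ 2.
  have -> : s * (a - s^-1 * b) ^+ 2 = (1 + s) * a ^+ 2 + (1 + s^-1) * b ^+ 2 - (a + b) ^+ 2.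
    by field; exact: lt0r_neq0.
  by rewrite subr_ge0 -!mulrA -!expr2.
by rewrite mulr_ge0 ?sqr_ge0// ltW.
Qed.

Lemma hardy_norm2M f g (B : R) : analytic f -> analytic g -> 
  (forall z, normc (f z) <= B) ->
  (hardy_norm2 (fun z => (f z * g z)%R) <= (B ^+ 2)%:E * hardy_norm2 g)%E.
Proof.
move=> af ag fB; apply: ge_ereal_sup => _ [r /= + <-]; rewrite in_itv/= => r01.
apply: (@le_trans _ _ ((B ^+ 2)%:E * circle_mean g r)%E); last first.
  by rewrite lee_wpmul2l ?circle_mean_le_hardy// lee_fin sqr_ge0.
have mg := measurable_circ ag r01.
rewrite -ge0_integralZl_EFin ?sqr_ge0//; last by move=> t _; exact: circ_ge0.
apply: ge0_le_integral => //.
- by move=> t _; exact: (circ_ge0 (fun z => f z * g z)).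
- exact: (measurable_circ (analyticM af ag) r01).
- by apply: measurable_funeM.
move=> t _; rewrite -!EFinM lee_fin mulrA normcM exprMn.
rewrite ler_wpM2r ?invr_ge0 ?mulr_ge0 ?pi_ge0//.
have B0 : 0 <= B := le_trans (normc_ge0 _) (fB (polar r t)).
by rewrite ler_wpM2r ?sqr_ge0// lerXn2r ?nnegrE ?normc_ge0.
Qed.

Lemma polar_surj (z : disc R) : exists r t : R,
  [/\ 0 <= r < 1, - pi <= t <= pi & z = polar r t].
Proof.
have z1 : normc (disc_val z) < 1 by rewrite -ltcR; exact: disc_lt1.
have zr : 0 <= normc (disc_val z) < 1 by rewrite normc_ge0 z1.
have [z0|z0] := eqVneq (normc (disc_val z)) 0.
  exists 0, 0; split; rewrite ?lexx ?ltr01 ?oppr_le0 ?pi_ge0//.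
  by apply: val_inj; rewrite /= polar_val ?lexx ?ltr01// !mul0r (eq0_normc z0).
have {}z0 : 0 < normc (disc_val z) by rewrite lt_def z0 normc_ge0.
case E : (disc_val z) => [x y]; rewrite E in z0 z1 zr.
set r := normc _ in z0 z1 zr.
have r2 : r ^+ 2 = x ^+ 2 + y ^+ 2 by rewrite sqr_sqrtr// addr_ge0 ?sqr_ge0.
have xr : -1 <= x / r <= 1.
  rewrite -ler_norml -(@ler_pXn2r _ 2)// ?nnegrE// real_normK ?num_real//.
  by rewrite expr1n expr_div_n ler_pdivrMr ?exprn_gt0// mul1r r2 lerDl sqr_ge0.
have [ac0 cac] := acos_def xr.
have sac : r * sin (acos (x / r)) = `|y|.
  rewrite sin_acos// -{1}(gtr0_norm z0) -sqrtr_sqr -sqrtrM ?sqr_ge0//.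
  rewrite -sqrtr_sqr; congr Num.sqrt.
  have -> : r ^+ 2 * (1 - (x / r) ^+ 2) = r ^+ 2 - x ^+ 2 by field; exact: lt0r_neq0.
  by rewrite r2 addrC addKr.
have [y0|y0] := leP 0 y.
  exists r, (acos (x / r)); split => //.
    by move/andP: ac0 => [a0 ->]; rewrite (le_trans _ a0)// oppr_le0 pi_ge0.
  apply: val_inj; rewrite /= polar_val// E cac sac ger0_norm//.
  by rewrite mulrCA divff ?mulr1// gt_eqF.
exists r, (- acos (x / r)); split => //.
  by move/andP: ac0 => [a0 a1]; rewrite lerN2 a1/= (le_trans _ (pi_ge0 _))// oppr_le0.
apply: val_inj; rewrite /= polar_val// E cosN sinN cac mulrN sac ltr0_norm// opprK.
by rewrite mulrCA divff ?mulr1// gt_eqF.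
Qed.

Lemma hardy_norm2_eq0 f : analytic f -> hardy_norm2 f = 0%E -> f = fun=> 0.
Proof.
move=> af f0; apply/funext => z; have [r [t0 [r01 tpi ->]]] := polar_surj z.
apply/eqP/negPn/negP => fz.
have cm0 : circle_mean f r = 0%E.
  by apply/le_anti; rewrite circle_mean_ge0 -f0 circle_mean_le_hardy.
pose F t := normc (f (polar r t)) ^+ 2 / (2 * pi).
have F0 : 0 < F t0.
  rewrite divr_gt0//; last by rewrite mulr_gt0 ?pi_gt0.
  rewrite exprn_gt0// lt_def normc_ge0 andbT.
  by apply: contra fz => /eqP/eq0_normc ->.
have F2 : 0 < F t0 / 2 by rewrite divr_gt0.
have /cvgrPdist_lt/(_ _ F2)[d /= d0 Hd] := continuous_circ af r01 (x := t0).
have {}Hd t : `|t0 - t| < d -> F t0 / 2 <= F t.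
  by move=> /Hd; rewrite -/(F t0) -/(F t) ltr_norml => /andP[_]; lra.
pose a := Num.max (- pi) (t0 - d / 2); pose b := Num.min pi (t0 + d / 2).
have pi0 := pi_gt0 R.
have ab : a < b.
  by rewrite /a /b lt_min !gt_max; apply/andP; split; apply/andP; split; lra.
have sub : `[a, b] `<=` `[- pi, pi].
  move=> t /=; rewrite !in_itv/= => /andP[]; rewrite /a /b ge_max le_min.
  by move=> /andP[-> _] /andP[-> _].
have : ((F t0 / 2)%:E * mu `[a, b] <= circle_mean f r)%E.
  rewrite -integral_cst//.
  apply: (@le_trans _ _ (\int[mu]_(t in `[a, b]) circ f r t)%E).
    apply: ge0_le_integral => //.
    - by move=> t _; rewrite lee_fin ltW.
    - by apply: measurable_funS sub _ => //; exact: measurable_circ.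
    - move=> t /=; rewrite in_itv/= /a /b ge_max le_min => /andP[/andP[_ h1] /andP[_ h2]].
      rewrite lee_fin; apply: Hd; rewrite ltr_norml; apply/andP; split; lra.
  by apply: ge0_subset_integral => //; [exact: measurable_circ|move=> t _; exact: circ_ge0].
rewrite cm0 lebesgue_measure_itv/= lte_fin ab -EFinD -EFinM lee_fin leNgt.
by rewrite mulr_gt0// subr_gt0.
Qed.

End HardyNorm.

Section HardySpace.
Variable R : realType.

Lemma hardy2P (f : disc R -> R[i]) :
  reflect (analytic f /\ (hardy_norm2 f < +oo)%E) (f \in @hardy2 R).
Proof. by apply: (iffP idP) => [/asboolP|?]; last exact/asboolP. Qed.

Lemma hardy_norm2_cst0 : hardy_norm2 (fun=> 0 : R[i]) = 0%E :> \bar R.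
Proof.
apply/le_anti; rewrite hardy_norm2_ge0 andbT; apply: ge_ereal_sup => _ [r _ <-].
by rewrite /circle_mean integral0_eq// => t _; rewrite /circ normc0 expr0n/= mul0r.
Qed.

Lemma hardy2_submod_closed : submod_closed (@hardy2 R).
Proof.
split; first by apply/hardy2P; split; [exact: analytic_cst|rewrite hardy_norm2_cst0].
move=> c f g /hardy2P[af ff] /hardy2P[ag fg]; apply/hardy2P.
have acf : analytic (fun z => c * f z) := analyticM (analytic_cst c) af.
split; first exact: (analyticD acf ag).
apply: le_lt_trans (hardy_norm2D acf ag ltr01) _.
have hc := hardy_norm2M (analytic_cst c) af (fun=> lexx (normc c)).
have fcf : (hardy_norm2 (fun z => (c * f z)%R) < +oo)%E.
  by apply: le_lt_trans hc _; rewrite lte_mul_pinfty// lee_fin sqr_ge0.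
by rewrite lte_add_pinfty// lte_mul_pinfty// lee_fin addr_ge0 ?invr_ge0.
Qed.
HB.instance Definition _ :=
  GRing.isSubmodClosed.Build R[i] (disc R -> R[i]) (@hardy2 R) hardy2_submod_closed.

Record hardy := Hardy { hardy_fun :> disc R -> R[i]; _ : hardy_fun \in @hardy2 R }.
HB.instance Definition _ := [isSub for hardy_fun].
HB.instance Definition _ := [Choice of hardy by <:].
HB.instance Definition _ := [SubChoice_isSubLmodule of hardy by <:].

Implicit Types f g : hardy.

Lemma hardy_analytic f : analytic f.
Proof. by case: f => f /= /hardy2P[]. Qed.

Lemma hardy_norm2_fin f : hardy_norm2 f = (fine (hardy_norm2 f))%:E.
Proof.
by case: f => f /= /hardy2P[_ ff]; rewrite fineK// ge0_fin_numE// hardy_norm2_ge0.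
Qed.

(* Norms of normed modules over R[i] take values in R[i]. *)
Definition hardy_norm f : R[i] := (Num.sqrt (fine (hardy_norm2 f)))%:C.

Local Notation N f := (fine (hardy_norm2 f)).

Lemma fine_hardy_norm2_ge0 f : 0 <= N f.
Proof. by rewrite fine_ge0// hardy_norm2_ge0. Qed.

Lemma eqCR (x : R) : (x%:C == 0 :> R[i]) = (x == 0).
Proof. by rewrite eq_complex/= eqxx andbT. Qed.

Lemma hardy_norm_eq0 f : hardy_norm f = 0 -> f = 0.
Proof.
move=> /eqP; rewrite eqCR sqrtr_eq0 => h; apply: val_inj => /=.
apply: hardy_norm2_eq0; first exact: hardy_analytic.
by rewrite hardy_norm2_fin; congr EFin; apply/le_anti; rewrite h/= fine_hardy_norm2_ge0.
Qed.

Lemma hardy_normD f g : hardy_norm (f + g) <= hardy_norm f + hardy_norm g.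
Proof.
have [f0|f0] := eqVneq (hardy_norm f) 0; first by rewrite f0 (hardy_norm_eq0 f0) !add0r.
have [g0|g0] := eqVneq (hardy_norm g) 0; first by rewrite g0 (hardy_norm_eq0 g0) !addr0.
rewrite -rmorphD lecR; set x := Num.sqrt _; set y := Num.sqrt (N f); set z := Num.sqrt (N g).
have y0 : 0 < y by rewrite lt_def sqrtr_ge0 andbT; move: f0; rewrite eqCR.
have z0 : 0 < z by rewrite lt_def sqrtr_ge0 andbT; move: g0; rewrite eqCR.
rewrite -(@ler_pXn2r _ 2)// ?nnegrE ?sqrtr_ge0 ?addr_ge0 ?(ltW y0) ?(ltW z0)//.
have xE : x ^+ 2 = N (f + g) by exact: sqr_sqrtr (fine_hardy_norm2_ge0 _).
have yE : y ^+ 2 = N f by exact: sqr_sqrtr (fine_hardy_norm2_ge0 _).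
have zE : z ^+ 2 = N g by exact: sqr_sqrtr (fine_hardy_norm2_ge0 _).
have s0 : 0 < z / y by rewrite divr_gt0.
have := hardy_norm2D (@hardy_analytic f) (@hardy_analytic g) s0.
rewrite [hardy_norm2 f]hardy_norm2_fin [hardy_norm2 g]hardy_norm2_fin.
rewrite -[X in (hardy_norm2 X)]/(hardy_fun (f + g)) hardy_norm2_fin.
rewrite -!EFinM -EFinD lee_fin -xE -yE -zE => /le_trans; apply.
rewrite le_eqVlt; apply/orP; left; apply/eqP; field.
by rewrite !lt0r_neq0.
Qed.

Lemma hardy_normZ_le (c : R[i]) f : hardy_norm (c *: f) <= `|c| * hardy_norm f.
Proof.
rewrite -[`|c|]/((normc c)%:C) -rmorphM lecR.
rewrite -[normc c]ger0_norm ?normc_ge0// -sqrtr_sqr -sqrtrM ?sqr_ge0// ler_wsqrtr//.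
have := hardy_norm2M (analytic_cst c) (@hardy_analytic f) (fun=> lexx (normc c)).
by rewrite hardy_norm2_fin -[X in (hardy_norm2 X)]/(hardy_fun (c *: f)) hardy_norm2_fin -EFinM lee_fin.
Qed.

Lemma hardy_normZ (c : R[i]) f : hardy_norm (c *: f) = `|c| * hardy_norm f.
Proof.
apply/le_anti; rewrite hardy_normZ_le/=.
have [->|c0] := eqVneq c 0; first by rewrite normr0 mul0r lecR sqrtr_ge0.
have := hardy_normZ_le c^-1 (c *: f).
by rewrite scalerA mulVf// scale1r normfV ler_pdivlMl ?normr_gt0.
Qed.

HB.instance Definition _ := Lmodule_isNormed.Build R[i] hardy
  hardy_normD hardy_normZ hardy_norm_eq0.

Record hinfty := Hinfty {
  hinfty_fun :> disc R -> R[i];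
  hinfty_analytic : analytic hinfty_fun;
  hinfty_bounded : exists B : R, forall z, normc (hinfty_fun z) <= B }.

Lemma mulop_subproof (phi : hinfty) (g : hardy) : (fun z => phi z * g z) \in @hardy2 R.
Proof.
case: phi => phi aphi [B phiB] /=; apply/hardy2P; split.
  exact: analyticM aphi (@hardy_analytic g).
apply: le_lt_trans (hardy_norm2M aphi (@hardy_analytic g) phiB) _.
by rewrite hardy_norm2_fin -EFinM ltry.
Qed.

Definition mulop (phi : hinfty) (g : hardy) : hardy := Hardy (mulop_subproof phi g).

(* There is such an h2 exactly when h belongs to the Hardy space. *)
Definition outer (h : disc R -> R[i]) := exists h2 : hardy, hardy_fun h2 = h /\
  dense [set g : hardy |
    exists p : {poly R[i]}, forall z : disc R, g z = p.[z] * h z].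

(* p and h are determined by m, phi and z0: the zeros of p are those of
   phi - phi z0, with multiplicity. *)
Definition rooter (m : nat) (phi : disc R -> R[i]) (z0 : disc R)
    (h : disc R -> R[i]) :=
  exists p : {poly R[i]},
    [/\ p \is monic, size p = m.+1, forall w, root p w -> `|w| < 1,
        analytic h /\ (forall z, h z != 0)
      & forall z : disc R, phi z - phi z0 = p.[z] * h z].

Definition folder (m : nat) (phi : disc R -> R[i]) :=
  [/\ analytic phi, exists z w : disc R, phi z != phi w
    & forall z0, exists h, rooter m phi z0 h].

(* M_phi^* belongs to B_n; an operator has at most one adjoint in this sense, and
   its existence is part of the assertion. *)
Definition adjoint_in_class (phi : hinfty) (n : nat) :=
  exists A : hardy -> hardy, adjoint_of (mulop phi) A /\
    cowen_douglas_class n [set (phi z)^* | z in [set: disc R]] A.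

Definition cowen_douglas_function (phi : hinfty) :=
  exists n, (0 < n)%N /\ adjoint_in_class phi n.

End HardySpace.

(* Main.v *)
Require Import Defs.
From mathcomp Require Import all_boot all_order all_algebra complex.
From mathcomp Require Import all_classical all_reals all_analysis.
From mathcomp Require Import ring lra.

(** Let Ad f be the adjoint of multiplication by the bounded analytic function f on
    the Hardy space. On Taylor coefficients Ad (z - b) is the backward shift minus
    conj b. For |b| < 1 it has a bounded right inverse and its kernel is the line spanned
    by the reproducing kernel at b (right_invertible_lin, has_dim_lin); for |b| >= 1 it is
    injective (Ad_lin_inj). If h and 1 / h are bounded analytic, Ad h is invertible
    (Ad_inv). Since Ad turns products into compositions, Ad (p h) is onto for a monic
    polynomial p with all its roots in the disc, and in general the dimension of its
    kernel is the number of roots of p in the disc (Ad_factor). For phi - phi z0 = p h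
    this gives surjectivity and dimension m, as soon as the rooter function h and its
    reciprocal are known to be bounded (rooter_bounded).

    The function h has no zeros, so only its behaviour near the unit circle matters, and
    there one has to bound |phi - phi z0| from below. Dilate by some r < 1 such that all
    roots of p lie in |z| < r. The operator T = Ad ((phi - phi z0)(r z)) has a right
    inverse and a kernel of dimension m, and the dimension of the kernel of T - x does not
    drop for small x (has_dim_perturb). Hence phi - w has at least m zeros in |z| < r for
    every w near phi z0 (local_degree). If w = phi z1, there are only m zeros in the whole
    disc, z1 among them, so |z1| < r: values near phi z0 are not taken in |z| >= r. The
    same count shows that every w near phi z0 is a value of phi, so that the range is
    open (folder_open).

    The eigenvectors contain all reproducing kernels, since Ad phi sends the kernel at b
    to conj (phi b) times itself (szego_eigen). The kernels at small points yield every
    monomial in the limit (mono_closed_span), hence their span is dense.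

    All this rests on identifying the Hardy space with the square-summable sequences.
    That a locally analytic function on the disc is the sum of one power series (taylor)
    is proved without contour integrals: the Cauchy estimate comes from Parseval's
    identity for polynomials, and it shows that the radius of convergence can always be
    increased (radius_extends). Completeness of the sequence space provides adjoints
    (adjoint_exists) and Neumann series (neumann); the latter also yield the analyticity
    of reciprocals (analyticV). *)

Set Implicit Arguments.
Unset Strict Implicit.
Unset Printing Implicit Defensive.

Import Order.TTheory GRing.Theory Num.Theory numFieldNormedType.Exports.
Import Normc.

Local Open Scope classical_set_scope.
Local Open Scope ring_scope.
Local Open Scope complex_scope.

(** * Limits of complex sequences *)

Section Tends.
Variable R : realType.
Implicit Types (u v : nat -> R[i]) (l : R[i]).

Definition tends u l := forall e : R, 0 < e ->
  exists N, forall n, (N <= n)%N -> normc (l - u n) < e.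

Lemma tendsE u l : tends u l <-> ((u : nat -> R[i]^o) @ \oo --> (l : R[i]^o)).
Proof. by split => /cvgCP. Qed.

Lemma tends_unique u l l' : tends u l -> tends u l' -> l = l'.
Proof. by move=> /tendsE h /tendsE h'; exact: (cvg_unique _ h h'). Qed.

Lemma tends_cst l : tends (fun=> l) l.
Proof. by apply/tendsE; exact: cvg_cst. Qed.

Lemma tendsD u v l l' : tends u l -> tends v l' -> tends (fun n => u n + v n) (l + l').
Proof.
move=> h h' e e0; have e2 : 0 < e / 2 by rewrite divr_gt0.
have [N HN] := h _ e2; have [N' HN'] := h' _ e2.
exists (maxn N N') => n; rewrite geq_max => /andP[/HN h1 /HN' h2].
rewrite opprD addrACA; apply: le_lt_trans (normcD _ _) _.
by rewrite (splitr e) ltrD.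
Qed.

Lemma tendsN u l : tends u l -> tends (fun n => - u n) (- l).
Proof. by move=> h e /h[N HN]; exists N => n /HN; rewrite -opprD normcN. Qed.

Lemma tendsB u v l l' : tends u l -> tends v l' -> tends (fun n => u n - v n) (l - l').
Proof. by move=> h h'; apply: tendsD => //; exact: tendsN. Qed.

Lemma tendsM u v l l' : tends u l -> tends v l' -> tends (fun n => u n * v n) (l * l').
Proof.
move=> h h' e e0; pose K := normc l + normc l' + 1.
have l0 := normc_ge0 l; have l'0 := normc_ge0 l'.
have K0 : 0 < K by rewrite /K; lra.
have d0 : 0 < Num.min 1 (e / K) by rewrite lt_min ltr01 divr_gt0.
have [N HN] := h _ d0; have [N' HN'] := h' _ d0.
exists (maxn N N') => n; rewrite geq_max => /andP[/HN + /HN'].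
have -> : l * l' - u n * v n = (l - u n) * l' + l * (l' - v n) - (l - u n) * (l' - v n) by ring.
rewrite !lt_min !ltr_pdivlMr// => /andP[h1 h2] /andP[h3 h4].
apply: le_lt_trans (normcD _ _) _; rewrite normcN.
apply: le_lt_trans (lerD (normcD _ _) (lexx _)) _; rewrite !normcM.
have := normc_ge0 (l - u n); have := normc_ge0 (l' - v n).
move: h1 h2 h3 h4; rewrite /K; set x := normc (_ - _); set y := normc (_ - _).
set a := normc l; set b := normc l'; move=> h1 h2 h3 h4 y0 x0.
have [xy|yx] := leP x y.
  have : x * b <= y * b by rewrite ler_wpM2r// normc_ge0.
  have : x * y <= y by rewrite ler_piMl// ltW.
  lra.
have : a * y <= a * x by rewrite ler_wpM2l// ltW.
have : x * y <= x by rewrite ler_piMr// ltW.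
lra.
Qed.

Lemma tends_ext u v l : u =1 v -> tends u l -> tends v l.
Proof. by move=> /funext ->. Qed.

Lemma tends_shift k u l : tends u l -> tends (fun n => u (n + k)%N) l.
Proof.
move=> h e /h[N HN]; exists N => n Nn; apply: HN.
by rewrite (leq_trans Nn)// leq_addr.
Qed.

Lemma tends_sum m (u : 'I_m -> nat -> R[i]) (l : 'I_m -> R[i]) :
  (forall i, tends (u i) (l i)) -> tends (fun n => \sum_i u i n) (\sum_i l i).
Proof.
move=> h; elim: m u l h => [|m IH] u l h.
  by rewrite big_ord0; apply: tends_ext (tends_cst 0) => n; rewrite big_ord0.
rewrite big_ord_recl; apply: tends_ext (tendsD (h ord0) (IH _ _ (fun i => h (lift ord0 i)))).
by move=> n; rewrite big_ord_recl.
Qed.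

Lemma normc_real (x : R) : normc (x%:C) = `|x|.
Proof. by rewrite /= expr0n/= addr0 sqrtr_sqr. Qed.

Lemma normc_conj (z : R[i]) : normc (conjc z) = normc z.
Proof. by case: z => a b /=; rewrite sqrrN. Qed.

Lemma tends_conj u l : tends u l -> tends (fun n => conjc (u n)) (conjc l).
Proof.
move=> h e /h[N HN]; exists N => n /HN.
by rewrite -rmorphB normc_conj.
Qed.

Lemma tends_bound u l (E : nat -> R) : (forall n, normc (l - u n) <= E n) ->
  E @ \oo --> (0 : R) -> tends u l.
Proof.
move=> uE /cvgrPdist_lt E0 e /E0[N _ HN]; exists N => n Nn.
apply: le_lt_trans (uE n) _; have := HN n Nn; rewrite sub0r normrN.
by apply: le_lt_trans; exact: ler_norm.
Qed.

Lemma normcB_ge (x y : R[i]) : `|normc x - normc y| <= normc (x - y).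
Proof.
have h1 : normc x <= normc (x - y) + normc y by apply: le_trans (normcD _ _); rewrite subrK.
have h2 : normc y <= normc (y - x) + normc x by apply: le_trans (normcD _ _); rewrite subrK.
rewrite normcB_sym in h2; rewrite ler_norml; apply/andP; split; lra.
Qed.

Lemma tends_normc_le u l (B : R) : tends u l -> (forall n, normc (u n) <= B) -> normc l <= B.
Proof.
move=> h uB; rewrite -[l]subr0; apply: (normc_lim_le h).
by exists 0%N => n _; rewrite subr0.
Qed.

Lemma normc_Re (z : R[i]) : `|complex.Re z| <= normc z.
Proof. by have := @normc_ge_Re R z; rewrite lecR. Qed.

Lemma normc_Im (z : R[i]) : `|complex.Im z| <= normc z.
Proof.
case: z => a b /=; rewrite -sqrtr_sqr ler_wsqrtr// lerDr; exact: sqr_ge0.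
Qed.

Lemma normc_le_ReIm (z : R[i]) : normc z <= `|complex.Re z| + `|complex.Im z|.
Proof.
case: z => a b /=.
rewrite -[leRHS]ger0_norm ?addr_ge0// -sqrtr_sqr ler_wsqrtr//.
rewrite sqrrD !real_normK ?num_real// -addrA lerD2l lerDr mulrn_wge0//.
Qed.

Lemma real_complete (u E : nat -> R) : (forall n m, (n <= m)%N -> `|u m - u n| <= E n) ->
  E @ \oo --> (0 : R) -> exists x : R, u @ \oo --> x.
Proof.
move=> uE /cvgrPdist_lt E0; suff : cvg (u @ \oo) by move=> h; exists (lim (u @ \oo)).
apply: cauchy_cvg; apply/cauchy_exP => e e0; have [N _ HN] := E0 _ e0.
exists (u N); exists N => // n /= Nn; rewrite /ball/= distrC.
apply: le_lt_trans (uE _ _ Nn) _; have := HN N (leqnn _); rewrite sub0r normrN.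
by apply: le_lt_trans; exact: ler_norm.
Qed.

Lemma tends_complete u (E : nat -> R) :
  (forall n m, (n <= m)%N -> normc (u m - u n) <= E n) ->
  E @ \oo --> (0 : R) -> exists l, tends u l.
Proof.
move=> uE E0.
have [|x hx] := @real_complete (fun n => complex.Re (u n)) _ _ E0.
  move=> n m nm; apply: le_trans (uE _ _ nm); apply: le_trans (normc_Re _).
  by case: (u m) (u n) => a b [c d].
have [|y hy] := @real_complete (fun n => complex.Im (u n)) _ _ E0.
  move=> n m nm; apply: le_trans (uE _ _ nm); apply: le_trans (normc_Im _).
  by case: (u m) (u n) => a b [c d].
exists (x +i* y) => e e0.
have e2 : 0 < e / 2 by rewrite divr_gt0.
move/cvgrPdist_lt : hx => /(_ _ e2)[N _ HN].
move/cvgrPdist_lt : hy => /(_ _ e2)[N' _ HN'].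
exists (maxn N N') => n; rewrite geq_max => /andP[/HN h1 /HN' h2].
apply: le_lt_trans (normc_le_ReIm _) _.
by move: h1 h2; case: (u n) => a b /= h1 h2; rewrite (splitr e) ltrD.
Qed.

Lemma geo_null (M q : R) : 0 <= q < 1 -> (fun n => M * q ^+ n) @ \oo --> (0 : R).
Proof. by move=> /andP[q0 q1]; apply: cvg_geometric; rewrite ger0_norm. Qed.

Lemma geo_sum_le (q : R) n : 0 <= q < 1 -> \sum_(i < n) q ^+ i <= (1 - q)^-1.
Proof.
move=> /andP[q0 q1].
have q1' : 0 < 1 - q by rewrite subr_gt0.
rewrite -[leRHS]mul1r ler_pdivlMr//.
have := subrX1 q n; set S := \sum_(i < n) _ => h.
have : 0 <= q ^+ n by rewrite exprn_ge0.
nra.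
Qed.

Lemma geo_tail_le (q : R) n m : 0 <= q < 1 -> (n <= m)%N ->
  \sum_(n <= i < m) q ^+ i <= q ^+ n / (1 - q).
Proof.
move=> q01 nm; rewrite -{1}[n]add0n big_addn big_mkord.
under eq_bigr do rewrite addnC exprD.
rewrite -mulr_sumr ler_wpM2l ?geo_sum_le//.
by rewrite exprn_ge0//; case/andP: q01.
Qed.

End Tends.

(** * Power series and their re-expansion *)

Section PowerSeries.
Variable R : realType.
Implicit Types (a b c : nat -> R[i]) (z w v : R[i]).

Definition csum c : R[i] := xget 0 [set l | tends (fun n => \sum_(k < n) c k) l].

Definition psum a z := csum (fun k => a k * z ^+ k).

Lemma csum_eq c l : tends (fun n => \sum_(k < n) c k) l -> csum c = l.
Proof.
by move=> h; rewrite /csum; case: xgetP => [x _ /= hx|/(_ l)//]; exact: tends_unique hx h.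
Qed.

Lemma sum_ord_sub (c : nat -> R[i]) n m : (n <= m)%N ->
  \sum_(k < m) c k - \sum_(k < n) c k = \sum_(n <= k < m) c k.
Proof.
move=> nm; rewrite -!(big_mkord xpredT c) (big_cat_nat (n := n))//=.
by rewrite [X in X - _]addrC addrK.
Qed.

Lemma normc_sum_nat (c : nat -> R[i]) n m :
  normc (\sum_(n <= k < m) c k) <= \sum_(n <= k < m) normc (c k).
Proof.
elim/big_ind2: _ => [|x1 x2 y1 y2 h1 h2|//]; first by rewrite normc0.
by rewrite (le_trans (normcD _ _))// lerD.
Qed.

(** Domination by a geometric series is the only source of convergence below; the
    explicit tail makes every later passage to the limit uniform. *)
Lemma csum_geo c (M q : R) : 0 <= q < 1 -> (forall n, normc (c n) <= M * q ^+ n) ->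
  tends (fun n => \sum_(k < n) c k) (csum c) /\
  forall n, normc (csum c - \sum_(k < n) c k) <= M / (1 - q) * q ^+ n.
Proof.
move=> q01 cM; have [q0 q1] := andP q01.
have M0 : 0 <= M by apply: le_trans (normc_ge0 (c 0%N)) _; have := cM 0%N; rewrite mulr1.
have d n m : (n <= m)%N ->
    normc (\sum_(k < m) c k - \sum_(k < n) c k) <= M / (1 - q) * q ^+ n.
  move=> nm; rewrite sum_ord_sub// (le_trans (normc_sum_nat _ _ _))//.
  apply: (@le_trans _ _ (\sum_(n <= k < m) M * q ^+ k)); first exact: ler_sum.
  by rewrite -mulr_sumr -mulrA ler_wpM2l// mulrC geo_tail_le.
have [l hl] := tends_complete d (geo_null _ q01).
rewrite (csum_eq hl); split => // n; apply: (normc_lim_le hl).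
by exists n => m; exact: d.
Qed.

Lemma pow_term a z (M rho : R) n : 0 < rho -> (forall n, normc (a n) * rho ^+ n <= M) ->
  normc (a n * z ^+ n) <= M * (normc z / rho) ^+ n.
Proof. by move=> r0 h; rewrite normcM normcX term_bound ?normc_ge0. Qed.

Lemma ratio01 (x rho : R) : 0 <= x -> x < rho -> 0 <= x / rho < 1.
Proof.
move=> x0 xr; have r0 := le_lt_trans x0 xr.
by rewrite divr_ge0 ?(ltW r0)//= ltr_pdivrMr// mul1r.
Qed.

Lemma psum_geo a z (M rho : R) : (forall n, normc (a n) * rho ^+ n <= M) ->
  normc z < rho ->
  tends (fun n => \sum_(k < n) a k * z ^+ k) (psum a z) /\
  forall n, normc (psum a z - \sum_(k < n) a k * z ^+ k) <=
     M / (1 - normc z / rho) * (normc z / rho) ^+ n.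
Proof.
move=> h zr; have r0 := le_lt_trans (normc_ge0 z) zr.
by apply: csum_geo => [|n]; [rewrite ratio01 ?normc_ge0|exact: pow_term].
Qed.

Lemma psum_le a z (M rho : R) : (forall n, normc (a n) * rho ^+ n <= M) ->
  normc z < rho -> normc (psum a z) <= M / (1 - normc z / rho).
Proof.
move=> h zr; have [_ /(_ 0%N)] := psum_geo h zr.
by rewrite big_ord0 subr0 expr0 mulr1.
Qed.

(** A single term of the binomial expansion of (x + y)^n is kept. *)
Lemma bin_term_le (x y : R) n k : 0 <= x -> 0 <= y ->
  'C(n, k)%:R * x ^+ (n - k) * y ^+ k <= (x + y) ^+ n.
Proof.
move=> x0 y0; have [nk|kn] := ltnP n k.
  by rewrite bin_small// !mul0r exprn_ge0// addr_ge0.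
rewrite exprDn (bigD1 (Ordinal (kn : (k < n.+1)%N)))//= -[X in X + _]mulr_natl mulrA lerDl.
by apply: sumr_ge0 => i _; rewrite mulrn_wge0// mulr_ge0 ?exprn_ge0.
Qed.

(** The k-th Taylor coefficient at w of the sum of the power series a. *)
Definition shiftc a w k : R[i] := csum (fun n => 'C(n, k)%:R * a n * w ^+ (n - k)).

Lemma normc_nat n : normc (n%:R : R[i]) = n%:R.
Proof. by rewrite -(rmorph_nat (@real_complex R)) normc_real ger0_norm. Qed.

(** Exchanging the two summations is avoided: the truncation of the outer
    series at N has Taylor coefficients at w that differ from those of the
    whole series by at most a geometric tail. *)
Lemma recenter a w (M rho eta : R) : (forall n, normc (a n) * rho ^+ n <= M) ->
  0 < eta -> normc w + eta < rho ->
  (forall k, normc (shiftc a w k) * eta ^+ k <= M / (1 - (normc w + eta) / rho)) /\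
  (forall v, normc v < eta ->
     tends (fun n => \sum_(k < n) shiftc a w k * v ^+ k) (psum a (w + v))).
Proof.
move=> aM e0 wr; have w0 := normc_ge0 w.
have r0 : 0 < rho by lra.
pose q := (normc w + eta) / rho.
have q01 : 0 <= q < 1 by apply: ratio01 => //; lra.
have [q0 q1] := andP q01.
have M0 : 0 <= M by apply: le_trans (aM 0%N); rewrite mulr1 normc_ge0.
have term k n : normc ('C(n, k)%:R * a n * w ^+ (n - k)) <= M / eta ^+ k * q ^+ n.
  rewrite [leRHS]mulrAC ler_pdivlMr ?exprn_gt0// !normcM normcX normc_nat.
  have := bin_term_le n k w0 (ltW e0).
  have -> : normc w + eta = q * rho by rewrite /q divfK ?gt_eqF.
  rewrite exprMn => /(ler_wpM2l (normc_ge0 (a n))) h.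
  have -> : 'C(n, k)%:R * normc (a n) * normc w ^+ (n - k) * eta ^+ k =
    normc (a n) * ('C(n, k)%:R * normc w ^+ (n - k) * eta ^+ k) by ring.
  by apply: le_trans h _; rewrite mulrCA mulrC ler_wpM2r ?exprn_ge0.
have sh k := csum_geo q01 (term k).
have d k N : normc (shiftc a w k - \sum_(n < N) 'C(n, k)%:R * a n * w ^+ (n - k))
    <= M / (1 - q) * q ^+ N / eta ^+ k.
  have [_ /(_ N) /le_trans] := sh k; apply.
  by rewrite le_eqVlt; apply/orP; left; apply/eqP; ring.
split.
  move=> k; have := d k 0%N; rewrite big_ord0 subr0 expr0 mulr1.
  by rewrite ler_pdivlMr// exprn_gt0.
move=> v ve; have v0 := normc_ge0 v.
have wvr : normc (w + v) < rho by apply: le_lt_trans (normcD _ _) _; lra.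
have [hp _] := psum_geo aM wvr.
have expand N : \sum_(n < N) a n * (w + v) ^+ n =
    \sum_(k < N) (\sum_(n < N) 'C(n, k)%:R * a n * w ^+ (n - k)) * v ^+ k.
  under [RHS]eq_bigr do rewrite mulr_suml.
  rewrite exchange_big/=; apply: eq_bigr => n _.
  rewrite exprDn mulr_sumr 
    (big_ord_widen _ (fun k => a n * (w ^+ (n - k) * v ^+ k *+ 'C(n, k))) (ltn_ord n)).
  rewrite big_mkcond/=; apply: eq_bigr => k _.
  case: ltnP => [_|nk]; first by rewrite -mulr_natl; ring.
  by rewrite bin_small// !mul0r.
have close : tends (fun N => \sum_(n < N) a n * (w + v) ^+ n -
    \sum_(k < N) shiftc a w k * v ^+ k) 0.
  apply: (@tends_bound _ _ _ (fun N => M / (1 - q) * (1 - normc v / eta)^-1 * q ^+ N)).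
    move=> N; rewrite sub0r normcN expand -sumrB (le_trans (normc_sum _))//.
    apply: (@le_trans _ _ (\sum_(k < N) M / (1 - q) * q ^+ N * (normc v / eta) ^+ k)).
      apply: ler_sum => k _; rewrite -mulrBl normcM normcB_sym normcX.
      by rewrite [(normc v / eta) ^+ k]expr_div_n [X in _ <= _ * X]mulrC mulrA ler_wpM2r ?exprn_ge0.
    rewrite -mulr_sumr -[leRHS]mulrA [X in _ <= _ * X]mulrC mulrA ler_wpM2l//.
      by rewrite !mulr_ge0 ?invr_ge0 ?subr_ge0 ?exprn_ge0// ltW.
    by rewrite geo_sum_le// ratio01.
  exact: geo_null.
have := tendsB hp close; rewrite subr0; apply: tends_ext => N.
by rewrite opprB addrC subrK.
Qed.

(** A shifted series is itself a power series in the new centre, which makes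
    the Cauchy estimate applicable to it. *)
Lemma shiftc_psum a (M rho : R) k (t : R) : (forall n, normc (a n) * rho ^+ n <= M) ->
  0 < t < rho ->
  exists M' rho', t < rho' /\
    (forall j, normc ('C(j + k, k)%:R * a (j + k)%N) * rho' ^+ j <= M') /\
    forall w, normc w = t -> shiftc a w k = psum (fun j => 'C(j + k, k)%:R * a (j + k)%N) w.
Proof.
move=> aM /andP[t0 tr]; pose y := (rho - t) / 2.
have y0 : 0 < y by rewrite /y; lra.
exists (M / y ^+ k), (t + y); rewrite ltrDl y0; split => //.
have cM j : normc ('C(j + k, k)%:R * a (j + k)%N) * (t + y) ^+ j <= M / y ^+ k.
  rewrite ler_pdivlMr ?exprn_gt0// normcM normc_nat.
  have ty : 0 <= t + y by lra.
  have := bin_term_le (j + k) k ty (ltW y0); rewrite addnK.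
  have -> : t + y + y = rho by rewrite /y; lra.
  move=> /(ler_wpM2l (normc_ge0 (a (j + k)%N))) h; apply: le_trans (aM (j + k)%N).
  by apply: le_trans h; rewrite le_eqVlt; apply/orP; left; apply/eqP; ring.
split => // w wt; apply: csum_eq.
have wr : normc w < t + y by rewrite wt ltrDl.
have [h _] := psum_geo cM wr.
move=> e /h[N HN]; exists (N + k)%N => n Nn; have kn := leq_trans (leq_addl N k) Nn.
have := HN (n - k)%N; rewrite leq_subRL// addnC Nn => /(_ isT).
congr (normc (_ - _) < e).
rewrite -(big_mkord xpredT (fun n => 'C(n, k)%:R * a n * w ^+ (n - k))).
have z0 : \sum_(0 <= i < k) 'C(i, k)%:R * a i * w ^+ (i - k) = 0.
  rewrite big_nat_cond big1// => i; rewrite andbT => /andP[_ ik].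
  by rewrite bin_small// !mul0r.
rewrite (big_cat_nat (n := k))//= z0 add0r.
apply/esym; rewrite -[X in \sum_(X <= _ < _) _]add0n big_addn big_mkord.
apply: eq_bigr => i _.
by rewrite addnK.
Qed.

End PowerSeries.

(** * Mean values of trigonometric polynomials *)

Section Parseval.
Variable R : realType.
Local Notation mu := (@lebesgue_measure R).

Definition expi (t : R) : R[i] := cos t +i* sin t.

Lemma normc_expi t : normc (expi t) = 1.
Proof. by rewrite /= cos2Dsin2 sqrtr1. Qed.

Lemma expiX t n : expi t ^+ n = cos (n%:R * t) +i* sin (n%:R * t).
Proof.
elim: n => [|n IH]; first by rewrite expr0 mul0r cos0 sin0.
rewrite exprSr IH -natr1 mulrDl mul1r cosD sinD /expi; simpc.
by congr (_ +i* _); rewrite addrC.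
Qed.

(** Having a primitive with equal values at the ends of [-pi, pi] is how the
    vanishing of an integral is recorded: sums of such functions are again of
    this kind without any appeal to integrability. *)
Definition zero_mean (g : R -> R) :=
  exists2 Q : R -> R, (forall t : R, is_derive t 1 Q (g t)) & Q (- pi) = Q pi.

Lemma zero_meanD g h : zero_mean g -> zero_mean h -> zero_mean (fun t : R => g t + h t).
Proof.
move=> [Q dQ Qpi] [P dP Ppi]; exists (fun t : R => Q t + P t); last by rewrite Qpi Ppi.
by move=> t; exact: is_deriveD.
Qed.

Lemma zero_mean0 : zero_mean (fun=> 0).
Proof. by exists (fun=> 0) => // t; exact: is_derive_cst. Qed.

Lemma zero_mean_sum n (g : 'I_n -> R -> R) : (forall i, zero_mean (g i)) ->
  zero_mean (fun t : R => \sum_i g i t).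
Proof.
elim: n g => [|n IH] g h.
  have -> : (fun t : R => \sum_(i < 0) g i t) = fun=> 0 by apply/funext => t; rewrite big_ord0.
  exact: zero_mean0.
have -> : (fun t : R => \sum_i g i t) = fun t : R => g ord0 t + \sum_(i < n) g (lift ord0 i) t.
  by apply/funext => t; rewrite big_ord_recl.
by apply: zero_meanD => //; exact: IH.
Qed.

Lemma zero_mean_trig (k : nat) (x y : R) : (0 < k)%N ->
  zero_mean (fun t : R => x * cos (k%:R * t) + y * sin (k%:R * t)).
Proof.
move=> k0; have kn : k%:R != 0 :> R by rewrite pnatr_eq0 -lt0n.
exists (fun t : R => (x / k%:R) * sin (k%:R * t) - (y / k%:R) * cos (k%:R * t)).
  move=> t.
  have dk : is_derive t 1 (fun t : R => k%:R * t) k%:R.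
    by apply: is_derive_eq; rewrite /GRing.scale/= mulr1.
  have ds : is_derive t 1 (fun t : R => sin (k%:R * t)) (cos (k%:R * t) * k%:R).
    by apply: (@is_derive1_comp _ sin (fun t : R => k%:R * t)); exact: is_derive_sin.
  have dc : is_derive t 1 (fun t : R => cos (k%:R * t)) (- sin (k%:R * t) * k%:R).
    by apply: (@is_derive1_comp _ cos (fun t : R => k%:R * t)); exact: is_derive_cos.
  apply: is_derive_eq; rewrite /GRing.scale/=; field.
  exact: kn.
have s0 : sin (k%:R * pi) = 0 :> R.
  by have := alternatingn (@sinDpi R) k 0; rewrite add0r sin0 mulr0 mulr_natl.
by rewrite !mulrN cosN sinN s0 oppr0 !mulr0.
Qed.

Lemma normcD_sqr (x y : R[i]) :
  normc (x + y) ^+ 2 = normc x ^+ 2 + normc y ^+ 2 + 2 * complex.Re (x * conjc y).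
Proof.
case: x y => a b [c d] /=.
by rewrite !sqr_sqrtr ?addr_ge0 ?sqr_ge0//; ring.
Qed.

Lemma conj_expi_mul t : expi t * conjc (expi t) = 1.
Proof.
by apply/eqP; rewrite eq_complex/=; apply/andP; split; apply/eqP;
  [rewrite -(cos2Dsin2 t); ring|ring].
Qed.

Lemma conjM (x y : R[i]) : conjc (x * y) = conjc x * conjc y.
Proof. exact: (rmorphM (@conjc R)). Qed.

Lemma conjX (x : R[i]) n : conjc (x ^+ n) = conjc x ^+ n.
Proof. exact: (rmorphXn (@conjc R)). Qed.

Lemma Re_sum n (F : 'I_n -> R[i]) :
  complex.Re (\sum_i F i) = \sum_i complex.Re (F i).
Proof. by apply: (big_morph (@complex.Re R)) => // -[a b] [c d]. Qed.

(** The diagonal terms of the square are the constant part; each cross term is a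
    trigonometric monomial of nonzero frequency. *)
Lemma zero_mean_poly (c : nat -> R[i]) n : zero_mean (fun t : R =>
  normc (\sum_(k < n) c k * expi t ^+ k) ^+ 2 - \sum_(k < n) normc (c k) ^+ 2).
Proof.
elim: n => [|n IH].
  suff -> : (fun t : R => normc (\sum_(k < 0) c k * expi t ^+ k) ^+ 2 -
     \sum_(k < 0) normc (c k) ^+ 2) = fun=> 0 by exact: zero_mean0.
  by apply/funext => t; rewrite !big_ord0 normc0 expr0n/= subrr.
pose d (k : 'I_n) := c k * conjc (c n).
have zk (k : 'I_n) : zero_mean (fun t : R => 2 * complex.Re (d k) * cos ((n - k)%:R * t) +
    2 * complex.Im (d k) * sin ((n - k)%:R * t)).
  by apply: zero_mean_trig; rewrite subn_gt0.
have := zero_meanD IH (zero_mean_sum zk); congr zero_mean; apply/funext => t.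
rewrite !big_ord_recr/= normcD_sqr normcM normcX normc_expi expr1n mulr1.
rewrite conjM conjX mulr_suml Re_sum mulr_sumr.
have -> : \sum_(i < n) 2 * complex.Re (c i * expi t ^+ i *
      (conjc (c n) * conjc (expi t) ^+ n)) =
    \sum_(i < n) (2 * complex.Re (d i) * cos ((n - i)%:R * t) +
                  2 * complex.Im (d i) * sin ((n - i)%:R * t)).
  apply: eq_bigr => i _.
  have -> : c i * expi t ^+ i * (conjc (c n) * conjc (expi t) ^+ n) =
      d i * conjc (expi t ^+ (n - i)).
    rewrite conjX /d.
    have -> : conjc (expi t) ^+ n = conjc (expi t) ^+ (n - i) * conjc (expi t) ^+ i.
      by rewrite -exprD subnK// ltnW.
    have -> : c i * expi t ^+ i *
       (conjc (c n) * (conjc (expi t) ^+ (n - i) * conjc (expi t) ^+ i)) =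
       c i * conjc (c n) * conjc (expi t) ^+ (n - i) * (expi t * conjc (expi t)) ^+ i.
      by rewrite exprMn; ring.
    by rewrite conj_expi_mul expr1n mulr1.
  by rewrite expiX; case: (d i) => x y /=; ring.
by ring.
Qed.

Lemma mean_primitive (p S q : R) : p != 0 ->
  (S * p + q) / (2 * p) - (S * - p + q) / (2 * p) = S.
Proof. by move=> p0; field. Qed.

Lemma integral_zero_mean (g : R -> R) (S : R) : continuous g ->
  zero_mean (fun t : R => g t - S) ->
  (\int[mu]_(t in `[(- pi)%R, pi%R]) (g t / (2 * pi))%:E = S%:E)%E.
Proof.
move=> cg [Q dQ Qpi]; have pi0 := pi_gt0 R.
pose F t := (S * t + Q t) / (2 * pi).
have dF (t : R) : is_derive t 1 F (g t / (2 * pi)).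
  have ds : is_derive t 1 (fun t : R => S * t) S.
    by apply: is_derive_eq; rewrite /GRing.scale/= mulr1.
  have dq := dQ t.
  by rewrite /F; apply: is_derive_eq; rewrite /GRing.scale/=; ring.
have cF : continuous F.
  move=> t; apply: differentiable_continuous; apply/derivable1_diffP.
  exact: (@ex_derive _ _ _ _ _ _ _ (dF t)).
rewrite (@continuous_FTC2 _ _ F).
- rewrite -EFinB; congr EFin; by rewrite /F Qpi mean_primitive ?gt_eqF.
- lra.
- apply: continuous_subspaceT => t; apply: cvgM; first exact: cg.
  exact: cvg_cst.
- split.
  + by move=> t _; exact: (@ex_derive _ _ _ _ _ _ _ (dF t)).
  + by apply: cvg_at_right_filter; exact: cF.
  + by apply: cvg_at_left_filter; exact: cF.
- by move=> t _; rewrite derive1E; exact: (@derive_val _ _ _ _ _ _ _ (dF t)).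
Qed.

End Parseval.

Section CircleMean.
Variable R : realType.
Implicit Types (f g : disc R -> R[i]) (c : nat -> R[i]).
Local Notation mu := (@lebesgue_measure R).

Lemma polarE (r t : R) : 0 <= r < 1 -> disc_val (polar r t) = r%:C * expi t.
Proof. by move=> h; rewrite polar_val// /expi; simpc. Qed.

Definition poly_fun c n : disc R -> R[i] := fun z => \sum_(k < n) c k * disc_val z ^+ k.

Lemma analytic_id : analytic (fun z : disc R => disc_val z).
Proof.
apply: analytic_intro => z0; exists (fun n => if n is 0%N then disc_val z0 else
   if n is 1%N then 1 else 0), 1; split => // z _ e e0.
exists 2%N => -[//|[//|n]] _; rewrite 2!big_ord_recl/= big1 ?addr0; last first.
  by move=> i _; rewrite mul0r.
rewrite (_ : _ - _ = 0) ?normc0//.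
by rewrite /bump/= expr0 expr1; ring.
Qed.

Lemma analytic_pow n : analytic (fun z : disc R => disc_val z ^+ n).
Proof.
elim: n => [|n IH]; first exact: (analytic_cst 1).
suff -> : (fun z : disc R => disc_val z ^+ n.+1) = fun z => disc_val z * disc_val z ^+ n.
  exact: analyticM analytic_id IH.
by apply/funext => z; rewrite exprS.
Qed.

Lemma analytic_sum n (f : 'I_n -> disc R -> R[i]) : (forall i, analytic (f i)) ->
  analytic (fun z => \sum_i f i z).
Proof.
elim: n f => [|n IH] f h.
  suff -> : (fun z => \sum_(i < 0) f i z) = fun=> 0 by exact: analytic_cst.
  by apply/funext => z; rewrite big_ord0.
suff -> : (fun z => \sum_i f i z) = fun z => f ord0 z + \sum_(i < n) f (lift ord0 i) z.
  by apply: analyticD => //; exact: IH.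
by apply/funext => z; rewrite big_ord_recl.
Qed.

Lemma analytic_poly c n : analytic (poly_fun c n).
Proof.
by apply: analytic_sum => i; apply: analyticM (analytic_cst _) (analytic_pow i).
Qed.

(** Parseval's identity for polynomials. *)
Lemma circle_mean_poly c n (r : R) : 0 <= r < 1 ->
  circle_mean (poly_fun c n) r = (\sum_(k < n) (normc (c k) * r ^+ k) ^+ 2)%:E.
Proof.
move=> r01; rewrite /circle_mean /circ; apply: integral_zero_mean.
  move=> t; under eq_fun do rewrite expr2.
  by apply: cvgM; apply: (continuous_polar (analytic_poly c n) r01).
have := zero_mean_poly (fun k => c k * r%:C ^+ k) n.
congr zero_mean; apply/funext => t; congr (normc _ ^+ 2 - _).
  by apply: eq_bigr => k _; rewrite (polarE t r01) exprMn mulrA.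
apply: eq_bigr => k _; rewrite normcM normcX normc_real.
by case/andP: r01 => r0 _; rewrite ger0_norm.
Qed.

Lemma circle_mean_le f g (r eta : R) : analytic f -> analytic g -> 0 <= r < 1 ->
  0 <= eta -> (forall t : R, normc (f (polar r t)) ^+ 2 <= normc (g (polar r t)) ^+ 2 + eta) ->
  (circle_mean f r <= circle_mean g r + eta%:E)%E.
Proof.
move=> af ag r01 eta0 h; have pi0 := pi_gt0 R.
have pp : 0 < 2 * pi :> R by rewrite mulr_gt0.
have -> : (eta%:E = \int[mu]_(t in `[(- pi)%R, pi%R]) (cst (eta / (2 * pi))%:E t))%E.
  rewrite integral_cst//= lebesgue_measure_itv/= lte_fin.
  have -> : (- pi < pi :> R) by lra.
  rewrite -EFinD -EFinM; congr EFin.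
  by rewrite opprK -mulr2n -[X in _ = _ * X]mulr_natl mulfVK// gt_eqF.
rewrite -ge0_integralD//.
- apply: ge0_le_integral => //.
  + by move=> t _; exact: circ_ge0.
  + exact: measurable_circ.
  + by apply: emeasurable_funD => //; exact: measurable_circ.
  + move=> t _; rewrite -EFinD lee_fin -mulrDl ler_wpM2r// invr_ge0 ltW//.
- by move=> t _; exact: circ_ge0.
- exact: measurable_circ.
- by move=> t _ /=; rewrite lee_fin divr_ge0// ltW.
Qed.

Lemma circle_mean0 (r : R) : circle_mean (fun=> 0) r = 0%E.
Proof.
by rewrite /circle_mean integral0_eq// => t _; rewrite /circ normc0 expr0n/= mul0r.
Qed.

(** The quadratic mean over a circle is at most the supremum. *)
Lemma poly_sup_bound c n (r B : R) : 0 <= r < 1 -> 0 <= B ->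
  (forall t, normc (\sum_(k < n) c k * (r%:C * expi t) ^+ k) <= B) ->
  \sum_(k < n) (normc (c k) * r ^+ k) ^+ 2 <= B ^+ 2.
Proof.
move=> r01 B0 h; rewrite -lee_fin -circle_mean_poly//.
have := @circle_mean_le (poly_fun c n) (fun=> 0) r (B ^+ 2) (analytic_poly c n)
  (analytic_cst 0) r01 (sqr_ge0 _).
rewrite circle_mean0 add0e; apply => t; rewrite normc0 expr0n/= add0r.
rewrite lerXn2r ?nnegrE ?normc_ge0//.
by rewrite /poly_fun; have := h t; rewrite -polarE.
Qed.

End CircleMean.

(** * Analytic functions on the disc are sums of their Taylor series *)

Section Taylor.
Variable R : realType.
Implicit Types (f : disc R -> R[i]) (a b c : nat -> R[i]).

(** On the circle the truncations are uniformly close to the sum, so the bound for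
    polynomials passes to power series; no integral of the sum is involved. *)
Lemma cauchy_estimate c (M rho r B : R) : (forall n, normc (c n) * rho ^+ n <= M) ->
  0 <= r < 1 -> r < rho -> (forall t, normc (psum c (r%:C * expi t)) <= B) ->
  forall n, normc (c n) * r ^+ n <= B.
Proof.
move=> cM r01 rr cB n; have [r0 r1] := andP r01.
have zr t : normc (r%:C * expi t) = r by rewrite normcM normc_expi normc_real mulr1 ger0_norm.
have q01 := ratio01 r0 rr.
pose E N := M / (1 - r / rho) * (r / rho) ^+ N.
have B0 : 0 <= B := le_trans (normc_ge0 _) (cB 0).
have M0 : 0 <= M by apply: le_trans (cM 0%N); rewrite mulr1 normc_ge0.
have E0 N : 0 <= E N.
  by rewrite !mulr_ge0 ?invr_ge0 ?subr_ge0 ?exprn_ge0//; case/andP: q01 => // _ /ltW.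
have key N : (n < N)%N -> normc (c n) * r ^+ n <= B + E N.
  move=> nN; rewrite -(@ler_pXn2r _ 2)// ?nnegrE ?mulr_ge0 ?normc_ge0 ?exprn_ge0 ?addr_ge0//.
  apply: (@le_trans _ _ (\sum_(k < N) (normc (c k) * r ^+ k) ^+ 2)).
    rewrite (bigD1 (Ordinal nN))//= lerDl; apply: sumr_ge0 => k _; exact: sqr_ge0.
  apply: poly_sup_bound => //; first by rewrite addr_ge0.
  move=> t; have zt : normc (r%:C * expi t) < rho by rewrite zr.
  have [_ /(_ N)] := psum_geo cM zt; rewrite zr -/(E N) => h.
  have -> : \sum_(k < N) c k * (r%:C * expi t) ^+ k = psum c (r%:C * expi t) -
    (psum c (r%:C * expi t) - \sum_(k < N) c k * (r%:C * expi t) ^+ k) by rewrite opprB addrC subrK.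
  by apply: le_trans (normcD _ _) _; rewrite normcN lerD.
apply/ler_addgt0Pr => e e0.
have /cvgrPdist_lt/(_ _ e0)[N _ HN] := geo_null (M / (1 - r / rho)) q01.
have := HN (maxn N n.+1) (leq_maxl _ _); rewrite sub0r normrN ger0_norm; last exact: E0.
have := key (maxn N n.+1) (leq_maxr _ _); rewrite /E; lra.
Qed.

Lemma psum_eq0 c (M rho d : R) : (forall n, normc (c n) * rho ^+ n <= M) ->
  0 < rho -> 0 < d -> (forall v, normc v < d -> psum c v = 0) -> forall n, c n = 0.
Proof.
move=> cM r0 d0 h n.
pose r := Num.min (Num.min rho d) 1 / 2.
have m0 : 0 < Num.min (Num.min rho d) 1 by rewrite !lt_min r0 d0 ltr01.
have rm : 0 < r < Num.min (Num.min rho d) 1.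
  by rewrite /r divr_gt0//= ltr_pdivrMr// ltr_pMr// ltr1n.
move: rm; rewrite !lt_min => /andP[rpos /andP[/andP[rr rd] r1]].
have r01 : 0 <= r < 1 by rewrite ltW.
have := cauchy_estimate cM r01 rr _ n; move=> /(_ 0) H.
have : normc (c n) * r ^+ n <= 0.
  apply: H => t; rewrite h ?normc0// normcM normc_expi mulr1 normc_real gtr0_norm//.
rewrite pmulr_lle0 ?exprn_gt0// => cn; apply: eq0_normc; apply/le_anti.
by rewrite cn normc_ge0.
Qed.

Lemma psum_unique a b (M M' rho rho' d : R) :
  (forall n, normc (a n) * rho ^+ n <= M) -> (forall n, normc (b n) * rho' ^+ n <= M') ->
  0 < rho -> 0 < rho' -> 0 < d -> (forall v, normc v < d -> psum a v = psum b v) -> a =1 b.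
Proof.
move=> aM bM r0 r'0 d0 h n; apply/eqP; rewrite -subr_eq0; apply/eqP.
pose s := Num.min rho rho'.
have s0 : 0 < s by rewrite lt_min r0.
have aM' k : normc (a k) * s ^+ k <= M.
  apply: le_trans (aM k); rewrite ler_wpM2l ?normc_ge0// lerXn2r ?nnegrE ?(ltW s0) ?(ltW r0)//.
  by rewrite ge_min lexx.
have bM' k : normc (b k) * s ^+ k <= M'.
  apply: le_trans (bM k); rewrite ler_wpM2l ?normc_ge0// lerXn2r ?nnegrE ?(ltW s0) ?(ltW r'0)//.
  by rewrite ge_min lexx orbT.
have abM k : normc (a k - b k) * s ^+ k <= M + M'.
  apply: (@le_trans _ _ ((normc (a k) + normc (b k)) * s ^+ k)); last by rewrite mulrDl lerD.
  by rewrite ler_wpM2r ?exprn_ge0 ?(ltW s0)// -[normc (b k)]normcN normcD.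
have ds0 : 0 < Num.min d s by rewrite lt_min d0.
apply: (psum_eq0 abM s0 ds0) => v; rewrite lt_min => /andP[vd vs].
apply: csum_eq; have [ha _] := psum_geo aM' vs; have [hb _] := psum_geo bM' vs.
have := tendsB ha hb; rewrite h// subrr; apply: tends_ext => N.
by rewrite -sumrB; apply: eq_bigr => k _; rewrite mulrBl.
Qed.

Definition expands f (w : R[i]) (delta M : R) b :=
  (forall k, normc (b k) * delta ^+ k <= M) /\
  forall z : disc R, normc (disc_val z - w) < delta ->
    tends (fun n => \sum_(k < n) b k * (disc_val z - w) ^+ k) (f z).

Lemma expands_le f w (d d' M M' : R) b : expands f w d M b -> 0 <= d' <= d -> M <= M' ->
  expands f w d' M' b.
Proof.
move=> [bM h] /andP[d'0 dd'] MM'; split=> [k|z zw]; last by apply: h; exact: lt_le_trans dd'.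
apply: le_trans MM'; apply: le_trans (bM k); rewrite ler_wpM2l ?normc_ge0//.
by rewrite lerXn2r ?nnegrE// (le_trans d'0).
Qed.

Lemma disc_normc (z : disc R) : normc (disc_val z) < 1.
Proof. by rewrite -ltcR; exact: disc_lt1. Qed.

Lemma discE (z : R[i]) : normc z < 1 -> exists z' : disc R, disc_val z' = z.
Proof. by rewrite -ltcR => h; exists (Disc h). Qed.

(** The size and the bound of the expansions are the same for all centres near z0,
    which is the form that compactness can use. *)
Lemma expands_near f (z0 : disc R) : analytic f -> exists2 eta : R, 0 < eta &
  exists M : R, forall w, normc (w - disc_val z0) < eta -> exists b, expands f w eta M b.
Proof.
move=> af; have [a [M [rho [r0 M0 aM h]]]] := analytic_bound z0 af.
have e0 : 0 < rho / 2 by rewrite divr_gt0.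
exists (rho / 4); first by rewrite divr_gt0.
exists (4 * M) => w wz; pose u := w - disc_val z0.
have ur : normc u + rho / 2 < rho by rewrite /u; lra.
have [sM hs] := recenter aM e0 ur.
exists (shiftc a u); split=> [k|z zw].
  apply: (@le_trans _ _ (normc (shiftc a u k) * (rho / 2) ^+ k)).
    rewrite ler_wpM2l ?normc_ge0// lerXn2r ?nnegrE; lra.
  apply: le_trans (sM k) _; rewrite [leRHS]mulrC ler_wpM2l ?(ltW M0)//.
  rewrite invf_ple ?posrE; last 2 first.
  - by rewrite subr_gt0 ltr_pdivrMr// mul1r.
  - lra.
  rewrite lerBrDl -lerBrDr ler_pdivrMr//; rewrite /u in ur *; lra.
have v0 : normc (disc_val z - w) < rho / 2 by lra.
have zE : u + (disc_val z - w) = disc_val z - disc_val z0 by rewrite /u addrC addrA subrK.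
have zr : normc (disc_val z - disc_val z0) < rho.
  by rewrite -zE; apply: le_lt_trans (normcD _ _) _; rewrite /u; lra.
have := hs _ v0; rewrite zE.
have [hp _] := psum_geo aM zr.
by rewrite (tends_unique (h z zr) hp).
Qed.

Lemma expi_continuous (t0 e : R) : 0 < e ->
  \forall t \near t0, normc (expi t - expi t0) < e.
Proof.
move=> e0; have e2 : 0 < e / 2 by rewrite divr_gt0.
have /cvgrPdist_lt/(_ _ e2) hc := @continuous_cos R t0.
have /cvgrPdist_lt/(_ _ e2) hs := @continuous_sin R t0.
near=> t; apply: le_lt_trans (normc_le_ReIm _) _.
rewrite /= (splitr e) ltrD// distrC.
  by near: t.
by near: t.
Unshelve. all: by end_near. Qed.

(** Compactness of the circle. Sizes and bounds are indexed by one integer i, as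
    1 / (i + 1) and i, so that uniformity is a statement about large i. *)
Lemma expands_circle f (s : R) : analytic f -> 0 <= s < 1 ->
  exists2 d : R, 0 < d & exists M : R, forall t, - pi <= t <= pi ->
    forall w, normc (w - s%:C * expi t) < d -> exists b, expands f w d M b.
Proof.
move=> af /andP[s0 s1].
pose P (i : nat) (t : R) := forall w, normc (w - s%:C * expi t) < i.+1%:R^-1 ->
  exists b, expands f w i.+1%:R^-1 i%:R b.
have cpt : compact (`[(- pi)%R, pi%R]%classic : set R) by exact: segment_compact.
have /(_ nat \oo P _)[|N _ HN] := (iffLR (compact_near_coveringP _)) cpt.
  move=> t0 _.
  have [z0 zE] : exists z0 : disc R, disc_val z0 = s%:C * expi t0.
    by apply: discE; rewrite normcM normc_expi mulr1 normc_real ger0_norm.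
  have [eta e0 [M HM]] := expands_near z0 af.
  have e2 : 0 < eta / 2 by rewrite divr_gt0.
  near=> t i => w /= wt.
  have i1 : i.+1%:R^-1 < eta / 2 by near: i; exact: near_infty_natSinv_lt (PosNum e2).
  have [|b hb] := HM w.
    rewrite zE (_ : w - _ = (w - s%:C * expi t) + s%:C * (expi t - expi t0)); last by ring.
    apply: le_lt_trans (normcD _ _) _; rewrite (splitr eta) ltrD//; first exact: lt_trans i1.
    rewrite normcM normc_real ger0_norm//.
    apply: (@le_lt_trans _ _ (normc (expi t - expi t0))).
      by rewrite ler_piMl ?normc_ge0// ltW.
    by near: t; exact: expi_continuous.
  exists b; apply: expands_le hb _ _.
    by rewrite invr_ge0 ler0n/= ltW// (lt_trans i1)//; lra.
  by near: i; exact: nbhs_infty_ger.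
exists N.+1%:R^-1; first by rewrite invr_gt0.
exists N%:R => t ht w hw; apply: (HN N (leqnn N) t) => //.
Unshelve. all: by end_near. Qed.

(** The heart of the extension of the radius of convergence: local expansions
    of size delta around the points of a circle of radius t bound, through the
    Cauchy estimate, every term of the binomial expansion of
    |a_n| (t + delta / 2)^n. *)
Lemma radius_extends f a (s t d M Ms : R) : analytic f -> 0 < t < s -> s <= 1 -> 0 < d ->
  expands f 0 s Ms a ->
  (forall th, exists b, expands f (t%:C * expi th) d M b) ->
  (forall n, normc (a n) * (t + d / 2) ^+ n <= 2 * M) /\
  (forall th, expands f (t%:C * expi th) d M (shiftc a (t%:C * expi th))).
Proof.
move=> af /andP[t0 ts] s1 d0 [aM ha] hb.
have s0 : 0 < s := lt_trans t0 ts.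
have wt th : normc (t%:C * expi th) = t by rewrite normcM normc_expi mulr1 normc_real gtr0_norm.
pose y := (s - t) / 2; have y0 : 0 < y by rewrite /y; lra.
have sE th : expands f (t%:C * expi th) d M (shiftc a (t%:C * expi th)).
  have [b [bM hbz]] := hb th; set w := t%:C * expi th in hbz *.
  have wy : normc w + y < s by rewrite wt /y; lra.
  have [sM hs] := recenter aM y0 wy.
  suff -> : shiftc a w = b by [].
  apply/funext; have dy0 : 0 < Num.min d y by rewrite lt_min d0.
  apply: (psum_unique sM bM y0 d0 dy0) => v; rewrite lt_min => /andP[vd vy].
  have wv : normc (w + v) < s by apply: le_lt_trans (normcD _ _) _; lra.
  have [z zE] := discE (lt_le_trans wv s1).
  have zw : disc_val z - w = v by rewrite zE addrC addKr.
  have h1 := hbz z; rewrite zw in h1.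
  have h2 := ha z; rewrite subr0 zE in h2.
  have [hp _] := psum_geo aM wv.
  have fz := tends_unique (h2 wv) hp.
  have [hsv _] := psum_geo sM vy; have [hbv _] := psum_geo bM vd.
  by rewrite (tends_unique hsv (hs v vy)) (tends_unique hbv (h1 vd)) fz.
split => // n.
have cf (k : 'I_n.+1) : 'C(n, k)%:R * normc (a n) * t ^+ (n - k) * d ^+ k <= M.
  have t0s : 0 < t < s by rewrite t0.
  have [M' [rho' [tr [cM cE]]]] := shiftc_psum k aM t0s.
  have t01 : 0 <= t < 1 by rewrite ltW//= (lt_le_trans ts).
  have kn : (k <= n)%N by rewrite -ltnS.
  pose c j := 'C(j + k, k)%:R * a (j + k)%N.
  have H : normc (c (n - k)%N) * t ^+ (n - k) <= M / d ^+ k.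
    apply: (cauchy_estimate cM t01 tr) => th.
    rewrite -(cE _ (wt th)) ler_pdivlMr ?exprn_gt0//.
    by have [h _] := sE th; exact: h.
  move: H; rewrite /c subnK// normcM normc_nat.
  by rewrite ler_pdivlMr// exprn_gt0.
rewrite exprDn mulr_sumr.
apply: (@le_trans _ _ (\sum_(k < n.+1) M * 2^-1 ^+ k)).
  apply: ler_sum => k _; rewrite exprVn.
  have -> : normc (a n) * (t ^+ (n - k) * (d / 2) ^+ k *+ 'C(n, k)) =
    'C(n, k)%:R * normc (a n) * t ^+ (n - k) * d ^+ k / 2 ^+ k.
    by rewrite -mulr_natl expr_div_n; ring.
  by rewrite ler_wpM2r// invr_ge0 exprn_ge0.
rewrite -mulr_sumr [leRHS]mulrC ler_wpM2l//; last by rewrite half_geo_le2//; lra.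
have [b [bM _]] := hb 0; by apply: le_trans (bM 0%N); rewrite mulr1 normc_ge0.
Qed.

(** The supremum sg of the radii on which the expansion at 0 represents f cannot be
    less than 1: compactness of the circle of radius sg gives local expansions of a
    common size d, and radius_extends then passes beyond sg. *)
Theorem taylor f : analytic f -> exists a, forall s : R, 0 < s < 1 ->
  exists M, expands f 0 s M a.
Proof.
move=> af; have [a [M0 [rho [r0 _ aM0 h0]]]] := analytic_bound (disc0 R) af.
exists a; apply: contrapT => nall.
pose E := [set s : R | 0 < s <= 1 /\ exists M, expands f 0 s M a].
have [s0 [s01 ns0]] : exists s, 0 < s < 1 /\ ~ exists M, expands f 0 s M a.
  apply: contrapT => h; apply: nall => s s01; apply: contrapT => hs; apply: h; by exists s.
have ubE : ubound E s0.
  move=> s [/andP[sp _] [M hM]]; rewrite leNgt; apply/negP => s0s; apply: ns0.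
  by exists M; apply: expands_le hM _ _ => //; case/andP: s01 => /ltW -> _; rewrite /= ltW.
have E1 : E (Num.min rho 1).
  split; first by rewrite lt_min r0 ltr01/= ge_min lexx orbT.
  exists M0; have e0 : expands f 0 rho M0 a by split => // z zr; apply: h0; exact: zr.
  apply: (expands_le e0) => //.
  by rewrite ge_min lexx le_min (ltW r0) ler01.
have supE : has_sup E by split; [exists (Num.min rho 1)|exists s0].
pose sg := sup E.
have sg0 : 0 < sg.
  apply: lt_le_trans (sup_upper_bound supE E1); by rewrite lt_min r0 ltr01.
have sg1 : sg < 1.
  apply: le_lt_trans (_ : sg <= s0) _; last by case/andP: s01.
  by apply: ge_sup => //; exists (Num.min rho 1).
have sg01 : 0 <= sg < 1 by rewrite ltW.
have [d' d'0 [M HM]] := expands_circle af sg01.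
pose d := Num.min d' sg.
have d0 : 0 < d by rewrite lt_min d'0.
have [s Es ss] := sup_adherent (divr_gt0 d0 (ltr0n _ 8)) supE.
have [/andP[sp s1] [Ms hs]] := Es.
have ssg : s <= sg := sup_upper_bound supE Es.
(* t < s lies within d / 8 of sg, so the gain of d / 4 beyond t leads past sg. *)
pose t := (sg - d / 8 + s) / 2.
have dsg : d <= sg by rewrite ge_min lexx orbT.
have dd' : d <= d' by rewrite ge_min lexx.
have t0s : 0 < t < s by apply/andP; split; rewrite /t /sg; rewrite /sg in ss dsg; lra.
have [t0 ts] := andP t0s.
have tsg : sg - t < d / 8 by rewrite /t -/sg in ss *; lra.
have wn th r : 0 <= r -> normc (r%:C * expi th) = r.
  by move=> rr; rewrite normcM normc_expi mulr1 normc_real ger0_norm.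
have hb th : - pi <= th <= pi -> exists b, expands f (t%:C * expi th) d M b.
  move=> hth; have [|b hb] := HM th hth (t%:C * expi th).
    rewrite -mulrBl -rmorphB normcM normc_expi mulr1 normc_real ler0_norm; lra.
  by exists b; apply: expands_le hb _ _ => //; rewrite (ltW d0).
have hb' th : exists b, expands f (t%:C * expi th) d M b.
  have [z zE] : exists z : disc R, disc_val z = t%:C * expi th.
    by apply: discE; rewrite wn ?(ltW t0)//; lra.
  have [r [th' [r01 hth' zE']]] := polar_surj z.
  have r0' : 0 <= r by case/andP: r01.
  have rE : r = t.
    have := congr1 (fun z : disc R => normc (disc_val z)) zE'.
    by rewrite zE polarE// !wn// ltW.
  rewrite -zE zE' polarE// rE; exact: hb.
have [aM2 sE] := radius_extends af t0s s1 d0 hs hb'.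
pose s' := Num.min 1 (t + d / 4).
have s'g : sg < s' by rewrite lt_min sg1 /=; lra.
suff : E s' by move=> /(sup_upper_bound supE); rewrite leNgt -/sg s'g.
split; first by rewrite (lt_trans sg0 s'g)/= ge_min lexx.
exists (2 * M); split=> [k|z zs'].
  apply: le_trans (aM2 k); rewrite ler_wpM2l ?normc_ge0//.
  have s'0 : 0 <= s' by rewrite ltW// (lt_trans sg0).
  have s't : s' <= t + d / 4 by rewrite ge_min lexx orbT.
  rewrite lerXn2r ?nnegrE//; lra.
have [zs|sz] := ltP (normc (disc_val z)) s.
  by have [_ h] := hs; apply: h; rewrite subr0.
rewrite subr0 in zs' *.
(* Outside the disc of radius s, compare with the expansion at the point of the
   circle of radius t on the same ray. *)
have [r [th [r01 _ zE]]] := polar_surj z.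
have r0' : 0 <= r by case/andP: r01.
have rE : normc (disc_val z) = r by rewrite zE polarE// wn.
rewrite rE in sz zs'.
have rt : r < t + d / 4 by move: zs'; rewrite lt_min => /andP[].
pose w := t%:C * expi th.
have zw : disc_val z - w = (r - t)%:C * expi th by rewrite zE polarE// rmorphB mulrBl.
have zwn : normc (disc_val z - w) < 3 * d / 8 by rewrite zw wn; lra.
have d38 : 0 < 3 * d / 8 by lra.
have wr : normc w + 3 * d / 8 < t + d / 2 by rewrite wn; lra.
have [_ /(_ _ zwn)] := recenter aM2 d38 wr.
have -> : w + (disc_val z - w) = disc_val z by rewrite addrC subrK.
have [_ /(_ z)] := sE th; rewrite -/w => h1 h2.
have zwd : normc (disc_val z - w) < d by lra.
rewrite (tends_unique (h1 zwd) h2).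
have zr : normc (disc_val z) < t + d / 2 by rewrite rE; lra.
by have [] := psum_geo aM2 zr.
Qed.

End Taylor.

(** * The Hardy norm in terms of Taylor coefficients *)

Section Coefficients.
Variable R : realType.
Implicit Types (f g : disc R -> R[i]) (a b c : nat -> R[i]).

Definition taylor_coefs f a := forall s : R, 0 < s < 1 -> exists M, expands f 0 s M a.

Definition coef f : nat -> R[i] := xget (fun=> 0) [set a | taylor_coefs f a].

Lemma coefP f : analytic f -> taylor_coefs f (coef f).
Proof.
move=> /taylor[a ha]; rewrite /coef; case: xgetP => [x _ hx|/(_ a)/(_ ha)] //; exact: hx.
Qed.

Lemma half01 : 0 < (2^-1 : R) < 1.
Proof. by apply/andP; split; lra. Qed.

Lemma expands_psum f (s M : R) a (z : disc R) : expands f 0 s M a ->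
  normc (disc_val z) < s -> f z = psum a (disc_val z).
Proof.
move=> [aM h] zs; have [hp _] := psum_geo aM zs.
by apply: tends_unique hp; have := h z; rewrite subr0; apply.
Qed.

Lemma coef_expands f (s M : R) a : 0 < s -> expands f 0 s M a -> analytic f -> coef f = a.
Proof.
move=> s0 ha /coefP/(_ _ half01)[M' hb]; apply/funext.
have h0 : 0 < (2^-1 : R) by lra.
have d0 : 0 < Num.min s 2^-1 by rewrite lt_min s0.
apply: (psum_unique hb.1 ha.1 h0 s0 d0) => v; rewrite lt_min => /andP[vs vh].
have [z zE] : exists z : disc R, disc_val z = v by apply: discE; lra.
by rewrite -zE -(expands_psum ha) -?(expands_psum hb)// zE.
Qed.

Lemma coef_unique f a : taylor_coefs f a -> analytic f -> coef f = a.
Proof. by move=> /(_ _ half01)[M ha]; apply: coef_expands ha; case/andP: half01. Qed.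

Lemma taylor_coefs_ext f a : taylor_coefs f a -> forall z,
  tends (fun n => \sum_(k < n) a k * disc_val z ^+ k) (f z).
Proof.
move=> h z; have z1 := disc_normc z; have z0 := normc_ge0 (disc_val z).
have s01 : 0 < (1 + normc (disc_val z)) / 2 < 1 by apply/andP; split; lra.
have [M [_ hM]] := h _ s01; have := hM z; rewrite subr0; apply; lra.
Qed.

Lemma analytic_eq f g : analytic f -> analytic g -> coef f = coef g -> f = g.
Proof.
move=> /coefP/taylor_coefs_ext hf /coefP/taylor_coefs_ext hg e; apply/funext => z.
by have := hf z; rewrite e => h; exact: tends_unique h (hg z).
Qed.

Lemma coefD f g : analytic f -> analytic g ->
  coef (fun z => f z + g z) = fun n => coef f n + coef g n.
Proof.
move=> af ag; apply: coef_unique (analyticD af ag) => s s01.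
have [M [fM hf]] := coefP af s01; have [M' [gM hg]] := coefP ag s01.
exists (M + M'); split=> [k|z zs].
  apply: (@le_trans _ _ ((normc (coef f k) + normc (coef g k)) * s ^+ k)).
    by rewrite ler_wpM2r ?normcD// exprn_ge0//; case/andP: s01 => /ltW.
  by rewrite mulrDl lerD.
apply: tends_ext (tendsD (hf z zs) (hg z zs)) => n.
by rewrite -big_split/=; apply: eq_bigr => k _; rewrite mulrDl.
Qed.

Lemma coefZ (x : R[i]) f : analytic f -> coef (fun z => x * f z) = fun n => x * coef f n.
Proof.
move=> af; apply: coef_unique (analyticM (analytic_cst x) af) => s s01.
have [M [fM hf]] := coefP af s01.
exists (normc x * M); split=> [k|z zs]; first by rewrite normcM -mulrA ler_wpM2l ?normc_ge0.
apply: tends_ext (tendsM (tends_cst x) (hf z zs)) => n.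
by rewrite mulr_sumr; apply: eq_bigr => k _; rewrite mulrA.
Qed.

Lemma coefX f : analytic f ->
  coef (fun z => disc_val z * f z) = fun n => if n is n'.+1 then coef f n' else 0.
Proof.
move=> af; apply: coef_unique (analyticM (@analytic_id R) af) => s s01.
have [M [fM hf]] := coefP af s01; have [s0 s1] := andP s01.
have M0 : 0 <= M by apply: le_trans (fM 0%N); rewrite mulr1 normc_ge0.
exists M; split=> [[|k]|z zs]; first by rewrite normc0 mul0r.
  rewrite exprS mulrCA; apply: le_trans (fM k); rewrite ler_piMl ?(ltW s1)//.
  by rewrite mulr_ge0 ?normc_ge0// exprn_ge0// ltW.
have := tendsM (tends_cst (disc_val z)) (hf z zs); rewrite subr0.
move=> h e /h[N HN]; exists N.+1 => -[//|n] Nn; have := HN n Nn.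
rewrite big_ord_recl/= mul0r add0r mulr_sumr.
congr (normc (_ - _) < e); apply: eq_bigr => i _.
by rewrite exprS mulrCA.
Qed.

(** The difference of squares is the product of a difference, which is a geometric
    tail, and of a sum, which is bounded on the circle. *)
Lemma poly_approx f (r : R) : analytic f -> 0 <= r < 1 ->
  exists B q : R, [/\ 0 <= B, 0 <= q < 1 & forall N t,
   `| normc (f (polar r t)) ^+ 2 - normc (poly_fun (coef f) N (polar r t)) ^+ 2| <= B * q ^+ N].
Proof.
move=> af r01; have [r0 r1] := andP r01.
have s01 : 0 < (1 + r) / 2 < 1 by apply/andP; split; lra.
have [M hM] := coefP af s01; have [aM _] := hM.
pose q := r / ((1 + r) / 2).
have q01 : 0 <= q < 1 by apply: ratio01; lra.
have [q0 q1] := andP q01.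
have M0 : 0 <= M by apply: le_trans (aM 0%N); rewrite mulr1 normc_ge0.
pose K := M / (1 - q).
have K0 : 0 <= K by rewrite mulr_ge0// invr_ge0 subr_ge0 ltW.
exists (3 * K ^+ 2), q; split => // [|N t]; first by rewrite mulr_ge0// sqr_ge0.
have zr : normc (disc_val (polar r t)) = r.
  by rewrite polarE// normcM normc_expi mulr1 normc_real ger0_norm.
have zs : normc (disc_val (polar r t)) < (1 + r) / 2 by rewrite zr; lra.
have [_ hN] := psum_geo aM zs; rewrite -(expands_psum hM zs) zr -/q -/K in hN.
have h := hN N; have := hN 0%N; rewrite big_ord0 subr0 expr0 mulr1 => h0.
rewrite /poly_fun; set P := \sum_(k < N) _ in h *.
have hd := le_trans (normcB_ge _ _) h.
have qN : 0 <= q ^+ N <= 1 by rewrite exprn_ge0//= exprn_ile1// ltW.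
have [qN0 qN1] := andP qN.
have hP : normc P <= 2 * K.
  have -> : P = f (polar r t) - (f (polar r t) - P) by rewrite opprB addrC subrK.
  rewrite (le_trans (normcD _ _))// normcN.
  have : K * q ^+ N <= K by rewrite ler_piMr.
  lra.
rewrite subr_sqr normrM mulrC.
have -> : 3 * K ^+ 2 * q ^+ N = 3 * K * (K * q ^+ N) by ring.
apply: ler_pM => //; rewrite ger0_norm ?addr_ge0 ?normc_ge0//; lra.
Qed.

Lemma circle_mean_poly_diff f (r : R) : analytic f -> 0 <= r < 1 ->
  exists B q : R, [/\ 0 <= B, 0 <= q < 1 & forall N,
   (circle_mean f r <= (\sum_(k < N) (normc (coef f k) * r ^+ k) ^+ 2 + B * q ^+ N)%:E)%E /\
   ((\sum_(k < N) (normc (coef f k) * r ^+ k) ^+ 2)%:E <= circle_mean f r + (B * q ^+ N)%:E)%E].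
Proof.
move=> af r01; have [B [q [B0 q01 h]]] := poly_approx af r01.
exists B, q; split => // N; have [q0 _] := andP q01.
have BN : 0 <= B * q ^+ N by rewrite mulr_ge0// exprn_ge0.
rewrite EFinD -circle_mean_poly//; have aP := analytic_poly (coef f) N.
split; apply: circle_mean_le => // t; have := h N t; rewrite ler_norml => /andP[]; lra.
Qed.

Lemma circle_mean_coef_le f (r : R) n : analytic f -> 0 <= r < 1 ->
  ((\sum_(k < n) (normc (coef f k) * r ^+ k) ^+ 2)%:E <= circle_mean f r)%E.
Proof.
move=> af r01; have [B [q [B0 q01 h]]] := circle_mean_poly_diff af r01.
apply/lee_addgt0Pr => e e0.
have /cvgrPdist_lt/(_ _ e0)[N _ HN] := geo_null B q01.
have := HN (maxn N n) (leq_maxl _ _); rewrite sub0r normrN => /(le_lt_trans (ler_norm _)) hB.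
have [_ h2] := h (maxn N n).
apply: le_trans (le_trans h2 _); last by rewrite leeD2l// lee_fin ltW.
rewrite lee_fin -(subnKC (leq_maxr N n)) big_split_ord/= lerDl.
by apply: sumr_ge0 => k _; exact: sqr_ge0.
Qed.

Lemma circle_mean_coef_ge f (r C : R) : analytic f -> 0 <= r < 1 ->
  (forall n, \sum_(k < n) normc (coef f k) ^+ 2 <= C) -> (circle_mean f r <= C%:E)%E.
Proof.
move=> af r01 hC; have [B [q [B0 q01 h]]] := circle_mean_poly_diff af r01.
apply/lee_addgt0Pr => e e0.
have /cvgrPdist_lt/(_ _ e0)[N _ HN] := geo_null B q01.
have := HN N (leqnn _); rewrite sub0r normrN => /(le_lt_trans (ler_norm _)) hB.
have [h1 _] := h N; apply: le_trans h1 _; rewrite lee_fin lerD ?(ltW hB)//.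
apply: le_trans (hC N); apply: ler_sum => k _; have [r0 r1] := andP r01.
rewrite lerXn2r ?nnegrE ?mulr_ge0 ?normc_ge0 ?exprn_ge0//.
by rewrite ler_piMr ?normc_ge0// exprn_ile1// ltW.
Qed.

Lemma bernoulli (x : R) n : 0 <= x <= 1 -> 1 - n%:R * x <= (1 - x) ^+ n.
Proof.
move=> /andP[x0 x1]; elim: n => [|n IH]; first by rewrite mul0r subr0.
rewrite exprS -natr1; apply: (@le_trans _ _ ((1 - x) * (1 - n%:R * x))).
  have : 0 <= n%:R * x * x by rewrite !mulr_ge0.
  lra.
by rewrite ler_wpM2l// subr_ge0.
Qed.

Lemma hardy_norm2_ge_coef f n : analytic f ->
  ((\sum_(k < n) normc (coef f k) ^+ 2)%:E <= hardy_norm2 f)%E.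
Proof.
move=> af; set S := \sum_(k < n) _.
have S0 : 0 <= S by apply: sumr_ge0 => k _; exact: sqr_ge0.
apply/lee_addgt0Pr => e e0; pose T := 2 * n%:R * S + 1.
have T0 : 0 < T by rewrite ltr_wpDl// !mulr_ge0.
(* On the circle of radius 1 - x at most 2 n x S of the sum S is lost. *)
pose x := Num.min 1 (e / T).
have x0 : 0 < x by rewrite lt_min ltr01 divr_gt0.
have x1 : x <= 1 by rewrite ge_min lexx.
have xe : x * T <= e by rewrite -ler_pdivlMr// ge_min lexx orbT.
have r01 : 0 <= 1 - x < 1 by apply/andP; split; lra.
have h := le_trans (circle_mean_coef_le n af r01) (circle_mean_le_hardy f r01).
apply: (@le_trans _ _
  ((\sum_(k < n) (normc (coef f k) * (1 - x) ^+ k) ^+ 2)%:E + e%:E)%E); last first.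
  by rewrite leeD2r.
rewrite -EFinD lee_fin.
suff : S * (1 - (2 * n)%:R * x) <= \sum_(k < n) (normc (coef f k) * (1 - x) ^+ k) ^+ 2.
  move: xe; rewrite /T natrM; lra.
rewrite mulr_suml; apply: ler_sum => k _; rewrite exprMn ler_wpM2l ?sqr_ge0//.
have x01 : 0 <= x <= 1 by rewrite ltW.
rewrite -exprM; apply: le_trans (bernoulli _ x01) _.
rewrite ler_wiXn2l//; [lra|lra|].
by rewrite mulnC leq_pmul2l// ltnW.
Qed.

Lemma hardy_norm2_le_coef f (C : R) : analytic f ->
  (forall n, \sum_(k < n) normc (coef f k) ^+ 2 <= C) -> (hardy_norm2 f <= C%:E)%E.
Proof.
move=> af h; apply: ge_ereal_sup => _ [r /= + <-]; rewrite in_itv/= => r01.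
exact: circle_mean_coef_ge.
Qed.

Lemma analytic_psum a (M : R) : (forall n, normc (a n) <= M) ->
  analytic (fun z : disc R => psum a (disc_val z)) /\
  taylor_coefs (fun z : disc R => psum a (disc_val z)) a.
Proof.
move=> aM; have aM1 n : normc (a n) * 1 ^+ n <= M by rewrite expr1n mulr1.
split.
  apply: analytic_intro => z0; have z1 := disc_normc z0.
  pose eta := (1 - normc (disc_val z0)) / 2.
  have e0 : 0 < eta by rewrite /eta; lra.
  have we : normc (disc_val z0) + eta < 1 by rewrite /eta; lra.
  have [_ h] := recenter aM1 e0 we.
  exists (shiftc a (disc_val z0)), eta; split => // z ze.
  by have := h _ ze; rewrite [_ + (_ - _)]addrC subrK.
move=> s /andP[s0 s1]; exists M; split=> [k|z zs].
  by apply: le_trans (aM k); rewrite ler_piMr ?normc_ge0// exprn_ile1// ltW.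
rewrite subr0; by have [] := psum_geo aM1 (disc_normc z).
Qed.

(** Every square-summable sequence is the sequence of Taylor coefficients of a
    function in the Hardy space: boundedness of the sequence alone gives convergence in
    the disc, and re-expansion gives analyticity. *)
Lemma hardy_of_coef a (C : R) : (forall n, \sum_(k < n) normc (a k) ^+ 2 <= C) ->
  exists f : hardy R, coef f = a.
Proof.
move=> h; have C0 : 0 <= C by have := h 0%N; rewrite big_ord0.
have aM n : normc (a n) <= Num.sqrt C.
  rewrite -[leLHS]ger0_norm ?normc_ge0// -sqrtr_sqr ler_wsqrtr//.
  apply: le_trans (h n.+1); rewrite big_ord_recr/= lerDr; apply: sumr_ge0 => k _; exact: sqr_ge0.
have [af ta] := analytic_psum aM; have ca := coef_unique ta af.
have fin : (hardy_norm2 (fun z : disc R => psum a (disc_val z)) < +oo)%E.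
  apply: le_lt_trans (ltry C); apply: hardy_norm2_le_coef => // n.
  by rewrite ca.
have hf : (fun z : disc R => psum a (disc_val z)) \in @hardy2 R by apply/hardy2P.
by exists (Hardy hf).
Qed.

End Coefficients.

(** * The Hardy space as a Hilbert space *)

Section HilbertSpace.
Variable R : realType.
Implicit Types (f g u v : hardy R).
Local Notation cf f := (coef (hardy_fun f)).

Lemma conjD (x y : R[i]) : conjc (x + y) = conjc x + conjc y.
Proof. exact: (rmorphD (@conjc R)). Qed.

Lemma conjN (x : R[i]) : conjc (- x) = - conjc x.
Proof. exact: (rmorphN (@conjc R)). Qed.

Lemma conjB (x y : R[i]) : conjc (x - y) = conjc x - conjc y.
Proof. by rewrite conjD conjN. Qed.

Lemma conj_sum n (F : 'I_n -> R[i]) : conjc (\sum_i F i) = \sum_i conjc (F i).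
Proof. by apply: (big_morph (@conjc R)) => //; [exact: conjD|exact: conjc0]. Qed.

Lemma realC_sum n (F : 'I_n -> R) : (\sum_i F i)%:C = \sum_i (F i)%:C.
Proof. by apply: (big_morph (@real_complex R)) => // x y; exact: rmorphD. Qed.

Lemma realCB (x y : R) : (x - y)%:C = x%:C - y%:C.
Proof. exact: rmorphB. Qed.

Lemma realCM (x y : R) : (x * y)%:C = x%:C * y%:C.
Proof. exact: rmorphM. Qed.

Lemma realCX (x : R) n : (x ^+ n)%:C = x%:C ^+ n.
Proof. exact: rmorphXn. Qed.

Definition sqn f : R := fine (hardy_norm2 f).
Definition nrm f : R := Num.sqrt (sqn f).

Lemma sqn_ge0 f : 0 <= sqn f.
Proof. exact: fine_hardy_norm2_ge0. Qed.

Lemma nrm_ge0 f : 0 <= nrm f.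
Proof. exact: sqrtr_ge0. Qed.

Lemma nrmE f : `|f| = (nrm f)%:C.
Proof. by []. Qed.

Lemma nrm_sqr f : nrm f ^+ 2 = sqn f.
Proof. by rewrite sqr_sqrtr// sqn_ge0. Qed.

Lemma hardy_norm2E f : hardy_norm2 f = (sqn f)%:E.
Proof. exact: hardy_norm2_fin. Qed.

Lemma nrm_eq0 f : nrm f = 0 -> f = 0.
Proof. by move=> h; apply: hardy_norm_eq0; rewrite /hardy_norm -/(sqn f) -/(nrm f) h. Qed.

Lemma nrmZ (x : R[i]) f : nrm (x *: f) = normc x * nrm f.
Proof.
have h : (nrm (x *: f))%:C = (normc x)%:C * (nrm f)%:C := hardy_normZ x f.
by move: h; rewrite -realCM => /complexI.
Qed.

Lemma nrmD f g : nrm (f + g) <= nrm f + nrm g.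
Proof. by have := hardy_normD f g; rewrite /hardy_norm -rmorphD lecR. Qed.

Lemma nrmN f : nrm (- f) = nrm f.
Proof. by rewrite -scaleN1r nrmZ normcN normc1 mul1r. Qed.

Lemma nrm0 : nrm 0 = 0.
Proof. by rewrite -(scale0r (0 : hardy R)) nrmZ normc0 mul0r. Qed.

Lemma nrmB f g : nrm (f - g) <= nrm f + nrm g.
Proof. by rewrite -[nrm g]nrmN nrmD. Qed.

(* The norm enters below only through the norm laws and the coefficients. *)
Opaque sqn nrm.

Lemma coef_add f g : cf (f + g) = fun n => cf f n + cf g n.
Proof. exact: coefD (@hardy_analytic _ f) (@hardy_analytic _ g). Qed.

Lemma coef_scale (x : R[i]) f : cf (x *: f) = fun n => x * cf f n.
Proof. exact: coefZ (@hardy_analytic _ f). Qed.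

Lemma coef_opp f : cf (- f) = fun n => - cf f n.
Proof. by rewrite -scaleN1r coef_scale; apply/funext => n; rewrite mulN1r. Qed.

Lemma coef_zero : cf (0 : hardy R) = fun=> 0.
Proof. by rewrite -(scale0r (0 : hardy R)) coef_scale; apply/funext => n; rewrite mul0r. Qed.

Lemma coef_sub f g : cf (f - g) = fun n => cf f n - cf g n.
Proof. by rewrite coef_add coef_opp. Qed.

Lemma coef_sum n (F : 'I_n -> hardy R) k : cf (\sum_i F i) k = \sum_i cf (F i) k.
Proof.
elim: n F => [|n IH] F; first by rewrite !big_ord0 coef_zero.
by rewrite !big_ord_recl coef_add IH.
Qed.

Lemma hardy_eq f g : cf f = cf g -> f = g.
Proof.
move=> e; apply: val_inj; apply: analytic_eq e; exact: hardy_analytic.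
Qed.

Lemma sqn_ge f n : \sum_(k < n) normc (cf f k) ^+ 2 <= sqn f.
Proof.
rewrite -lee_fin -hardy_norm2E; apply: hardy_norm2_ge_coef; exact: hardy_analytic.
Qed.

Lemma sqn_le f (C : R) : (forall n, \sum_(k < n) normc (cf f k) ^+ 2 <= C) -> sqn f <= C.
Proof.
move=> h; rewrite -lee_fin -hardy_norm2E.
apply: hardy_norm2_le_coef h; exact: hardy_analytic.
Qed.

Lemma sqn_coef f n : normc (cf f n) ^+ 2 <= sqn f.
Proof.
apply: le_trans (sqn_ge f n.+1); rewrite big_ord_recr/= lerDr.
by apply: sumr_ge0 => k _; exact: sqr_ge0.
Qed.

Lemma coef_le_nrm f n : normc (cf f n) <= nrm f.
Proof.
by rewrite -(@ler_pXn2r _ 2)// ?nnegrE ?normc_ge0 ?nrm_ge0// nrm_sqr sqn_coef.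
Qed.

Lemma psums_mono f n m : (n <= m)%N ->
  \sum_(k < n) normc (cf f k) ^+ 2 <= \sum_(k < m) normc (cf f k) ^+ 2.
Proof.
move=> nm; rewrite -(subnKC nm) big_split_ord/= lerDl.
by apply: sumr_ge0 => k _; exact: sqr_ge0.
Qed.

Lemma sqn_near f (e : R) : 0 < e -> exists N, forall n, (N <= n)%N ->
  sqn f - e < \sum_(k < n) normc (cf f k) ^+ 2 <= sqn f.
Proof.
move=> e0; apply: contrapT => h.
have : sqn f <= sqn f - e.
  apply: sqn_le => n; rewrite leNgt; apply/negP => hn; apply: h.
  exists n => m nm; rewrite sqn_ge andbT; exact: lt_le_trans (psums_mono f nm).
lra.
Qed.

Lemma mulconj_normc (x : R[i]) : x * conjc x = (normc x ^+ 2)%:C.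
Proof.
case: x => a b; rewrite /= sqr_sqrtr ?addr_ge0 ?sqr_ge0//.
by apply/eqP; rewrite eq_complex/=; apply/andP; split; apply/eqP; ring.
Qed.

Lemma sqn_lim f : tends (fun n => \sum_(k < n) cf f k * conjc (cf f k)) (sqn f)%:C.
Proof.
move=> e /(sqn_near f)[N HN]; exists N => n /HN /andP[h1 h2].
under eq_bigr do rewrite mulconj_normc.
rewrite -realC_sum -realCB normc_real ger0_norm; lra.
Qed.

Lemma polarization (a b : R[i]) :
  4^-1 * \sum_(k < 4) 'i ^+ k * ((a + 'i ^+ k * b) * conjc (a + 'i ^+ k * b)) = a * conjc b.
Proof.
have i2 : ('i ^+ 2 : R[i]) = -1 by exact: sqr_i.
have i3 : ('i ^+ 3 : R[i]) = - 'i by rewrite exprS i2 mulrN1.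
have ci : conjc 'i = - 'i :> R[i] by apply/eqP; rewrite eq_complex/= oppr0 !eqxx.
rewrite !big_ord_recl big_ord0 /bump/=.
rewrite (_ : bump 0 0 = 1%N)// (_ : bump 0 1 = 2%N)// (_ : bump 0 2 = 3%N)//
  expr0 expr1 i2 i3.
rewrite !mul1r !mulN1r !mulNr !(conjD, conjN, conjM) ci.
set A := conjc a; set B := conjc b; set j := ('i : R[i]) in i2 *.
have -> : (a + b) * (A + B) + (j * ((a + j * b) * (A + - j * B)) +
   (- ((a - b) * (A - B)) + (- (j * ((a - j * b) * (A - - j * B))) + 0))) =
   2 * (a * B) + 2 * (b * A) + j ^+ 2 * (2 * (b * A) - 2 * (a * B)) by ring.
by rewrite i2; field.
Qed.

(** Polarization, applied to each pair of coefficients. *)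
Lemma inner_lim f g : tends (fun n => \sum_(k < n) cf f k * conjc (cf g k)) (inner f g).
Proof.
rewrite /inner.
have h (k : 'I_4) : tends (fun n => 'i ^+ k * \sum_(j < n) (cf f j + 'i ^+ k * cf g j) *
    conjc (cf f j + 'i ^+ k * cf g j)) ('i ^+ k * `|f + 'i ^+ k *: g| ^+ 2).
  apply: tendsM; first exact: tends_cst.
  rewrite nrmE -realCX nrm_sqr; have := sqn_lim (f + 'i ^+ k *: g).
  by rewrite coef_add coef_scale.
have := tendsM (tends_cst 4^-1) (tends_sum h); apply: tends_ext => n.
under eq_bigr do rewrite mulr_sumr.
rewrite exchange_big/= mulr_sumr; apply: eq_bigr => j _.
exact: polarization.
Qed.

(* Only sesquilinearity and the formula in coefficients matter from here on. *)
Opaque inner.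

Lemma innerC f g : inner g f = conjc (inner f g).
Proof.
have := tends_conj (inner_lim f g); apply: tends_unique.
apply: tends_ext (inner_lim g f) => n.
rewrite conj_sum; apply: eq_bigr => k _.
by rewrite conjM conjcK mulrC.
Qed.

Lemma innerDl f g v : inner (f + g) v = inner f v + inner g v.
Proof.
apply: tends_unique (inner_lim _ _) _.
apply: tends_ext (tendsD (inner_lim f v) (inner_lim g v)) => n.
by rewrite -big_split/=; apply: eq_bigr => k _; rewrite coef_add mulrDl.
Qed.

Lemma innerZl (x : R[i]) f v : inner (x *: f) v = x * inner f v.
Proof.
apply: tends_unique (inner_lim _ _) _.
apply: tends_ext (tendsM (tends_cst x) (inner_lim f v)) => n.
by rewrite mulr_sumr; apply: eq_bigr => k _; rewrite coef_scale mulrA.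
Qed.

Lemma innerBl f g v : inner (f - g) v = inner f v - inner g v.
Proof. by rewrite innerDl -scaleN1r innerZl mulN1r. Qed.

Lemma inner_suml n (F : 'I_n -> hardy R) v : inner (\sum_i F i) v = \sum_i inner (F i) v.
Proof.
elim: n F => [|n IH] F; last by rewrite !big_ord_recl innerDl IH.
by rewrite !big_ord0 -(scale0r v) innerZl mul0r.
Qed.

Lemma innerDr f g v : inner v (f + g) = inner v f + inner v g.
Proof.
rewrite (innerC (f + g) v) innerDl conjD.
by congr (_ + _); apply/esym; exact: innerC.
Qed.

Lemma innerZr (x : R[i]) f v : inner v (x *: f) = conjc x * inner v f.
Proof. rewrite (innerC (x *: f) v) innerZl conjM; congr (_ * _).
by apply/esym; exact: innerC. Qed.

Lemma inner_self f : inner f f = (sqn f)%:C.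
Proof. exact: tends_unique (inner_lim f f) (sqn_lim f). Qed.

Lemma inner_half f g : normc (inner f g) <= (sqn f + sqn g) / 2.
Proof.
apply: (tends_normc_le (inner_lim f g)) => n.
rewrite (le_trans (normc_sum _))//.
apply: (@le_trans _ _ (\sum_(k < n) (normc (cf f k) ^+ 2 + normc (cf g k) ^+ 2) / 2)).
  apply: ler_sum => k _; rewrite normcM normc_conj.
  have := sqr_ge0 (normc (cf f k) - normc (cf g k)); lra.
by rewrite -mulr_suml big_split/= ler_wpM2r// lerD// sqn_ge.
Qed.

Lemma normalize_sqn f : 0 < nrm f -> sqn ((nrm f)^-1%:C *: f) = 1.
Proof.
move=> fp; rewrite -nrm_sqr nrmZ normc_real.
have -> : `|(nrm f)^-1| = (nrm f)^-1 by rewrite ger0_norm// invr_ge0 nrm_ge0.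
by rewrite mulVf ?expr1n// gt_eqF.
Qed.

Lemma unscale_le (p q x : R) : 0 < p -> 0 < q ->
  `|p^-1| * (`|q^-1| * x) <= (1 + 1) / 2 -> x <= p * q.
Proof.
move=> p0 q0; rewrite !ger0_norm ?invr_ge0 ?(ltW p0) ?(ltW q0)//.
have -> : (1 + 1) / 2 = 1 :> R by lra.
by rewrite ler_pdivrMl// ler_pdivrMl// mulr1 mulrC.
Qed.

(** The Cauchy-Schwarz inequality, reduced to the arithmetic-geometric mean
    inequality by normalizing both vectors. *)
Lemma inner_le f g : normc (inner f g) <= nrm f * nrm g.
Proof.
have [f0|f0] := eqVneq (nrm f) 0.
  by rewrite (nrm_eq0 f0) -(scale0r (0 : hardy R)) innerZl mul0r normc0 scale0r mulr_ge0 ?nrm_ge0.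
have [g0|g0] := eqVneq (nrm g) 0.
  by rewrite innerC normc_conj (nrm_eq0 g0) -(scale0r (0 : hardy R)) innerZl mul0r normc0
    mulr_ge0 ?nrm_ge0.
have fp : 0 < nrm f by rewrite lt_def f0 nrm_ge0.
have gp : 0 < nrm g by rewrite lt_def g0 nrm_ge0.
apply: (unscale_le fp gp).
have := inner_half ((nrm f)^-1%:C *: f) ((nrm g)^-1%:C *: g).
rewrite (normalize_sqn fp) (normalize_sqn gp) innerZl innerZr.
by rewrite [normc (_ * _)]normcM [normc (_ * inner _ _)]normcM normc_conj !normc_real.
Qed.

Lemma nrm_le (f : hardy R) (C : R) : 0 <= C ->
  (forall n, \sum_(k < n) normc (cf f k) ^+ 2 <= C ^+ 2) -> nrm f <= C.
Proof.
move=> C0 h; rewrite -(@ler_pXn2r _ 2)// ?nnegrE ?nrm_ge0// nrm_sqr; exact: sqn_le.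
Qed.

(** ** Monomials *)

Lemma mono_subproof n : exists f : hardy R, cf f = fun k => (k == n)%:R.
Proof.
apply: (@hardy_of_coef _ _ 1) => m.
have [mn|nm] := leqP m n.
  rewrite big1 ?ler01// => k _; have := ltn_ord k.
  by case: eqP => [->|_ _]; [rewrite ltnNge mn|rewrite normc0 expr0n].
rewrite (bigD1 (Ordinal nm))//= eqxx normc1 expr1n big1 ?addr0// => k kn.
have /negbTE -> : val k != n by apply: contra kn => /eqP e; apply/eqP/val_inj.
by rewrite normc0 expr0n.
Qed.

Definition mono n : hardy R := projT1 (cid (mono_subproof n)).

Lemma coef_mono n : cf (mono n) = fun k => (k == n)%:R.
Proof. exact: projT2 (cid (mono_subproof n)). Qed.

Lemma inner_mono f n : inner f (mono n) = cf f n.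
Proof.
apply: tends_unique (inner_lim _ _) _ => e e0; exists n.+1 => m nm.
rewrite (bigD1 (Ordinal nm))//= coef_mono eqxx conjc1 mulr1 big1 ?addr0 ?subrr ?normc0//.
move=> k kn; have /negbTE -> : val k != n by apply: contra kn => /eqP e'; apply/eqP/val_inj.
by rewrite conjc0 mulr0.
Qed.

Definition trunc f n : hardy R := \sum_(k < n) cf f k *: mono k.

Lemma coef_trunc f n k : cf (trunc f n) k = if (k < n)%N then cf f k else 0.
Proof.
rewrite coef_sum; case: ltnP => [kn|nk].
  rewrite (bigD1 (Ordinal kn))//= coef_scale coef_mono eqxx mulr1 big1 ?addr0// => j jk.
  rewrite coef_scale coef_mono; have /negbTE -> : k != val j.
    by apply: contra jk => /eqP e; apply/eqP/val_inj.
  by rewrite mulr0.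
rewrite big1// => j _; rewrite coef_scale coef_mono; have := ltn_ord j.
by case: eqP => [<-|_]; [rewrite ltnNge nk|rewrite mulr0].
Qed.

Lemma sqn_trunc (c : nat -> R[i]) n :
  sqn (\sum_(k < n) c k *: mono k) = \sum_(k < n) normc (c k) ^+ 2.
Proof.
suff : inner (\sum_(k < n) c k *: mono k) (\sum_(k < n) c k *: mono k) =
    (\sum_(k < n) normc (c k) ^+ 2)%:C by rewrite inner_self => -[].
rewrite {1}inner_suml realC_sum; apply: eq_bigr => k _.
rewrite innerZl innerC inner_mono coef_sum -mulconj_normc; congr (_ * conjc _).
rewrite (bigD1 k)//= coef_scale coef_mono eqxx mulr1 big1 ?addr0// => j jk.
rewrite coef_scale coef_mono; have /negbTE -> : val k != val j.
  by rewrite eq_sym; apply: contra jk => /eqP/val_inj ->.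
by rewrite mulr0.
Qed.

Lemma trunc_near f (e : R) : 0 < e -> exists N, forall n, (N <= n)%N -> nrm (f - trunc f n) <= e.
Proof.
move=> e0; have e20 : 0 < e ^+ 2 by rewrite exprn_gt0.
have [N HN] := sqn_near f e20; exists N => n Nn; have /andP[h1 h2] := HN n Nn.
apply: nrm_le; first exact: ltW.
move=> m; apply: (@le_trans _ _ (\sum_(k < m + n) normc (cf (f - trunc f n) k) ^+ 2)).
  by apply: psums_mono; rewrite leq_addr.
rewrite addnC big_split_ord/= big1 ?add0r; last first.
  by move=> k _; rewrite coef_sub coef_trunc ltn_ord subrr normc0 expr0n.
under eq_bigr do rewrite coef_sub coef_trunc ltnNge leq_addr subr0.
have := sqn_ge f (n + m); rewrite big_split_ord/=; lra.
Qed.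

(** The coefficients converge one by one, and the bound on the norm passes to the
    limit in each finite partial sum, as in Fatou's lemma. *)
Lemma hardy_complete (u : nat -> hardy R) (E : nat -> R) :
  (forall n m, (n <= m)%N -> nrm (u m - u n) <= E n) -> E @ \oo --> (0 : R) ->
  exists v, forall n, nrm (v - u n) <= E n.
Proof.
move=> uE E0.
have E_ge0 n : 0 <= E n by apply: le_trans (nrm_ge0 _) (uE n n (leqnn n)).
have lim k : exists l, tends (fun n => cf (u n) k) l.
  apply: (tends_complete _ E0) => n m nm; apply: le_trans (uE n m nm).
  by have := coef_le_nrm (u m - u n) k; rewrite coef_sub.
have [l hl] := choice lim.
have fatou n m : \sum_(k < m) normc (l k - cf (u n) k) ^+ 2 <= E n ^+ 2.
  have h (k : 'I_m) : tends (fun p => (cf (u p) k - cf (u n) k) * conjc (cf (u p) k - cf (u n) k))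
      ((normc (l k - cf (u n) k) ^+ 2)%:C).
    rewrite -mulconj_normc; apply: tendsM; last apply: tends_conj;
      by apply: tendsB (hl k) (tends_cst _).
  have := tends_sum h; rewrite -realC_sum => ht.
  have := @tends_normc_le _ _ _ (E n ^+ 2) (tends_shift n ht).
  rewrite normc_real ger0_norm; last by apply: sumr_ge0 => k _; exact: sqr_ge0.
  apply=> p; under eq_bigr do rewrite mulconj_normc.
  rewrite -realC_sum normc_real ger0_norm; last by apply: sumr_ge0 => k _; exact: sqr_ge0.
  have := uE n (p + n)%N (leq_addl _ _).
  rewrite -(@ler_pXn2r _ 2)// ?nnegrE ?nrm_ge0// nrm_sqr; apply: le_trans.
  apply: le_trans (sqn_ge _ m); apply: ler_sum => k _.
  by rewrite coef_sub.
have [d hd] : exists d : hardy R, cf d = fun k => l k - cf (u 0%N) k.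
  exact: (hardy_of_coef (fatou 0%N)).
exists (d + u 0%N) => n; apply: nrm_le => // m.
have := fatou n m; congr (_ <= _); apply: eq_bigr => k _.
by rewrite coef_sub coef_add hd subrK.
Qed.

End HilbertSpace.

Opaque inner sqn nrm mono coef.

(** * Bounded operators, adjoints and Neumann series *)

Section Operators.
Variable R : realType.
Implicit Types (f g u v : hardy R) (T A : hardy R -> hardy R) (K : R).
Local Notation cf f := (coef (hardy_fun f)).

Definition bdd T K := [/\ linear T, 0 <= K & forall v, nrm (T v) <= K * nrm v].

Lemma bddP T : bounded_operator T <-> exists K, bdd T K.
Proof.
split=> [[lT [k hk]]|[K [lT K0 hK]]]; last first.
  by split => //; exists K%:C => v; rewrite !nrmE -realCM lecR.
exists (normc k); split => //; first exact: normc_ge0.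
move=> v; rewrite -lecR realCM.
have h := hk v; rewrite !nrmE in h.
have h0 : 0 <= k * (nrm v)%:C by apply: le_trans h; rewrite lecR nrm_ge0.
have hn : `|(nrm v)%:C| = (nrm v)%:C :> R[i] by rewrite ger0_norm// lecR nrm_ge0.
by move: h; rewrite -[X in _ <= X](ger0_norm h0) normrM hn.
Qed.

Lemma op_add T : linear T -> forall u v, T (u + v) = T u + T v.
Proof. by move=> lT u v; have := lT 1 u v; rewrite !scale1r. Qed.

Lemma op_zero T : linear T -> T 0 = 0.
Proof.
move=> lT; have := lT 1 0 0.
by rewrite !scale1r addr0 => /eqP; rewrite -subr_eq subrr => /eqP.
Qed.

Lemma op_scale T : linear T -> forall (x : R[i]) u, T (x *: u) = x *: T u.
Proof. by move=> lT x u; have := lT x u 0; rewrite !addr0 (op_zero lT) addr0. Qed.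

Lemma op_sub T : linear T -> forall u v, T (u - v) = T u - T v.
Proof.
by move=> lT u v; rewrite (op_add lT) -scaleN1r (op_scale lT) scaleN1r.
Qed.

Lemma op_sum T n (F : 'I_n -> hardy R) : linear T -> T (\sum_i F i) = \sum_i T (F i).
Proof.
move=> lT; elim: n F => [|n IH] F; first by rewrite !big_ord0 op_zero.
by rewrite !big_ord_recl (op_add lT) IH.
Qed.

Lemma bdd_comp T A K K' : bdd T K -> bdd A K' -> bdd (fun v => T (A v)) (K * K').
Proof.
move=> [lT K0 hT] [lA K'0 hA]; split; last 2 first.
- exact: mulr_ge0.
- by move=> v; apply: le_trans (hT _) _; rewrite -mulrA ler_wpM2l.
- by move=> x u v; rewrite lA lT.
Qed.

Lemma bdd_scale T K (x : R[i]) : bdd T K -> bdd (fun v => x *: T v) (normc x * K).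
Proof.
move=> [lT K0 hT]; split; last 2 first.
- by rewrite mulr_ge0// normc_ge0.
- by move=> v; rewrite nrmZ -mulrA ler_wpM2l// normc_ge0.
- by move=> y u v; rewrite lT scalerDr !scalerA mulrC.
Qed.

Lemma inner_ext u v : (forall w, inner w u = inner w v) -> u = v.
Proof.
move=> h; apply: hardy_eq; apply/funext => n.
by rewrite -!inner_mono innerC h -innerC.
Qed.

Lemma sqr_le_mul (s p : R) : 0 <= s -> 0 <= p -> s ^+ 2 <= p * s -> s ^+ 2 <= p ^+ 2.
Proof.
move=> s0 p0 h; have [->|sn] := eqVneq s 0; first by rewrite expr0n sqr_ge0.
have sp : 0 < s by rewrite lt_def sn.
by move: h; rewrite expr2 ler_pM2r// => h; rewrite -expr2 lerXn2r ?nnegrE.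
Qed.

(** Testing the would-be value of the adjoint against its own truncations
    bounds the sum of the squares of its coefficients. *)
Lemma adjoint_coefs T K u n : bdd T K ->
  \sum_(k < n) normc (conjc (inner (T (mono R k)) u)) ^+ 2 <= (K * nrm u) ^+ 2.
Proof.
move=> [lT K0 hT]; pose b k := conjc (inner (T (mono R k)) u).
change (\sum_(k < n) normc (b k) ^+ 2 <= (K * nrm u) ^+ 2).
set B := \sum_(k < n) _.
have B0 : 0 <= B by apply: sumr_ge0 => k _; exact: sqr_ge0.
pose f := \sum_(k < n) b k *: mono R k.
have nf : B = nrm f ^+ 2 by rewrite nrm_sqr sqn_trunc.
have fB : normc (inner (T f) u) = B.
  rewrite (op_sum _ lT) inner_suml.
  have -> : \sum_(k < n) inner (T (b k *: mono R k)) u = B%:C.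
    rewrite realC_sum; apply: eq_bigr => k _.
    by rewrite (op_scale lT) innerZl -mulconj_normc /b conjcK.
  by rewrite normc_real ger0_norm.
have Ku0 : 0 <= K * nrm u by rewrite mulr_ge0// nrm_ge0.
rewrite nf; apply: (sqr_le_mul (nrm_ge0 f) Ku0).
rewrite -nf -fB mulrAC; apply: le_trans (inner_le _ _) _.
by have h := ler_wpM2r (nrm_ge0 u) (hT f); exact: h.
Qed.

(** Both sides of the adjunction are continuous in the first variable and agree on
    monomials, hence on the truncations of any function. *)
Lemma adjoint_exists T K : bdd T K -> exists A, adjoint_of T A /\ bdd A K.
Proof.
move=> bT; have [lT K0 hT] := bT.
have /choice[A hA] : forall u, exists a : hardy R,
    cf a = (fun k => conjc (inner (T (mono R k)) u)).
  by move=> u; apply: hardy_of_coef => n; exact: adjoint_coefs bT.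
have bA u : nrm (A u) <= K * nrm u.
  apply: nrm_le => [|n]; first by rewrite mulr_ge0// nrm_ge0.
  by rewrite hA; exact: adjoint_coefs.
have adjT : adjoint_of T A.
  move=> u v; pose D w := inner (T w) v - inner w (A v).
  have Dm k : D (mono R k) = 0.
    by rewrite /D [X in _ - X]innerC inner_mono hA conjcK subrr.
  have DB w w' : D (w - w') = D w - D w'.
    rewrite /D (op_sub lT) !innerBl.
    by move: (inner (T w) v) (inner (T w') v) (inner w (A v)) (inner w' (A v)) => a b c d; ring.
  have Dt n : D (trunc u n) = 0.
    rewrite /D /trunc (op_sum _ lT) !inner_suml -sumrB big1// => k _.
    by rewrite (op_scale lT) !innerZl -mulrBr -/(D _) Dm mulr0.
  have Dle w : normc (D w) <= 2 * (K * nrm v) * nrm w.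
    apply: le_trans (normcD _ _) _; rewrite normcN.
    have h3 := ler_wpM2r (nrm_ge0 v) (hT w).
    have h4 := ler_wpM2l (nrm_ge0 w) (bA v).
    apply: le_trans (lerD (le_trans (inner_le _ _) h3) (le_trans (inner_le _ _) h4)) _.
    move: (nrm v) (nrm w) => p q.
    by rewrite le_eqVlt; apply/orP; left; apply/eqP; ring.
  suff : normc (D u) = 0 by move=> /eq0_normc/eqP; rewrite subr_eq0 => /eqP.
  apply/le_anti; rewrite normc_ge0 andbT; apply/ler_addgt0Pr => e e0; rewrite add0r.
  pose L := 2 * (K * nrm v) + 1.
  have L0 : 0 < L by rewrite ltr_wpDl// !mulr_ge0 ?nrm_ge0.
  have [N /(_ N (leqnn N)) hN] := trunc_near u (divr_gt0 e0 L0).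
  have -> : D u = D (u - trunc u N) by rewrite DB Dt subr0.
  apply: le_trans (Dle _) _; apply: (@le_trans _ _ (L * nrm (u - trunc u N))).
    by rewrite ler_wpM2r ?nrm_ge0// /L lerDl.
  by rewrite mulrC -ler_pdivlMr.
exists A; split; first exact: adjT.
split; [|exact: K0|exact: bA].
move=> x u v; apply: inner_ext => w.
by rewrite -adjT innerDr innerZr innerDr innerZr !adjT.
Qed.

(** The iterates of w |-> v + T w form a Cauchy sequence, because T contracts. *)
Lemma neumann T (q : R) v : bdd T q -> q < 1 -> exists u, u = v + T u.
Proof.
move=> [lT q0 hT] q1; have q01 : 0 <= q < 1 by rewrite q0.
pose u n := iter n (fun w => v + T w) v.
pose C := nrm (T v).
have step n : nrm (u n.+1 - u n) <= C * q ^+ n.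
  elim: n => [|n IH]; first by rewrite /u/= addrC addKr mulr1.
  have -> : u n.+2 - u n.+1 = T (u n.+1 - u n).
    by rewrite (op_sub lT) /u !iterS opprD addrACA subrr add0r.
  by apply: le_trans (hT _) _; rewrite exprS mulrCA ler_wpM2l.
have cau n m : (n <= m)%N -> nrm (u m - u n) <= C / (1 - q) * q ^+ n.
  move=> nm; apply: (@le_trans _ _ (\sum_(n <= k < m) C * q ^+ k)).
    elim: m nm => [|m IH]; first by rewrite leqn0 => /eqP ->; rewrite subrr nrm0 big_geq.
    rewrite leq_eqVlt ltnS => /orP[/eqP ->|nm]; first by rewrite subrr nrm0 big_geq.
    rewrite big_nat_recr//= addrC.
    have -> : u m.+1 - u n = (u m.+1 - u m) + (u m - u n) by rewrite addrA subrK.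
    by apply: le_trans (nrmD _ _) _; rewrite lerD// IH.
  by rewrite -mulr_sumr -mulrA ler_wpM2l ?nrm_ge0// mulrC geo_tail_le.
have [U hU] := hardy_complete cau (geo_null _ q01).
exists U; apply/eqP; rewrite -subr_eq0; apply/eqP/nrm_eq0/le_anti; rewrite nrm_ge0 andbT.
apply/ler_addgt0Pr => e e0; rewrite add0r.
have /cvgrPdist_lt/(_ _ (divr_gt0 e0 (ltr0n _ 2)))[N _ HN] := geo_null (C / (1 - q)) q01.
have small n : (N <= n)%N -> nrm (U - u n) <= e / 2.
  move=> Nn; apply: le_trans (hU n) _; have := HN n Nn; rewrite sub0r normrN => h.
  by apply: ltW; apply: le_lt_trans h; exact: ler_norm.
have -> : U - (v + T U) = (U - u N.+1) - T (U - u N).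
  have e' : u N.+1 = v + T (u N) by [].
  rewrite (op_sub lT) e'; move: (T U) (T (u N)) => a b.
  by rewrite opprB !opprD !addrA subrK.
have s1 := small N.+1 (leqnSn N); have s2 := small N (leqnn N).
have s3 : q * nrm (U - u N) <= nrm (U - u N) by exact: ler_piMl (nrm_ge0 _) (ltW q1).
apply: le_trans (nrmB _ _) _; rewrite [e in leRHS](splitr e).
exact: lerD s1 (le_trans (hT _) (le_trans s3 s2)).
Qed.

End Operators.

(** * Bounded analytic functions and reciprocals *)

Section BoundedAnalytic.
Variable R : realType.
Implicit Types (f g : disc R -> R[i]).

Definition Hoo f := analytic f /\ exists B : R, forall z, normc (f z) <= B.

Lemma Hoo_hinfty f : Hoo f -> exists phi : hinfty R, hinfty_fun phi = f.
Proof. by move=> [af bf]; exists (Hinfty af bf). Qed.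

Lemma mulop_nrm (phi : hinfty R) (B : R) (u : hardy R) : (forall z, normc (phi z) <= B) ->
  nrm (mulop phi u) <= B * nrm u.
Proof.
move=> hB; have B0 : 0 <= B := le_trans (normc_ge0 _) (hB (disc0 R)).
rewrite -(@ler_pXn2r _ 2)// ?nnegrE ?mulr_ge0 ?nrm_ge0// exprMn !nrm_sqr.
rewrite -lee_fin EFinM -!hardy_norm2E.
exact: hardy_norm2M (hinfty_analytic phi) (@hardy_analytic _ u) hB.
Qed.

Lemma mulop_linear (phi : hinfty R) : linear (mulop phi).
Proof.
move=> x u v; apply: val_inj; apply/funext => z.
transitivity (phi z * (x * u z + v z)); first by [].
transitivity (x * (phi z * u z) + phi z * v z); last by [].
by rewrite mulrDr mulrCA.
Qed.

Lemma mulop_bdd (phi : hinfty R) (B : R) : (forall z, normc (phi z) <= B) ->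
  bdd (mulop phi) B.
Proof.
move=> hB; split; [exact: mulop_linear| |by move=> u; exact: mulop_nrm].
exact: le_trans (normc_ge0 _) (hB (disc0 R)).
Qed.

Lemma hardy_psum (u : hardy R) z :
  tends (fun n => \sum_(k < n) coef u k * disc_val z ^+ k) (u z).
Proof. exact: taylor_coefs_ext (coefP (@hardy_analytic _ u)) z. Qed.

Lemma mono_val n (z : disc R) : mono R n z = disc_val z ^+ n.
Proof.
apply: tends_unique (hardy_psum _ z) _ => e e0; exists n.+1 => m nm.
rewrite coef_mono (bigD1 (Ordinal nm))//= eqxx mul1r big1 ?addr0 ?subrr ?normc0// => k kn.
have /negbTE -> : val k != n by apply: contra kn => /eqP e'; apply/eqP/val_inj.
by rewrite mul0r.
Qed.

(** The default value is not taken when rho >= 0 and |z0| + rho <= 1. *)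
Definition affine (z0 : disc R) (rho : R) (z : disc R) : disc R :=
  insubd (disc0 R) (disc_val z0 + rho%:C * disc_val z).

Lemma affineE z0 (rho : R) z : 0 <= rho -> normc (disc_val z0) + rho <= 1 ->
  disc_val (affine z0 rho z) = disc_val z0 + rho%:C * disc_val z.
Proof.
move=> r0 h; have z1 := disc_normc z; have z01 := disc_normc z0.
rewrite /affine insubdK//= -[_ \in _]/((normc _)%:C < 1%:C) ltcR.
apply: le_lt_trans (normcD _ _) _; rewrite normcM normc_real ger0_norm//.
have [->|rn] := eqVneq rho 0; first by rewrite mul0r addr0.
apply: lt_le_trans h; rewrite ltrD2l gtr_pMr//.
by rewrite lt_def rn.
Qed.

Lemma analytic_affine f z0 (rho : R) : analytic f -> 0 < rho ->
  normc (disc_val z0) + rho <= 1 -> analytic (fun z => f (affine z0 rho z)).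
Proof.
move=> af r0 h; apply: analytic_intro => z1.
have [a [M [s [s0 M0 aM hf]]]] := analytic_bound (affine z0 rho z1) af.
exists (fun k => a k * rho%:C ^+ k), (s / rho); rewrite divr_gt0//; split => // z.
rewrite ltr_pdivlMr// => zs.
have e : disc_val (affine z0 rho z) - disc_val (affine z0 rho z1) =
    rho%:C * (disc_val z - disc_val z1) by rewrite !affineE ?(ltW r0)//; ring.
have := hf (affine z0 rho z); rewrite e normcM normc_real gtr0_norm// mulrC => /(_ zs) H d d0.
have [N HN] := H d d0; exists N => n /HN.
congr (normc (_ - _) < d); apply: eq_bigr => k _.
by rewrite exprMn mulrA.
Qed.

(** Near a point z0 the function is a multiple of 1 - g with |g| <= 1/2, so that
    its reciprocal is obtained by solving u = 1 + g u in the Hardy space. *)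
Lemma analyticV f : analytic f -> (forall z, f z != 0) -> analytic (fun z => (f z)^-1).
Proof.
move=> af fn0; apply: analytic_intro => z0.
have c0 : 0 < normc (f z0).
  by rewrite lt_def normc_ge0 andbT; apply: contra (fn0 z0) => /eqP/eq0_normc ->.
have [d d0 hd] := analytic_continuous z0 af (divr_gt0 c0 (ltr0n _ 2)).
have z01 := disc_normc z0; have z0n := normc_ge0 (disc_val z0).
pose rho := Num.min d (1 - normc (disc_val z0)) / 2.
have m0 : 0 < Num.min d (1 - normc (disc_val z0)) by rewrite lt_min d0 subr_gt0.
have r0 : 0 < rho by rewrite divr_gt0.
have rm : rho < Num.min d (1 - normc (disc_val z0)) by rewrite ltr_pdivrMr// ltr_pMr// ltr1n.
have [rd r1] : rho < d /\ rho < 1 - normc (disc_val z0) by move: rm; rewrite lt_min => /andP.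
have r1' : normc (disc_val z0) + rho <= 1 by lra.
pose F z := f (affine z0 rho z).
have aF : analytic F by exact: analytic_affine.
pose g z := 1 + (- (f z0)^-1) * F z.
have ag : analytic g := analyticD (analytic_cst 1) (analyticM (analytic_cst _) aF).
have gB z : normc (g z) <= 2^-1.
  have -> : g z = - ((f z0)^-1 * (F z - f z0)) by rewrite /g mulrBr mulVf//; ring.
  rewrite normcN normcM normcV ler_pdivrMl//; apply: ltW; apply: hd.
  rewrite affineE ?(ltW r0)// [X in X - _]addrC addrK normcM normc_real gtr0_norm//.
  apply: le_lt_trans rd; rewrite ler_piMr ?(ltW r0)// ltW//; exact: disc_normc.
have [phi phiE] : exists phi : hinfty R, hinfty_fun phi = g.
  by apply: Hoo_hinfty; split => //; exists 2^-1.
have phiB z : normc (phi z) <= 2^-1 by rewrite phiE.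
have h1 : 2^-1 < 1 :> R by lra.
have [u hu] := neumann (mono R 0) (mulop_bdd phiB) h1.
have alg (a b c : R[i]) : 1 - a * b * c = 1 + (1 + - a * b) * c - c by ring.
have uE z : u z = f z0 / F z.
  have := congr1 (fun w : hardy R => w z) hu.
  rewrite -[X in _ = X -> _]/(mono R 0 z + phi z * u z) mono_val expr0 phiE /g => e.
  have Fz : F z != 0 by exact: fn0.
  apply: (mulIf Fz); rewrite divfK//.
  have : (f z0)^-1 * F z * u z = 1.
    apply/eqP; rewrite eq_sym -subr_eq0; apply/eqP.
    transitivity (1 + (1 + - (f z0)^-1 * F z) * u z - u z); last by rewrite -e subrr.
    exact: alg.
  by move=> /(congr1 (fun x => f z0 * x)); rewrite mulr1 !mulrA mulfV// mul1r mulrC.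
have [M0 [aM hz]] := coefP (@hardy_analytic _ u) (half01 R).
exists (fun k => (f z0)^-1 * coef u k / rho%:C ^+ k), (rho / 2).
rewrite divr_gt0//; split => // z zr e e0.
have rC : rho%:C != 0 :> R[i] by rewrite eqCR gt_eqF.
have wn : normc ((disc_val z - disc_val z0) / rho%:C) < 2^-1.
  rewrite normcM normcV normc_real gtr0_norm// ltr_pdivrMr//; lra.
have [w wE] : exists w : disc R, disc_val w = (disc_val z - disc_val z0) / rho%:C.
  by apply: discE; lra.
have zE : affine z0 rho w = z.
  apply: val_inj; rewrite /= affineE ?(ltW r0)// wE mulrC divfK//.
  by rewrite addrC subrK.
have := hz w; rewrite subr0 wE => /(_ wn).
move=> /(tendsM (tends_cst (f z0)^-1)) /(_ _ e0)[N HN]; exists N => n /HN.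
rewrite uE /F zE mulKf//; congr (normc (_ - _) < e).
rewrite mulr_sumr; apply: eq_bigr => k _.
by rewrite expr_div_n; ring.
Qed.

End BoundedAnalytic.

(** * Dimensions of kernels *)

Section Dimension.
Variable R : realType.
Implicit Types (u v w : hardy R) (T Y L : hardy R -> hardy R) (K : R).

Definition onto T := forall w, exists v, T v = w.

Lemma sum_delta n (e : 'I_n -> hardy R) i : \sum_j (j == i)%:R *: e j = e i.
Proof.
by rewrite (bigD1 i)//= eqxx scale1r big1 ?addr0// => j /negbTE ->; rewrite scale0r.
Qed.

Lemma has_dim_nonzero (K : set (hardy R)) n : (0 < n)%N -> has_dim K n -> exists2 v, K v & v != 0.
Proof.
case: n => // n _ [e [fe ->]]; exists (e ord0).
  by exists (fun j => (j == ord0)%:R); rewrite sum_delta.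
apply/eqP => e0; have := fe (fun j => (j == ord0)%:R).
by rewrite sum_delta => /(_ e0 ord0)/eqP; rewrite eqxx oner_eq0.
Qed.

(** A basis of the kernel of Y T consists of a basis of the kernel of T and of
    preimages of a basis of the kernel of Y. *)
Lemma has_dim_comp T Y n k : linear T -> linear Y -> onto T ->
  has_dim (ker_op T) n -> has_dim (ker_op Y) k ->
  has_dim (ker_op (fun v => Y (T v))) (n + k).
Proof.
move=> lT lY sT [e [fe ke]] [y [fy ky]].
have /choice[d hd] : forall j, exists v, T v = y j by move=> j; exact: sT.
pose b (i : 'I_(n + k)) := match fintype.split i with inl a => e a | inr j => d j end.
have be (c : 'I_(n + k) -> R[i]) : \sum_i c i *: b i =
    \sum_i c (lshift k i) *: e i + \sum_j c (rshift n j) *: d j.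
  rewrite big_split_ord/=; congr (_ + _); apply: eq_bigr => i _; congr (_ *: _).
    by rewrite /b; case: fintype.splitP => j h; [congr e; apply: val_inj|
      have := ltn_ord i; rewrite -[X in (X < _)%N]/(nat_of_ord (lshift k i)) h ltnNge leq_addr].
  rewrite /b; case: fintype.splitP => j h.
    by have := ltn_ord j; rewrite -h /= ltnNge leq_addr.
  by congr d; apply: val_inj; move/eqP: h; rewrite /= eqn_add2l => /eqP.
have Te i : T (e i) = 0.
  have : ker_op T (e i) by rewrite ke; exists (fun j => (j == i)%:R); rewrite sum_delta.
  by [].
have Tc (c : 'I_(n + k) -> R[i]) : T (\sum_i c i *: b i) = \sum_j c (rshift n j) *: y j.
  rewrite be (op_add lT) !(op_sum _ lT) big1 ?add0r; last first.
    by move=> i _; rewrite (op_scale lT) Te scaler0.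
  by apply: eq_bigr => j _; rewrite (op_scale lT) hd.
exists b; split=> [c c0|].
  have cr j : c (rshift n j) = 0.
    by apply: (fy (fun j => c (rshift n j))); rewrite -Tc c0 (op_zero lT).
  have cl i : c (lshift k i) = 0.
    apply: (fe (fun i => c (lshift k i))); rewrite -[RHS]c0 be.
    by rewrite [X in _ + X]big1 ?addr0// => j _; rewrite cr scale0r.
  by move=> i; case: (split_ordP i) => j ->.
apply/seteqP; split=> v /=.
  move=> YTv; have : ker_op Y (T v) by [].
  rewrite ky => -[cy TvE].
  have : ker_op T (v - \sum_j cy j *: d j).
    rewrite /ker_op/= (op_sub lT) (op_sum _ lT) TvE; apply/eqP; rewrite subr_eq0.
    by apply/eqP/eq_bigr => j _; rewrite (op_scale lT) hd.
  rewrite ke => -[ce vE].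
  exists (fun i => match fintype.split i with inl a => ce a | inr j => cy j end).
  rewrite be; apply/eqP; rewrite -subr_eq; apply/eqP.
  have -> : \sum_j match fintype.split (rshift n j) with inl a => ce a | inr j => cy j end *: d j =
      \sum_j cy j *: d j.
    apply: eq_bigr => j _; case: fintype.splitP => i h.
      by have := ltn_ord i; rewrite -h /= ltnNge leq_addr.
    by congr (cy _ *: _); apply: val_inj; move/eqP: h; rewrite /= eqn_add2l => /eqP.
  rewrite vE; apply: eq_bigr => i _; case: fintype.splitP => j h.
    by congr (ce _ *: _); apply: val_inj.
  have := ltn_ord i; rewrite -[X in (X < _)%N]/(nat_of_ord (lshift k i)) h.
  by rewrite ltnNge leq_addr.
move=> [c ->]; rewrite /ker_op/= Tc.
have : ker_op Y (\sum_j c (rshift n j) *: y j) by rewrite ky; exists (fun j => c (rshift n j)).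
by [].
Qed.

Lemma has_dim0 T : (forall v, T v = 0 -> v = 0) -> T 0 = 0 -> has_dim (ker_op T) 0.
Proof.
move=> h T0; exists (fun=> 0); split=> [c _ []//|].
apply/seteqP; split=> v /=.
  by move=> /h ->; exists (fun=> 0); rewrite big_ord0.
by move=> [c ->]; rewrite big_ord0; exact: T0.
Qed.

Lemma ker_comp_inj T Y : (forall v, Y v = 0 -> v = 0) -> Y 0 = 0 ->
  ker_op (fun v => Y (T v)) = ker_op T.
Proof.
move=> h Y0; apply/seteqP; split=> v /=; first by move/h.
by rewrite /ker_op/= => ->.
Qed.

(** A matrix with more rows than columns has a nonzero left kernel. *)
Lemma has_dim_inj_le (K K' : set (hardy R)) n n' L : has_dim K n -> has_dim K' n' ->
  linear L -> (forall v, L v = 0 -> v = 0) -> (forall v, K v -> K' (L v)) -> (n <= n')%N.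
Proof.
move=> [e [fe ke]] [y [fy ky]] lL iL KK'.
have Ke i : K (e i).
  by rewrite ke; exists (fun j => (j == i)%:R); rewrite sum_delta.
have /choice[M hM] : forall i, exists c : 'I_n' -> R[i], L (e i) = \sum_j c j *: y j.
  by move=> i; have := KK' _ (Ke i); rewrite ky.
pose A := \matrix_(i < n, j < n') M i j.
rewrite leqNgt; apply/negP => nn'.
have : kermx A != 0.
  rewrite -mxrank_eq0 mxrank_ker subn_eq0 -ltnNge.
  exact: leq_ltn_trans (rank_leq_col A) nn'.
move=> /rowV0Pn[r /sub_kermxP rA r0].
have : r = 0.
  apply/rowP => i; rewrite mxE; apply: (fe (fun i => r 0 i)); apply: iL.
  rewrite (op_sum _ lL).
  under eq_bigr do rewrite (op_scale lL) hM scaler_sumr.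
  rewrite exchange_big/= big1// => j _.
  under eq_bigr do rewrite scalerA.
  rewrite -scaler_suml; have /matrixP/(_ 0 j) := rA.
  rewrite !mxE => h; suff -> : \sum_i0 r 0 i0 * M i0 j = 0 by rewrite scale0r.
  by rewrite -[RHS]h; apply: eq_bigr => i0 _; rewrite mxE.
by move/eqP; rewrite (negbTE r0).
Qed.

Definition right_invertible T := exists Y K, bdd Y K /\ forall w, T (Y w) = w.

Lemma right_invertible_onto T : right_invertible T -> onto T.
Proof. by move=> [Y [K [_ h]]] w; exists (Y w). Qed.

Lemma right_invertible_comp T T' : right_invertible T -> right_invertible T' ->
  right_invertible (fun v => T (T' v)).
Proof.
move=> [Y [K [bY hY]]] [Y' [K' [bY' hY']]].
exists (fun v => Y' (Y v)), (K' * K); split; first exact: bdd_comp.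
by move=> w; rewrite hY' hY.
Qed.

(** With T Y = 1, the operator T - x is T (1 - x Y), and 1 - x Y is invertible
    for small x: it carries the kernel of T - x onto that of T. *)
Lemma has_dim_perturb T n : linear T -> right_invertible T -> has_dim (ker_op T) n ->
  exists2 d : R, 0 < d & forall (x : R[i]) n', normc x < d ->
    has_dim (ker_op (fun v => T v - x *: v)) n' -> (n <= n')%N.
Proof.
move=> lT [Y [K [bY hY]]] dT; have [lY K0 hK] := bY.
have K1 : 0 < K + 1 by rewrite ltr_wpDl.
exists (K + 1)^-1; first by rewrite invr_gt0.
move=> x n' xd dT'; pose q := normc x * K.
have q1 : q < 1.
  apply: (@le_lt_trans _ _ (normc x * (K + 1))); first by rewrite ler_wpM2l ?normc_ge0 ?lerDl.
  by rewrite -ltr_pdivlMr// mul1r.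
have bX := bdd_scale x bY; have [lX _ hX] := bX.
have /choice[L hL] : forall v, exists u, u = v + x *: Y u by move=> v; exact: neumann bX q1.
have uniq u : u = x *: Y u -> u = 0.
  move=> uE; apply/nrm_eq0/le_anti; rewrite nrm_ge0 andbT.
  have h := hX u; rewrite -uE -/q in h.
  have : (1 - q) * nrm u <= 0 by rewrite mulrBl mul1r subr_le0.
  by rewrite pmulr_rle0// subr_gt0.
have lL : linear L.
  move=> a u v; apply/eqP; rewrite -subr_eq0; apply/eqP/uniq.
  rewrite (op_sub lX) lX {1}hL {1}(hL u) {1}(hL v) scalerDr.
  set A := x *: Y (L (a *: u + v)); set B := a *: (x *: Y (L u)); set C := x *: Y (L v).
  have -> : a *: u + B + (v + C) = (a *: u + v) + (B + C) by rewrite addrACA.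
  by rewrite opprD addrACA subrr add0r.
apply: (has_dim_inj_le dT dT' lL).
  move=> v Lv0; have := hL v; rewrite Lv0 (op_zero lY) scaler0 addr0 => <- //.
move=> v; rewrite /ker_op/= => Tv.
have h : T (L v) = T v + x *: L v by rewrite {1}(hL v) (op_add lT) (op_scale lT) hY.
by rewrite h Tv add0r subrr.
Qed.

End Dimension.

(** * Adjoints of multiplication operators *)

Section Multipliers.
Variable R : realType.
Implicit Types (f g h : disc R -> R[i]) (u v w : hardy R).

(** The product is given by its values, so that one may speak of the adjoint without
    first exhibiting multiplication by f as an operator. *)
Definition mult_adjoint f (A : hardy R -> hardy R) :=
  forall u p v : hardy R, (forall z, p z = f z * u z) -> inner p v = inner u (A v).

Lemma Hoo_mul f (u : hardy R) : Hoo f -> exists p : hardy R, forall z, p z = f z * u z.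
Proof. by move=> /Hoo_hinfty[phi <-]; exists (mulop phi u). Qed.

Lemma mult_adjoint_exists f : Hoo f -> exists A, mult_adjoint f A /\ exists K, bdd A K.
Proof.
move=> Hf; have [_ [B hB]] := Hf; have [phi phiE] := Hoo_hinfty Hf.
have phiB z : normc (phi z) <= B by rewrite phiE.
have [A [hA bA]] := adjoint_exists (mulop_bdd phiB).
exists A; split; last by exists B.
move=> u p v hp; have -> : p = mulop phi u.
  by apply: val_inj; apply/funext => z; rewrite /= phiE; exact: hp.
exact: hA.
Qed.

(** The adjoint of multiplication by f, made total so that symbols can be replaced by
    equal ones. *)
Definition Ad f : hardy R -> hardy R :=
  if pselect (Hoo f) is left Hf then projT1 (cid (mult_adjoint_exists Hf)) else id.

Lemma mult_adjoint_unique f A A' : Hoo f -> mult_adjoint f A -> mult_adjoint f A' -> A = A'.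
Proof.
move=> Hf h h'; apply/funext => v; apply: inner_ext => w.
by have [p hp] := Hoo_mul w Hf; rewrite -(h _ _ _ hp) -(h' _ _ _ hp).
Qed.

Lemma AdP f : Hoo f -> mult_adjoint f (Ad f).
Proof.
move=> Hf; rewrite /Ad; case: pselect => [Hf'|nH]; last by case: (nH Hf).
exact: (projT2 (cid (mult_adjoint_exists Hf'))).1.
Qed.

Lemma Ad_bdd f : Hoo f -> exists K, bdd (Ad f) K.
Proof.
move=> Hf; have [A [hA [K bA]]] := mult_adjoint_exists Hf.
by exists K; rewrite (mult_adjoint_unique Hf (AdP Hf) hA).
Qed.

Lemma Ad_linear f : Hoo f -> linear (Ad f).
Proof. by move=> /Ad_bdd[K []]. Qed.

Lemma Ad_eq f A : Hoo f -> mult_adjoint f A -> Ad f = A.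
Proof. by move=> Hf; exact: mult_adjoint_unique (AdP Hf). Qed.

Lemma HooM f g : Hoo f -> Hoo g -> Hoo (fun z => f z * g z).
Proof.
move=> [af [B hB]] [ag [B' hB']]; split; first exact: analyticM.
exists (B * B') => z; rewrite normcM; apply: ler_pM => //; exact: normc_ge0.
Qed.

Lemma HooD f g : Hoo f -> Hoo g -> Hoo (fun z => f z + g z).
Proof.
move=> [af [B hB]] [ag [B' hB']]; split; first exact: analyticD.
by exists (B + B') => z; apply: le_trans (normcD _ _) _; rewrite lerD.
Qed.

Lemma Hoo_cst (c : R[i]) : Hoo (fun _ : disc R => c).
Proof. by split; [exact: analytic_cst|exists (normc c)]. Qed.

Lemma Hoo_id : Hoo (fun z : disc R => disc_val z).
Proof. by split; [exact: analytic_id|exists 1 => z; rewrite ltW// disc_normc]. Qed.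

Lemma AdM f g : Hoo f -> Hoo g -> Ad (fun z => f z * g z) = fun v => Ad g (Ad f v).
Proof.
move=> Hf Hg; apply: (Ad_eq (HooM Hf Hg)) => u p v hp.
have [q hq] := Hoo_mul u Hg.
rewrite -(AdP Hg _ hq); apply: (AdP Hf) => z.
by rewrite hp hq mulrA.
Qed.

Lemma AdC f g v : Hoo f -> Hoo g -> Ad f (Ad g v) = Ad g (Ad f v).
Proof.
move=> Hf Hg; have e : (fun z => f z * g z) = fun z => g z * f z.
  by apply/funext => z; rewrite mulrC.
have := congr1 (fun F => F v) (AdM Hf Hg); rewrite /= e => <-.
by rewrite AdM.
Qed.

Lemma Ad_cst (c : R[i]) : Ad (fun=> c) = fun v => conjc c *: v.
Proof.
apply: (Ad_eq (Hoo_cst c)) => u p v hp.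
have -> : p = c *: u by apply: val_inj; apply/funext => z; exact: hp.
by rewrite innerZr conjcK innerZl.
Qed.

Lemma AdD f g : Hoo f -> Hoo g -> Ad (fun z => f z + g z) = fun v => Ad f v + Ad g v.
Proof.
move=> Hf Hg; apply: (Ad_eq (HooD Hf Hg)) => u p v hp.
have [a ha] := Hoo_mul u Hf; have [b hb] := Hoo_mul u Hg.
have -> : p = a + b.
  apply: val_inj; apply/funext => z; transitivity (f z * u z + g z * u z).
    by rewrite -mulrDl; exact: hp.
  by rewrite -ha -hb.
by rewrite innerDl innerDr (AdP Hf _ ha) (AdP Hg _ hb).
Qed.

Lemma Hoo_sub f (w : R[i]) : Hoo f -> Hoo (fun z => f z - w).
Proof. by move=> Hf; apply: HooD => //; exact: Hoo_cst. Qed.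

Lemma Ad_sub f (w : R[i]) v : Hoo f -> Ad (fun z => f z - w) v = Ad f v - conjc w *: v.
Proof.
move=> Hf; have := congr1 (fun F => F v) (AdD Hf (Hoo_cst (- w))).
by rewrite /= => ->; rewrite Ad_cst conjN scaleNr.
Qed.

(** ** Multiplication by an invertible function *)

Lemma Ad_inv f g : Hoo f -> Hoo g -> (forall z, f z * g z = 1) ->
  right_invertible (Ad f) /\ (forall v, Ad f v = 0 -> v = 0).
Proof.
move=> Hf Hg fg; have e : (fun z => f z * g z) = fun=> 1 by apply/funext.
have h v : Ad g (Ad f v) = v.
  by have := congr1 (fun F => F v) (AdM Hf Hg); rewrite /= e Ad_cst conjc1 scale1r.
split; last by move=> v Av; rewrite -(h v) Av (op_zero (Ad_linear Hg)).
have [K bK] := Ad_bdd Hg; exists (Ad g), K; split => // w.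
by rewrite AdC.
Qed.

(** ** Linear factors *)

Lemma Hoo_lin (b : R[i]) : Hoo (fun z : disc R => disc_val z - b).
Proof. by apply: Hoo_sub; exact: Hoo_id. Qed.

Lemma coef_Ad_id v n : coef (Ad (fun z => disc_val z) v) n = coef v n.+1.
Proof.
rewrite -inner_mono innerC -(AdP Hoo_id (p := mono R n.+1)); last first.
  by move=> z; rewrite !mono_val exprS.
by rewrite -innerC inner_mono.
Qed.

Lemma coef_Ad_lin (b : R[i]) v n :
  coef (Ad (fun z => disc_val z - b) v) n = coef v n.+1 - conjc b * coef v n.
Proof. by rewrite Ad_sub; [rewrite coef_sub coef_scale coef_Ad_id|exact: Hoo_id]. Qed.

Lemma ker_lin_coef (b : R[i]) v : Ad (fun z => disc_val z - b) v = 0 ->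
  forall n, coef v n = conjc b ^+ n * coef v 0.
Proof.
move=> h; elim=> [|n IH]; first by rewrite mul1r.
have := coef_Ad_lin b v n; rewrite h coef_zero => /esym/eqP; rewrite subr_eq0 => /eqP ->.
by rewrite IH mulrA exprS.
Qed.

(** The coefficients of a vector in the kernel have nondecreasing modulus, so they are
    square-summable only if they vanish. *)
Lemma Ad_lin_inj (b : R[i]) v : 1 <= normc b -> Ad (fun z => disc_val z - b) v = 0 -> v = 0.
Proof.
move=> b1 /ker_lin_coef h; have v0 : coef v 0 = 0.
  apply: contrapT => /eqP n0; have p0 : 0 < normc (coef v 0) ^+ 2.
    rewrite exprn_gt0// lt_def normc_ge0 andbT.
    by apply: contra n0 => /eqP/eq0_normc ->.
  have le n : n%:R * normc (coef v 0) ^+ 2 <= sqn v.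
    apply: le_trans (sqn_ge v n).
    rewrite -[n in n%:R]card_ord mulr_natl -sumr_const; apply: ler_sum => k _.
    rewrite (h k) normcM normcX normc_conj exprMn ler_peMl ?sqr_ge0//.
    by rewrite exprn_ege1// exprn_ege1.
  have [n hn] : exists n, sqn v / normc (coef v 0) ^+ 2 < n%:R.
    exists (Num.bound (sqn v / normc (coef v 0) ^+ 2)).
    by rewrite archi_boundP// divr_ge0 ?sqn_ge0 ?ltW.
  by have := le n; rewrite leNgt -ltr_pdivrMr// hn.
apply: hardy_eq; rewrite coef_zero; apply/funext => n.
by rewrite h v0 mulr0.
Qed.

Lemma szego_subproof (b : disc R) :
  exists v : hardy R, coef v = fun n => conjc (disc_val b) ^+ n.
Proof.
pose q := normc (disc_val b).
have q01 : 0 <= q ^+ 2 < 1.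
  by rewrite sqr_ge0/= exprn_ilt1 ?normc_ge0 ?disc_normc.
apply: (@hardy_of_coef _ _ (1 - q ^+ 2)^-1) => n.
under eq_bigr do rewrite normcX normc_conj exprAC.
exact: geo_sum_le.
Qed.

(** The reproducing kernel at the point b. *)
Definition szego (b : disc R) : hardy R := projT1 (cid (szego_subproof b)).

Lemma coef_szego b : coef (szego b) = fun n => conjc (disc_val b) ^+ n.
Proof. exact: projT2 (cid (szego_subproof b)). Qed.

Lemma has_dim_lin (b : disc R) :
  has_dim (ker_op (Ad (fun z => disc_val z - disc_val b))) 1.
Proof.
exists (fun=> szego b); split=> [c|].
  rewrite big_ord1 => h i; rewrite (ord1 i).
  have := congr1 (fun u : hardy R => coef u 0) h.
  by rewrite /= coef_scale coef_szego coef_zero mulr1.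
apply/seteqP; split=> v /=.
  move=> /ker_lin_coef h; exists (fun=> coef v 0); rewrite big_ord1.
  by apply: hardy_eq; rewrite coef_scale coef_szego; apply/funext => n; rewrite h mulrC.
move=> [c ->]; rewrite big_ord1; apply: hardy_eq; apply/funext => n.
by rewrite coef_Ad_lin !coef_scale coef_szego coef_zero exprS; ring.
Qed.

(** With B the backward shift and S the shift, B S = 1, so the operator B - conj b
    equals B (1 - conj b S), and multiplication by z / (1 - conj b z) is a right
    inverse. *)
Lemma right_invertible_lin (b : disc R) :
  right_invertible (Ad (fun z => disc_val z - disc_val b)).
Proof.
pose bb := conjc (disc_val b).
have bbn : normc bb < 1 by rewrite /bb normc_conj disc_normc.
have lo (z : disc R) : 1 - normc bb <= normc (1 - bb * disc_val z).
  have h : normc (1 : R[i]) <= normc (1 - bb * disc_val z) + normc (bb * disc_val z).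
    by apply: le_trans (normcD _ _); rewrite subrK.
  rewrite normc1 normcM in h.
  have : normc bb * normc (disc_val z) <= normc bb.
    by rewrite ler_piMr ?normc_ge0// ltW// disc_normc.
  lra.
have n0 (z : disc R) : 1 - bb * disc_val z != 0.
  apply/eqP => e; have := lo z; rewrite e normc0; lra.
have a1 : analytic (fun z : disc R => 1 - bb * disc_val z).
  have -> : (fun z : disc R => 1 - bb * disc_val z) = fun z => 1 + (- bb) * disc_val z.
    by apply/funext => z; rewrite mulNr.
  apply: analyticD; first exact: analytic_cst.
  by apply: analyticM; [exact: analytic_cst|exact: analytic_id].
have Hg : Hoo (fun z : disc R => (1 - bb * disc_val z)^-1).
  split; first exact: analyticV.
  exists (1 - normc bb)^-1 => z; rewrite normcV lef_pV2 ?posrE ?lo//.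
    by apply: lt_le_trans (lo z); lra.
  lra.
have Hzg := HooM Hoo_id Hg.
have [_ [B hB]] := Hzg; have [phi phiE] := Hoo_hinfty Hzg.
exists (mulop phi), B; split; first by apply: mulop_bdd => z; rewrite phiE.
move=> w; have [y hy] := Hoo_mul w Hg.
have vE : coef (mulop phi w) = fun n => if n is n'.+1 then coef y n' else 0.
  rewrite -(coefX (@hardy_analytic _ y)); congr coef; apply/funext => z.
  by rewrite -[LHS]/(phi z * w z) phiE hy mulrA.
have wE : coef w = fun n => coef y n - bb * coef (mulop phi w) n.
  have h1 : forall z, w z = y z + (- bb) * (disc_val z * y z).
    move=> z; rewrite hy.
    transitivity ((1 - bb * disc_val z) * ((1 - bb * disc_val z)^-1 * w z)).
      by rewrite mulrA mulfV// mul1r.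
    by move: (_^-1 * w z) => t; ring.
  have ay := @hardy_analytic _ y; have azy := analyticM (@analytic_id R) ay.
  have -> : hardy_fun w = fun z => y z + (- bb) * (disc_val z * y z) by apply/funext.
  rewrite (coefD ay (analyticM (analytic_cst (- bb)) azy)) (coefZ _ azy) (coefX ay) vE.
  by apply/funext => n; rewrite mulNr.
apply: hardy_eq; apply/funext => n.
by rewrite coef_Ad_lin wE vE.
Qed.

(** ** Products of linear factors *)

Definition lin_prod (s : seq R[i]) : disc R -> R[i] := fun z => \prod_(b <- s) (disc_val z - b).

Lemma lin_prod_cons b s : lin_prod (b :: s) = fun z => (disc_val z - b) * lin_prod s z.
Proof. by apply/funext => z; rewrite /lin_prod big_cons. Qed.

Lemma lin_prod_nil : lin_prod [::] = fun=> 1.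
Proof. by apply/funext => z; rewrite /lin_prod big_nil. Qed.

Lemma Hoo_lin_prod s : Hoo (lin_prod s).
Proof.
elim: s => [|b s IH]; first by rewrite lin_prod_nil; exact: Hoo_cst.
by rewrite lin_prod_cons; apply: HooM => //; exact: Hoo_lin.
Qed.

(** The factors commute, so that one with a root outside the open disc can be applied last,
    where its injectivity leaves the kernel unchanged. *)
Lemma has_dim_lin_prod s : has_dim (ker_op (Ad (lin_prod s))) (count (fun b => normc b < 1) s).
Proof.
elim: s => [|b s IH].
  rewrite lin_prod_nil Ad_cst; apply: has_dim0 => [v|]; last exact: scaler0.
  by rewrite conjc1 scale1r.
have Hs := Hoo_lin_prod s; have Hb := Hoo_lin b.
rewrite lin_prod_cons/=; case: ltP => [b1|b1].
  have [b' bE] := discE b1; rewrite AdM//.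
  apply: has_dim_comp => //; [exact: Ad_linear|exact: Ad_linear|by rewrite -bE; apply:
     right_invertible_onto; exact: right_invertible_lin|by rewrite -bE; exact: has_dim_lin].
rewrite add0n; have -> : (fun z => (disc_val z - b) * lin_prod s z) =
    fun z => lin_prod s z * (disc_val z - b) by apply/funext => z; rewrite mulrC.
rewrite AdM// ker_comp_inj//; first by move=> v; exact: Ad_lin_inj.
exact: op_zero (Ad_linear Hb).
Qed.

Lemma right_invertible_lin_prod s : all (fun b => normc b < 1) s ->
  right_invertible (Ad (lin_prod s)).
Proof.
elim: s => [_|b s IH /= /andP[b1 hs]].
  rewrite lin_prod_nil Ad_cst; exists id, 1; split; first by split=> // v; rewrite mul1r.
  by move=> w; rewrite conjc1 scale1r.
have Hs := Hoo_lin_prod s; have Hb := Hoo_lin b.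
rewrite lin_prod_cons AdM//; apply: right_invertible_comp; first exact: IH.
by have [b' <-] := discE b1; exact: right_invertible_lin.
Qed.

End Multipliers.

(** * The local degree of an m-folder function *)

Section LocalDegree.
Variable R : realType.
Implicit Types (f g h phi : disc R -> R[i]) (s : seq R[i]).

(** The adjoint of multiplication by a product is a composition: the factor h
    contributes an invertible operator and each root in the disc one dimension. *)
Lemma Ad_factor f s h : Hoo h -> Hoo (fun z => (h z)^-1) -> (forall z, h z != 0) ->
  (forall z, f z = lin_prod s z * h z) ->
  [/\ Hoo f, has_dim (ker_op (Ad f)) (count (fun b => normc b < 1) s) &
      all (fun b => normc b < 1) s -> right_invertible (Ad f)].
Proof.
move=> Hh Hi h0 fE; have Hs := Hoo_lin_prod s.
have -> : f = fun z => lin_prod s z * h z by apply/funext.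
have hi z : h z * (h z)^-1 = 1 by rewrite mulfV.
have [rh ih] := Ad_inv Hh Hi hi.
split; first exact: HooM.
  rewrite AdM// ker_comp_inj//; first exact: has_dim_lin_prod.
  exact: op_zero (Ad_linear Hh).
move=> hs; rewrite AdM//; apply: right_invertible_comp => //.
exact: right_invertible_lin_prod.
Qed.

Definition dilate (r : R) (z : disc R) : disc R := affine (disc0 R) r z.

Lemma dilateE (r : R) z : 0 <= r <= 1 -> disc_val (dilate r z) = r%:C * disc_val z.
Proof.
by move=> /andP[r0 r1]; rewrite /dilate affineE// ?normc0 ?add0r.
Qed.

Lemma analytic_bounded f (r : R) : analytic f -> 0 <= r < 1 ->
  exists B : R, forall z, normc (disc_val z) <= r -> normc (f z) <= B.
Proof.
move=> af /andP[r0 r1]; pose s := (1 + r) / 2.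
have s01 : 0 < s < 1 by apply/andP; split; rewrite /s; lra.
have rs : r < s by rewrite /s; lra.
have [M hM] := coefP af s01; have [aM _] := hM.
have M0 : 0 <= M by apply: le_trans (aM 0%N); rewrite mulr1 normc_ge0.
exists (M / (1 - r / s)) => z zr; have zs := le_lt_trans zr rs.
rewrite (expands_psum hM zs); apply: le_trans (psum_le aM zs) _.
have /andP[_ q1] := ratio01 (normc_ge0 (disc_val z)) zs.
have /andP[_ q1'] := ratio01 r0 rs.
apply: ler_wpM2l => //; rewrite lef_pV2 ?posrE ?subr_gt0//.
by rewrite lerB// ler_wpM2r// invr_ge0; case/andP: s01 => /ltW.
Qed.

Lemma Hoo_dilate f (r : R) : analytic f -> 0 < r < 1 -> Hoo (fun z => f (dilate r z)).
Proof.
move=> af /andP[r0 r1]; have r01 : 0 <= r < 1 by rewrite ltW.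
split; first by apply: analytic_affine; rewrite // normc0 add0r ltW.
have [B hB] := analytic_bounded af r01; exists B => z; apply: hB.
rewrite dilateE ?(ltW r0) ?(ltW r1)// normcM normc_real gtr0_norm//.
by rewrite ler_piMr ?(ltW r0)// ltW// disc_normc.
Qed.

Lemma Hoo_of_boundary f (r B : R) : analytic f -> 0 <= r < 1 ->
  (forall z, r <= normc (disc_val z) -> normc (f z) <= B) -> Hoo f.
Proof.
move=> af r01 hB; split => //; have [B' hB'] := analytic_bounded af r01.
exists (Num.max B B') => z; rewrite le_max.
have [rz|zr] := leP r (normc (disc_val z)); first by rewrite hB.
by rewrite (hB' z (ltW zr)) orbT.
Qed.

Lemma lin_prod_dilate s (r : R) z : 0 < r < 1 ->
  lin_prod s (dilate r z) = r%:C ^+ size s * lin_prod [seq b / r%:C | b <- s] z.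
Proof.
move=> /andP[r0 r1]; have rC : r%:C != 0 :> R[i] by rewrite eqCR gt_eqF.
have r01 : 0 <= r <= 1 by rewrite !ltW.
elim: s => [|b s IH]; first by rewrite /lin_prod !big_nil mulr1.
rewrite lin_prod_cons IH/= lin_prod_cons dilateE// exprS.
have {1}-> : b = r%:C * (b / r%:C) by rewrite mulrC divfK.
by rewrite -mulrBr; ring.
Qed.

Lemma dilate_factor f s h (r : R) : analytic h -> (forall z, h z != 0) -> 0 < r < 1 ->
  (forall z, f z = lin_prod s z * h z) ->
  [/\ Hoo (fun z => f (dilate r z)),
      has_dim (ker_op (Ad (fun z => f (dilate r z)))) (count (fun b => normc b < r) s) &
      all (fun b => normc b < r) s -> right_invertible (Ad (fun z => f (dilate r z)))].
Proof.
move=> ah h0 r01 fE; have /andP[r0 r1] := r01.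
have rC : r%:C != 0 :> R[i] by rewrite eqCR gt_eqF.
pose c := r%:C ^+ size s; have c0 : c != 0 by rewrite expf_neq0.
pose h' z := c * h (dilate r z).
have Hh' : Hoo h' by apply: HooM; [exact: Hoo_cst|exact: Hoo_dilate].
have h'0 z : h' z != 0 by rewrite mulf_neq0.
have Hi : Hoo (fun z => (h' z)^-1).
  have -> : (fun z => (h' z)^-1) = fun z => c^-1 * (h (dilate r z))^-1.
    by apply/funext => z; rewrite invfM.
  apply: HooM; first exact: Hoo_cst.
  exact: (Hoo_dilate (analyticV ah h0) r01).
have fE' z : f (dilate r z) = lin_prod [seq b / r%:C | b <- s] z * h' z.
  by rewrite fE lin_prod_dilate// /h' -/c; ring.
have sc b : (normc (b / r%:C) < 1) = (normc b < r).
  by rewrite normcM normcV normc_real gtr0_norm// ltr_pdivrMr// mul1r.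
have [H1 H2 H3] := Ad_factor Hh' Hi h'0 fE'.
split => //.
  by move: H2; rewrite count_map; congr (has_dim _ _); apply: eq_count => b /=.
by move=> hs; apply: H3; rewrite all_map; apply: sub_all hs => b /=; rewrite sc.
Qed.

Lemma rooter_roots m phi z0 h : rooter m phi z0 h -> exists s : seq R[i],
  [/\ size s = m, all (fun b => normc b < 1) s, analytic h, (forall z, h z != 0)
    & forall z, phi z - phi z0 = lin_prod s z * h z].
Proof.
move=> [p [pm ps pr [ah h0] pE]].
have [s sE] := closed_field_poly_normal p.
rewrite (monicP pm) scale1r in sE.
exists s; split => //.
- by have := ps; rewrite sE size_prod_XsubC => -[].
- apply/allP => b bs; rewrite -ltcR; apply: pr.
  by rewrite sE root_prod_XsubC.
- move=> z; rewrite pE sE horner_prod /lin_prod; congr (_ * _).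
  by apply: eq_bigr => b _; rewrite hornerXsubC.
Qed.

Lemma roots_radius s : all (fun b => normc b < 1) s ->
  exists r : R, 0 < r < 1 /\ all (fun b => normc b < r) s.
Proof.
elim: s => [_|b s IH /= /andP[b1 /IH[r [/andP[r0 r1] hs]]]].
  by exists 2^-1; split => //; apply/andP; split; lra.
exists (Num.max r ((1 + normc b) / 2)); split.
  by rewrite lt_max r0/= gt_max r1/=; lra.
apply/andP; split; first by rewrite lt_max; apply/orP; right; lra.
by apply: sub_all hs => c cr; rewrite lt_max cr.
Qed.

(** The dimension of the kernel of the adjoint of a dilated multiplier counts
    the zeros of the symbol in a disc, and cannot drop under small perturbations:
    this replaces the argument principle. *)
Lemma local_degree m phi z0 h : analytic phi -> rooter m phi z0 h ->
  exists r eps : R, [/\ 0 < r < 1, 0 < eps,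
    (forall (w : R[i]) (s : seq R[i]) g, normc (w - phi z0) < eps -> analytic g ->
      (forall z, g z != 0) -> (forall z, phi z - w = lin_prod s z * g z) ->
      (m <= count (fun b => (normc b < r)%R) s)%N) &
    exists s, [/\ size s = m, all (fun b => normc b < r) s &
      forall z, phi z - phi z0 = lin_prod s z * h z]].
Proof.
move=> aphi /rooter_roots[s [sm s1 ah h0 fE]].
have [r [r01 sr]] := roots_radius s1.
have [Hd dimd rd] := dilate_factor ah h0 r01 fE.
move: dimd; have -> : count (fun b => normc b < r) s = m.
  by rewrite -sm; apply/eqP; rewrite -all_count.
move=> dimd; have [eps e0 he] := has_dim_perturb (Ad_linear Hd) (rd sr) dimd.
exists r, eps; split => //; last by exists s.
move=> w t g we ag g0 gE; have [_ dimw _] := dilate_factor ag g0 r01 gE.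
apply: (he (conjc (w - phi z0))); first by rewrite normc_conj.
have e : (fun z => phi (dilate r z) - w) =
    fun z => (phi (dilate r z) - phi z0) - (w - phi z0) by apply/funext => z; ring.
move: dimw; rewrite e; congr (has_dim (ker_op _) _).
by apply/funext => v; rewrite -(Ad_sub _ _ Hd).
Qed.

(** If w were omitted, phi - w would be a symbol without zeros, against the count of
    local_degree. *)
Lemma folder_open m phi z0 h : (0 < m)%N -> analytic phi -> rooter m phi z0 h ->
  exists2 eps : R, 0 < eps & forall w, normc (w - phi z0) < eps -> exists z, phi z = w.
Proof.
move=> m0 aphi rh; have [r [eps [r01 e0 H _]]] := local_degree aphi rh.
exists eps => // w we; apply: contrapT => nw.
have := H w [::] (fun z => phi z - w) we; rewrite /= leqn0 => h0.
have : m == 0%N.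
  apply: h0.
  - exact: (analyticD aphi (analytic_cst (- w))).
  - by move=> z; apply/eqP => /eqP; rewrite subr_eq0 => /eqP zw; apply: nw; exists z.
  - by move=> z; rewrite /lin_prod big_nil mul1r.
by rewrite eqn0Ngt m0.
Qed.

Lemma lin_prod_le s z : all (fun b => normc b < 1) s -> normc (lin_prod s z) <= 2 ^+ size s.
Proof.
elim: s => [_|b s IH /= /andP[b1 hs]]; first by rewrite /lin_prod big_nil normc1.
rewrite lin_prod_cons normcM exprS; apply: ler_pM; rewrite ?normc_ge0 ?IH//.
apply: le_trans (normcD _ _) _; rewrite normcN.
have := disc_normc z; lra.
Qed.

Lemma lin_prod_ge s (r : R) : all (fun b => normc b < r) s ->
  exists2 c : R, 0 < c & forall z, r <= normc (disc_val z) -> c <= normc (lin_prod s z).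
Proof.
elim: s => [_|b s IH /= /andP[br /IH[c c0 hc]]].
  by exists 1 => // z _; rewrite /lin_prod big_nil normc1.
exists ((r - normc b) * c); first by rewrite mulr_gt0// subr_gt0.
move=> z rz; rewrite lin_prod_cons normcM; apply: ler_pM; rewrite ?hc//.
- by rewrite subr_ge0 ltW.
- exact: ltW.
apply: le_trans (lerB rz (lexx _)) _; apply: le_trans (normcB_ge _ _); exact: ler_norm.
Qed.

Lemma lin_prod_root s z : lin_prod s z = 0 -> disc_val z \in s.
Proof.
move=> /eqP; rewrite /lin_prod prodf_seq_eq0 => /hasP[b bs /=].
by rewrite subr_eq0 => /eqP ->.
Qed.

(** Values close to phi z0 are only taken away from the unit circle, so that a
    rooter function is bounded and bounded away from 0 near the circle. *)
Lemma rooter_bounded m phi z0 h : folder m phi -> Hoo phi -> rooter m phi z0 h ->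
  [/\ Hoo h, Hoo (fun z => (h z)^-1) & exists s, [/\ size s = m,
    all (fun b => normc b < 1) s & forall z, phi z - phi z0 = lin_prod s z * h z]].
Proof.
move=> [aphi _ hroot] [_ [B hB]] rh.
have [r [eps [r01 e0 H [s [sm sr sE]]]]] := local_degree aphi rh.
have [_ [_ _ ah h0 _]] := rooter_roots rh.
have /andP[r0 r1] := r01; have r01' : 0 <= r < 1 by rewrite ltW.
have s1 : all (fun b => normc b < 1) s.
  by apply: sub_all sr => b br; exact: lt_trans r1.
have far z : r <= normc (disc_val z) -> eps <= normc (phi z - phi z0).
  move=> rz; rewrite leNgt; apply/negP => ze.
  have [h1 /rooter_roots[t [tm t1 ah1 h10 tE]]] := hroot z.
  have tr : all (fun b => normc b < r) t.
    by rewrite all_count eqn_leq count_size tm (H (phi z) t h1).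
  have : lin_prod t z * h1 z = 0 by rewrite -tE subrr.
  move=> /eqP; rewrite mulf_eq0 (negbTE (h10 z)) orbF => /eqP/lin_prod_root zt.
  by have := allP tr _ zt; rewrite ltNge rz.
split; last by exists s.
- have [c c0 hc] := lin_prod_ge sr.
  apply: (@Hoo_of_boundary _ r (2 * B / c) ah r01') => z rz.
  rewrite ler_pdivlMr//; apply: (@le_trans _ _ (normc (phi z - phi z0))).
    by rewrite sE normcM mulrC ler_wpM2r ?normc_ge0// hc.
  apply: le_trans (normcD _ _) _; rewrite normcN.
  have := hB z; have := hB z0; lra.
- apply: (@Hoo_of_boundary _ r (2 ^+ m / eps) (analyticV ah h0) r01') => z rz.
  have hz0 : 0 < normc (h z).
    by rewrite lt_def normc_ge0 andbT; apply: contra (h0 z) => /eqP/eq0_normc ->.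
  rewrite normcV ler_pdivlMr// ler_pdivrMl//.
  apply: le_trans (far z rz) _; rewrite sE normcM mulrC ler_wpM2l ?normc_ge0//.
  by rewrite -sm; exact: lin_prod_le.
Qed.

End LocalDegree.

(** * Density of the span of the eigenvectors *)

Section Density.
Variable R : realType.
Implicit Types (u v w : hardy R) (K : set (hardy R)).

Lemma span_in K v : K v -> linear_span K v.
Proof.
move=> Kv; exists 1%N, (fun=> 1), (fun=> v); split => //.
by rewrite big_ord1 scale1r.
Qed.

Lemma span_add K u v : linear_span K u -> linear_span K v -> linear_span K (u + v).
Proof.
move=> [n [c [e [Ke ->]]]] [k [d [f [Kf ->]]]].
exists (n + k)%N, (fun i => match fintype.split i with inl a => c a | inr b => d b end),
  (fun i => match fintype.split i with inl a => e a | inr b => f b end); split.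
  by move=> i; case: fintype.split.
rewrite big_split_ord/=; congr (_ + _); apply: eq_bigr => i _.
  case: fintype.splitP => j h.
    by have -> : i = j by apply: val_inj.
  by have := ltn_ord i; rewrite -[X in (X < _)%N]/(nat_of_ord (lshift k i)) h ltnNge leq_addr.
case: fintype.splitP => j h.
  by have := ltn_ord j; rewrite -h /= ltnNge leq_addr.
by have -> : i = j by apply: val_inj; move/eqP: h; rewrite /= eqn_add2l => /eqP.
Qed.

Lemma span_scale K (x : R[i]) v : linear_span K v -> linear_span K (x *: v).
Proof.
move=> [n [c [e [Ke ->]]]]; exists n, (fun i => x * c i), e; split => //.
by rewrite scaler_sumr; apply: eq_bigr => i _; rewrite scalerA.
Qed.

Definition closed_span K : set (hardy R) :=
  [set v | forall e : R, 0 < e -> exists2 s, linear_span K s & nrm (v - s) < e].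

Lemma closed_span_in K v : K v -> closed_span K v.
Proof.
by move=> Kv e e0; exists v; [exact: span_in|rewrite subrr nrm0].
Qed.

Lemma closed_span_add K u v : closed_span K u -> closed_span K v -> closed_span K (u + v).
Proof.
move=> hu hv e e0; have e2 : 0 < e / 2 by rewrite divr_gt0.
have [s Ss us] := hu _ e2; have [t St vt] := hv _ e2.
exists (s + t); first exact: span_add.
rewrite opprD addrACA; apply: le_lt_trans (nrmD _ _) _.
by have h := ltrD us vt; rewrite -splitr in h.
Qed.

Lemma closed_span_scale K (x : R[i]) v : closed_span K v -> closed_span K (x *: v).
Proof.
move=> hv e e0; have x0 : 0 < normc x + 1 by rewrite ltr_wpDl ?normc_ge0.
have [s Ss vs] := hv _ (divr_gt0 e0 x0); exists (x *: s); first exact: span_scale.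
rewrite -scalerBr nrmZ; rewrite ltr_pdivlMr// mulrC in vs.
apply: le_lt_trans vs; apply: ler_wpM2r; first exact: nrm_ge0.
by rewrite lerDl.
Qed.

Lemma closed_span_sum K n (c : 'I_n -> R[i]) (F : 'I_n -> hardy R) :
  closed_span K 0 -> (forall i, closed_span K (F i)) -> closed_span K (\sum_i c i *: F i).
Proof.
move=> h0; elim: n c F => [|n IH] c F hF; first by rewrite big_ord0.
rewrite big_ord_recl; apply: closed_span_add; first exact: closed_span_scale (hF _).
by apply: IH => i; exact: hF.
Qed.

Lemma closed_span_lim K v :
  (forall e : R, 0 < e -> exists2 u, closed_span K u & nrm (v - u) < e) -> closed_span K v.
Proof.
move=> h e e0; have e2 : 0 < e / 2 by rewrite divr_gt0.
have [u hu vu] := h _ e2; have [s Ss us] := hu _ e2.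
exists s => //; have -> : v - s = (v - u) + (u - s) by rewrite addrA subrK.
apply: le_lt_trans (nrmD _ _) _.
by have h' := ltrD vu us; rewrite -splitr in h'.
Qed.

Lemma closure_nrm K v : closed_span K v -> closure (linear_span K) v.
Proof.
move=> h B /nbhs_ballP[e /= e0 eB].
have eR : e = (complex.Re e)%:C by apply/esym/RRe_real/gtr0_real.
rewrite eR ltcR in e0; have [s Ss vs] := h _ e0.
exists s; split => //; apply: eB; rewrite -ball_normE /=.
by rewrite nrmE eR ltcR.
Qed.

(** Once the lower monomials are available, the kernel at a small point t is, up to
    the factor t^n, a small perturbation of the n-th monomial. *)
Lemma mono_closed_span K : (forall b, K (szego b)) -> forall n, closed_span K (mono R n).
Proof.
move=> hK; have c0 : closed_span K 0.
  by rewrite -(scale0r (szego (disc0 R))); apply: closed_span_scale; exact: closed_span_in.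
elim/ltn_ind => n IH; apply: closed_span_lim => e e0.
pose t := Num.min 2^-1 (e / 4).
have t0 : 0 < t by rewrite lt_min divr_gt0// andbT; lra.
have th : t <= 2^-1 by rewrite ge_min lexx.
have te : t <= e / 4 by rewrite ge_min lexx orbT.
have tn : normc t%:C = t by rewrite normc_real gtr0_norm.
have [b bE] : exists b : disc R, disc_val b = t%:C by apply: discE; lra.
have tC : t%:C != 0 :> R[i] by rewrite eqCR gt_eqF.
pose d := \sum_(j < n) t%:C ^+ j *: mono R j.
exists ((t%:C ^+ n)^-1 *: (szego b - d)).
  apply: closed_span_scale; rewrite -scaleN1r; apply: closed_span_add.
    exact: closed_span_in.
  apply: closed_span_scale; apply: (closed_span_sum _ c0) => j.
  exact: IH (ltn_ord j).
apply: (@le_lt_trans _ _ (2 * t)); last lra.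
have cd k : coef d k = if (k < n)%N then t%:C ^+ k else 0.
  rewrite coef_sum; case: ltnP => [kn|nk].
    rewrite (bigD1 (Ordinal kn))//= coef_scale coef_mono eqxx mulr1 big1 ?addr0// => j jk.
    rewrite coef_scale coef_mono; have /negbTE -> : k != val j.
      by apply: contra jk => /eqP ek; apply/eqP/val_inj.
    by rewrite mulr0.
  rewrite big1// => j _; rewrite coef_scale coef_mono; have := ltn_ord j.
  by case: eqP => [<-|_]; [rewrite ltnNge nk|rewrite mulr0].
have cj : conjc t%:C = t%:C :> R[i] by rewrite /= oppr0.
have cf k : coef (mono R n - (t%:C ^+ n)^-1 *: (szego b - d)) k =
    if (k <= n)%N then 0 else - t%:C ^+ (k - n).
  rewrite coef_sub coef_scale coef_sub coef_mono coef_szego cd bE cj.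
  have [kn|nk|->] := ltngtP k n.
  - by rewrite subrr mulr0 subr0.
  - rewrite subr0 sub0r; congr (- _).
    by rewrite -{1}(subnK (ltnW nk)) exprD mulrC mulfK// expf_neq0.
  - by rewrite subr0 mulVf ?subrr// expf_neq0.
apply: nrm_le; first lra.
move=> N; apply: le_trans (psums_mono _ (leq_addl n.+1 N)) _.
rewrite big_split_ord/= big1 ?add0r; last first.
  by move=> i _; rewrite cf -ltnS ltn_ord normc0 expr0n.
apply: (@le_trans _ _ (\sum_(i < N) t ^+ 2 * (t ^+ 2) ^+ i)).
  apply: ler_sum => i _; rewrite cf leqNgt leq_addr/= normcN normcX tn.
  by rewrite addSn subSn ?leq_addr// addKn -!exprM -exprD mulSn [(i * 2)%N]mulnC.
rewrite -mulr_sumr exprMn [leRHS]mulrC; apply: ler_wpM2l; first exact: sqr_ge0.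
have t2 : 0 <= t ^+ 2 < 1.
  by rewrite sqr_ge0/= expr2; apply: (@le_lt_trans _ _ (1 * t)); [rewrite ler_wpM2r|]; lra.
apply: le_trans (geo_sum_le _ t2) _.
have h34 : 4^-1 <= 1 - t ^+ 2.
  have : t ^+ 2 <= 2^-1 * 2^-1 by rewrite expr2; apply: ler_pM; lra.
  lra.
have p0 : 0 < 1 - t ^+ 2 by apply: lt_le_trans h34; lra.
have -> : 2 ^+ 2 = 4 :> R by rewrite expr2; lra.
by rewrite -[leLHS]mul1r ler_pdivrMr//; lra.
Qed.

Lemma szego_dense K : (forall b, K (szego b)) -> closure (linear_span K) = setT.
Proof.
move=> hK; apply/seteqP; split=> // v _; apply: closure_nrm; apply: closed_span_lim => e e0.
have [N /(_ N (leqnn N)) hN] := trunc_near v (divr_gt0 e0 (ltr0n _ 2)).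
exists (trunc v N); last by apply: le_lt_trans hN _; lra.
have hm := mono_closed_span hK.
apply: closed_span_sum => [|i]; last exact: hm.
rewrite -(scale0r (mono R 0)); exact: closed_span_scale (hm 0%N).
Qed.

Lemma reproducing v b : inner v (szego b) = v b.
Proof.
apply: tends_unique (inner_lim _ _) _; apply: tends_ext (hardy_psum v b) => n.
by apply: eq_bigr => k _; rewrite coef_szego conjX conjcK.
Qed.

(** Evaluation at b turns multiplication by f into the scalar f b. *)
Lemma szego_eigen (f : disc R -> R[i]) b : Hoo f -> Ad f (szego b) = conjc (f b) *: szego b.
Proof.
move=> Hf; apply: inner_ext => w; have [p hp] := Hoo_mul w Hf.
by rewrite -(AdP Hf _ hp) innerZr conjcK !reproducing hp.
Qed.

End Density.

(** * The range of an analytic function *)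

Section Range.
Variable R : realType.
Implicit Types (f : disc R -> R[i]).

Lemma spoke_subproof (z : disc R) (t : R) : `|(sin t)%:C * disc_val z| < 1.
Proof.
rewrite -[X in X < _]/((normc _)%:C) -[1]/(1%:C) ltcR normcM normc_real.
apply: le_lt_trans (disc_normc z); rewrite ler_piMl ?normc_ge0//.
by rewrite ler_norml sin_geN1 sin_le1.
Qed.

(** The sine keeps the point on the segment through 0 inside the disc for every
    real parameter. *)
Definition spoke (z : disc R) (t : R) : disc R := Disc (spoke_subproof z t).

Lemma continuous_spoke f (z : disc R) : analytic f ->
  continuous (fun t : R => conjc (f (spoke z t)) : R[i]^o).
Proof.
move=> af t0; apply/cvgrPdist_lt => e e0.
have eR : e = (complex.Re e)%:C by apply/esym/RRe_real/gtr0_real.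
rewrite eR ltcR in e0.
have [d d0 hd] := analytic_continuous (spoke z t0) af e0.
have /cvgrPdist_lt/(_ _ d0) hs := @continuous_sin R t0.
near=> t; rewrite eR -[X in X < _]/((normc _)%:C) ltcR -conjB normc_conj normcB_sym.
apply: hd; rewrite /= -mulrBl -realCB normcM normc_real.
apply: (@le_lt_trans _ _ (`|sin t - sin t0|)).
  by rewrite ler_piMr// ltW// disc_normc.
by rewrite distrC; near: t.
Unshelve. all: by end_near. Qed.

(** The range is a union of curves through the value at 0. *)
Lemma range_connected f : analytic f ->
  connected ([set conjc (f z) | z in [set: disc R]] : set R[i]^o).
Proof.
move=> af; pose S (z : disc R) := (fun t : R => conjc (f (spoke z t)) : R[i]^o) @` [set: R].
have -> : [set conjc (f z) | z in [set: disc R]] = \bigcup_(z in [set: disc R]) S z.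
  apply/seteqP; split=> [_ [z _ <-]|_ [z _ [t _ <-]]]; last by exists (spoke z t).
  exists z => //; exists (pi / 2) => //; congr (conjc (f _)).
  by apply: val_inj; rewrite /= sin_pihalf mul1r.
apply: bigcup_connected.
  exists (conjc (f (disc0 R))) => z _; exists 0 => //; congr (conjc (f _)).
  by apply: val_inj; rewrite /= sin0 mul0r.
move=> z _; apply: connected_continuous_connected.
  by apply/connected_intervalP => x y _ _ u _.
by apply: continuous_subspaceT; exact: continuous_spoke.
Qed.

Lemma range_open f : (forall z0, exists2 eps : R, 0 < eps &
    forall w, normc (w - f z0) < eps -> exists z, f z = w) ->
  open ([set conjc (f z) | z in [set: disc R]] : set R[i]^o).
Proof.
move=> h; rewrite openE => _ [z0 _ <-]; have [eps e0 he] := h z0.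
apply/nbhs_ballP; exists eps%:C; first by rewrite /= ltcR.
move=> q; rewrite -ball_normE/= -[X in X < _]/((normc _)%:C) ltcR => hq.
have [|z zE] := he (conjc q); last by exists z => //; rewrite zE conjcK.
by rewrite -normc_conj conjB conjcK normcB_sym.
Qed.

End Range.

(** * The adjoint multiplier *)

Theorem theorem3p6 (R : realType) (m : nat) (hm : (0 < m)%N) (phi : hinfty R)
  (hphi : folder m phi)
  (hout : forall (z0 : disc R) (h : disc R -> R[i]),
    rooter m phi z0 h -> outer h) :
  cowen_douglas_function phi /\ adjoint_in_class phi m.
Proof.
suff h : adjoint_in_class phi m by split => //; exists m.
have [aphi _ hroot] := hphi.
have Hphi : Hoo phi by split; [exact: hinfty_analytic|exact: hinfty_bounded].
have [K bK] := Ad_bdd Hphi.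
exists (Ad phi); split.
  by move=> u v; apply: (AdP Hphi).
have shiftE z0 : shift_op (Ad phi) (conjc (phi z0)) = Ad (fun z => phi z - phi z0).
  by apply/funext => v; rewrite Ad_sub.
have key z0 : right_invertible (Ad (fun z => phi z - phi z0)) /\
    has_dim (ker_op (Ad (fun z => phi z - phi z0))) m.
  have [h rh] := hroot z0; have [Hh Hi [s [sm s1 sE]]] := rooter_bounded hphi Hphi rh.
  have [_ [_ _ _ h0 _]] := rooter_roots rh.
  have [_ H1 H2] := Ad_factor Hh Hi h0 sE; split; first exact: H2.
  by move: H1; rewrite (_ : count _ s = m)// -sm; apply/eqP; rewrite -all_count.
split; split.
- apply: range_open => z0; have [h rh] := hroot z0; exact: folder_open hm aphi rh.
- exact: range_connected.
- by apply/bddP; exists K.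
- move=> _ [z0 _ <-] [S [_ TS _]].
  have [v Kv /eqP v0] := has_dim_nonzero hm (key z0).2; apply: v0.
  rewrite -shiftE in Kv; rewrite -[LHS]TS Kv.
  have T0 : shift_op (Ad phi) (conjc (phi z0)) 0 = 0.
    by rewrite /shift_op (op_zero (Ad_linear Hphi)) scaler0 subrr.
  by rewrite -[in LHS]T0 TS.
- move=> _ [z0 _ <-]; rewrite shiftE; apply/seteqP; split=> // w _.
  by have [v vE] := right_invertible_onto (key z0).1 w; exists v.
- apply: szego_dense => b; exists (conjc (phi b)); first by exists b.
  by rewrite /ker_op/= /shift_op szego_eigen// subrr.
- by move=> _ [z0 _ <-]; rewrite shiftE; exact: (key z0).2.
Qed.
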